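(* There exist an Orlicz function $\Psi$ such that $H^{3+\varepsilon}\subseteq H^\Psi\subseteq H^3$ for every $\varepsilon>0$, and an analytic self-map $\phi\colon\mathbb{D}\to\mathbb{D}$ such that the composition operator $C_\phi$ is compact on $H^3$ and on $H^{3+\varepsilon}$ for every $\varepsilon>0$, but is not compact on $H^\Psi$.
   Context: $\mathbb{D}$ is the open unit disk of $\mathbb{C}$, $\mathbb{T}=\partial\mathbb{D}$, and $m$ is normalized Lebesgue measure on $\mathbb{T}$. $H^p$ denotes the classical Hardy space on $\mathbb{D}$. For an analytic self-map $\phi\colon\mathbb{D}\to\mathbb{D}$, $C_\phi$ is the composition operator $f\mapsto f\circ\phi$. An Orlicz function is a non-decreasing convex function $\Psi\colon[0,\infty]\to[0,\infty]$ with $\Psi(0)=0$, $\Psi(\infty)=\infty$, which is moreover assumed to be continuous at $0$, strictly convex on $[0,\infty)$ (hence finite and increasing there), and such that $\Psi(x)/x\to\infty$ as $x\to\infty$. $L^\Psi(\mathbb{T})$ is the space of (classes of) measurable $f\colon\mathbb{T}\to\mathbb{C}$ for which there is $C>0$ with $\int_{\mathbb{T}}\Psi(|f|/C)\,dm<+\infty$; the Luxemburg norm $\|f\|_\Psi$ is the infimum of the constants $C>0$ such that this integral is $\le 1$. The Hardy-Orlicz space $H^\Psi$ is the space of all $f\in H^1$ whose boundary function $f^*$ lies in $L^\Psi(\mathbb{T})$, normed by $\|f^*\|_\Psi$. Every composition operator is bounded on every $H^p$ and on every $H^\Psi$. *)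

(* Defs.v *)
From HB Require Import structures.
From mathcomp Require Import all_boot all_order all_algebra.
From mathcomp Require Import complex.
From mathcomp Require Import all_classical all_reals all_analysis.

Set Implicit Arguments.
Unset Strict Implicit.
Unset Printing Implicit Defensive.

Import Order.TTheory GRing.Theory Num.Theory.
Import numFieldNormedType.Exports.

Local Open Scope classical_set_scope.
Local Open Scope ring_scope.
Local Open Scope complex_scope.

(* Functions on the unit disk D, or on the unit circle T, are total functions
   R[i] -> R[i] (or R[i] -> \bar R) whose values elsewhere are never used.
   The modulus is [normc : R[i] -> R]; MathComp's `|z| lives in R[i]. *)

Definition normc {R : realType} (z : R[i]) : R := ComplexField.Normc.normc z.

Definition disk {R : realType} : set R[i] := [set z | normc z < 1].

(* The base field of R[i]^o is R[i], so this is complex differentiability. *)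
Definition analytic_on_disk (R : realType) (f : R[i] -> R[i]) : Prop :=
  forall z, disk z -> derivable (f : R[i]^o -> R[i]^o) z 1.

Definition self_map (R : realType) (phi : R[i] -> R[i]) : Prop :=
  analytic_on_disk phi /\ forall z, disk z -> disk (phi z).

Definition expi {R : realType} (t : R) : R[i] := cos t +i* sin t.

(* Integral over T with respect to m: m is the image under expi of the
   Lebesgue measure of [0, 2 pi] divided by 2 pi. *)
Definition circle_integral (R : realType) (g : R[i] -> \bar R) : \bar R :=
  (((2 * pi)^-1)%:E *
     \int[@lebesgue_measure R]_(t in `[0%R, (2 * pi)%R]) g (expi t))%E.

Definition circle_measurable (R : realType) (f : R[i] -> R[i]) : Prop :=
  measurable_fun (`[0, 2 * pi] : set R) (fun t : R => complex.Re (f (expi t))) /\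
  measurable_fun (`[0, 2 * pi] : set R) (fun t : R => complex.Im (f (expi t))).

Section Hardy.
Context {R : realType}.
Implicit Types (p r : R) (f : R[i] -> R[i]).

Definition hardy_norm p f : \bar R :=
  ereal_sup
    [set (circle_integral
            (fun xi => (normc (f (r%:C * xi)) `^ p)%:E) `^ p^-1)%E
    | r in `]0, 1[].

Definition hardy p : set (R[i] -> R[i]) :=
  [set f | analytic_on_disk f /\ (hardy_norm p f < +oo)%E].

(* [lim] has a fixed default value at the points of T where the radial limit
   does not exist; for f in hardy 1 these points form an m-null set. *)
Definition boundary f (xi : R[i]) : R[i] :=
  lim ((f (r%:C * xi) : R[i]^o) @[r --> (1 : R)^'-]).

End Hardy.

Record orlicz_function (R : realType) (Psi : \bar R -> \bar R) : Prop := {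
  orlicz_ge0 : forall x, (0 <= x)%E -> (0 <= Psi x)%E;
  orlicz_at0 : Psi 0%E = 0%E;
  orlicz_aty : Psi +oo%E = +oo%E;
  orlicz_nondecreasing :
    forall x y, (0 <= x)%E -> (x <= y)%E -> (Psi x <= Psi y)%E;
  orlicz_convex : forall (x y : \bar R) (t : R),
    (0 <= x)%E -> (0 <= y)%E -> 0 < t < 1 ->
    (Psi (t%:E * x + (1 - t)%:E * y) <=
       t%:E * Psi x + (1 - t)%:E * Psi y)%E;
  orlicz_strictly_convex : forall x y t : R,
    0 <= x -> 0 <= y -> x != y -> 0 < t < 1 ->
    (Psi (t * x + (1 - t) * y)%:E <
       t%:E * Psi x%:E + (1 - t)%:E * Psi y%:E)%E;
  orlicz_continuous_at0 : Psi x%:E @[x --> (0 : R)^'+] --> 0%E;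
  orlicz_superlinear : (Psi x%:E * (x^-1)%:E)%E @[x --> +oo%R] --> +oo%E
}.

Section HardyOrlicz.
Context {R : realType}.
Implicit Types (Psi : \bar R -> \bar R) (f : R[i] -> R[i]).

Definition modular Psi (C : R) f : \bar R :=
  circle_integral (fun xi => Psi (normc (f xi) / C)%:E).

Definition orlicz_space Psi : set (R[i] -> R[i]) :=
  [set f | circle_measurable f /\
           exists2 C : R, 0 < C & (modular Psi C f < +oo)%E].

Definition luxemburg Psi f : \bar R :=
  ereal_inf [set C%:E | C in [set C : R | 0 < C /\ (modular Psi C f <= 1)%E]].

Definition hardy_orlicz Psi : set (R[i] -> R[i]) :=
  [set f | hardy 1 f /\ orlicz_space Psi (boundary f)].

Definition hardy_orlicz_norm Psi f : \bar R := luxemburg Psi (boundary f).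

End HardyOrlicz.

(* The composition operator f |-> f \o phi is compact on the space X with norm
   N: every bounded sequence of X has a subsequence whose image converges to
   an element of X. Stability of X under the operator is not a clause of the
   definition, so that it does not make the negation easier; on the spaces
   hardy p and hardy_orlicz Psi it holds for every self-map phi. *)
Definition compact_composition (R : realType) (X : set (R[i] -> R[i]))
    (N : (R[i] -> R[i]) -> \bar R) (phi : R[i] -> R[i]) : Prop :=
  forall u : nat -> (R[i] -> R[i]),
    (forall n, X (u n)) ->
    (exists M : R, forall n, (N (u n) <= M%:E)%E) ->
    exists s : nat -> nat, exists g : R[i] -> R[i],
      [/\ {homo s : m n / (m < n)%N}, X g &
          N ((u (s n) \o phi) \- g) @[n --> \oo] --> 0%E].

(* Main.v *)
(* The symbol is phi = (1 + W) / 2 with W a lacunary power series with positive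
   coefficients p_j of size j^2 2^-j and sum 1. Its contact with the circle is
   confined to the point 1: the term of index j gives
   1 - |phi(z)| >= (p_j / 4) (1 - Re z^(2^j)), and summing over dyadic shells
   around 1 the integrals of 1 / (1 - |phi|) over small neighbourhoods of 1 tend
   to 0. With the growth estimate |f(z)|^p <= C / (1 - |z|) this makes C_phi
   compact on H^p for all p >= 1.
   The function Psi(x) = x^3 + sum_n a_n (x - x_n)^+ has x_n = 2^(4^n) and
   a_n = 2^(7n) x_n^2: the slopes increase so sparsely that Psi(x) is bounded by
   a multiple of 1 + x^(3 + eps), yet Psi(2 x_n) exceeds Psi(x_n) by a factor of
   order 2^(7n). The functions u_n = x_n ((1 - r) / (1 - r z))^2 with
   1 - r = 1 / (2 x_n^3) lie in the unit ball of H^Psi, and |u_n o phi| is at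
   least x_n / 4 on an arc of length about (1 - r) / log(1 / (1 - r))^3 at 1.
   A dilation by a constant brings this to 2 x_n, where the factor 2^(7n) beats
   the cube of the logarithm, which is of order 2^(6n); so no subsequence of
   u_n o phi is Cauchy.
   The inclusion of H^Psi in H^3 is Smirnov's theorem. For f in H^1 let H be a
   limit of the Herglotz integrals of (1 + |f_rho|)^(1/2); then |f| <= 4 |H|^2 and
   Re H >= 1. The quotient f = (f / H^2) / (1 / H)^2 of bounded functions gives
   the radial limits, and Re H is at most the Poisson integral of
   (1 + |f*|)^(1/2), so that M. Riesz's inequality for the exponent 6 bounds the
   means of |f|^3. *)
Require Import Defs.
From HB Require Import structures.
From mathcomp Require Import all_boot all_order all_algebra.
From mathcomp Require Import complex.
From mathcomp Require Import all_classical all_reals all_analysis.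
From mathcomp Require Import measurable_realfun zify ring lra.

Set Implicit Arguments.
Unset Strict Implicit.
Unset Printing Implicit Defensive.

Import Order.TTheory GRing.Theory Num.Theory.
Import numFieldNormedType.Exports.
Local Open Scope classical_set_scope.
Local Open Scope ring_scope.
Local Open Scope complex_scope.

(** Compactness on [hardy p] follows from one condition on the symbol in which [p] does not occur,
    while on an Orlicz space the values of [Psi] at a point and at a fixed multiple of it compete.
    Powers gain only a bounded factor under dilation; sparse kinks let the gain be unbounded without
    leaving the gap between the exponent 3 and every larger one. The weights of the symbol balance
    two sums: the reciprocals of j^2 are summable, which gives the vanishing tails, while the sum of
    j^2 up to J is of order J^3, which gives the cube of the logarithm in the length of the arc. The
    obstacle in Smirnov's theorem is that, for a function of H^1, limits of Poisson integrals along
    growing radii could retain a singular part that the boundary values do not see. Taking a square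
    root removes it: the functions (1 + |f_rho|)^(1/2) are bounded in L^2, hence uniformly
    integrable, and truncation identifies their limit. The price is the exponent 6 = 2 * 3, an even
    integer, for which Riesz's inequality is a polynomial inequality combined with the mean value
    property. *)

#[global] Arguments Defs.normc : simpl never.
#[global] Arguments Defs.disk : simpl never.

(** * Modulus, real and imaginary parts, points of the circle *)

Section ComplexModulus.
Variable R : realType.
Implicit Types (z w : R[i]) (x y t : R).

Lemma normcE z : normc z = Num.sqrt (complex.Re z ^+ 2 + complex.Im z ^+ 2).
Proof. by case: z. Qed.

Lemma normc_ge0 z : 0 <= normc z.
Proof. by rewrite normcE sqrtr_ge0. Qed.

Lemma normc_sqr z : normc z ^+ 2 = complex.Re z ^+ 2 + complex.Im z ^+ 2.
Proof. by rewrite normcE sqr_sqrtr// addr_ge0// sqr_ge0. Qed.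

Lemma normc0 : normc (0 : R[i]) = 0.
Proof. by rewrite normcE /= expr0n addr0 sqrtr0. Qed.

Lemma normc1 : normc (1 : R[i]) = 1.
Proof. exact: ComplexField.Normc.normc1. Qed.

Lemma normcM z w : normc (z * w) = normc z * normc w.
Proof. exact: ComplexField.Normc.normcM. Qed.

Lemma normcV z : normc z^-1 = (normc z)^-1.
Proof. exact: ComplexField.Normc.normcV. Qed.

Lemma normcf z w : normc (z / w) = normc z / normc w.
Proof. by rewrite normcM normcV. Qed.

Lemma normcX z n : normc (z ^+ n) = normc z ^+ n.
Proof. by elim: n => [|n ih]; rewrite ?expr0 ?normc1// !exprS normcM ih. Qed.

Lemma normcD z w : normc (z + w) <= normc z + normc w.
Proof. exact: le_normcD. Qed.

Lemma normcN z : normc (- z) = normc z.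
Proof. by rewrite !normcE; case: z => a b /=; rewrite !sqrrN. Qed.

Lemma normcB z w : normc (z - w) <= normc z + normc w.
Proof. by rewrite -(normcN w); exact: normcD. Qed.

Lemma normc_sub z w : normc (z - w) = normc (w - z).
Proof. by rewrite -normcN opprB. Qed.

Lemma normc_tri z w v : normc (z - v) <= normc (z - w) + normc (w - v).
Proof. by apply: le_trans (normcD _ _); rewrite subrKA. Qed.

Lemma normcB_ge z w : normc z - normc w <= normc (z - w).
Proof. by rewrite lerBlDr; apply: le_trans (normcD _ _); rewrite subrK. Qed.

Lemma normc_dist z w : `|normc z - normc w| <= normc (z - w).
Proof.
rewrite ler_norml lerNl opprB normcB_ge andbT normc_sub; exact: normcB_ge.
Qed.

Lemma normc_eq0 z : (normc z == 0) = (z == 0).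
Proof.
apply/eqP/eqP => [|->]; last exact: normc0.
exact: ComplexField.Normc.eq0_normc.
Qed.

Lemma normc_gt0 z : (0 < normc z) = (z != 0).
Proof. by rewrite lt_def normc_eq0 normc_ge0 andbT. Qed.

Lemma normc_real x : normc x%:C = `|x|.
Proof. by rewrite normcE /= expr0n addr0 sqrtr_sqr. Qed.

Lemma normc_Re z : `|complex.Re z| <= normc z.
Proof. by rewrite normcE -sqrtr_sqr ler_wsqrtr// lerDl sqr_ge0. Qed.

Lemma normc_Im z : `|complex.Im z| <= normc z.
Proof. by rewrite normcE -sqrtr_sqr ler_wsqrtr// lerDr sqr_ge0. Qed.

Lemma normc_le_ReIm z : normc z <= `|complex.Re z| + `|complex.Im z|.
Proof.
rewrite -[leRHS]ger0_norm ?addr_ge0// -sqrtr_sqr normcE ler_wsqrtr//.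
rewrite sqrrD !real_normK ?num_real// lerD2r lerDl.
by rewrite mulrn_wge0// mulr_ge0.
Qed.

Lemma normc_conj z : normc z^* = normc z.
Proof. by rewrite !normcE; case: z => a b /=; rewrite sqrrN. Qed.

Lemma mulc_conj z : z * z^* = (normc z ^+ 2)%:C.
Proof.
rewrite normc_sqr; case: z => a b; apply/eqP.
by rewrite eq_complex /=; apply/andP; split; apply/eqP; ring.
Qed.

Lemma ReD z w : complex.Re (z + w) = complex.Re z + complex.Re w.
Proof. by case: z w => [a b] [c d]. Qed.
Lemma ImD z w : complex.Im (z + w) = complex.Im z + complex.Im w.
Proof. by case: z w => [a b] [c d]. Qed.
Lemma ReN z : complex.Re (- z) = - complex.Re z.
Proof. by case: z. Qed.
Lemma ImN z : complex.Im (- z) = - complex.Im z.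
Proof. by case: z. Qed.
Lemma ReM z w : complex.Re (z * w) =
  complex.Re z * complex.Re w - complex.Im z * complex.Im w.
Proof. by case: z w => [a b] [c d]. Qed.
Lemma ImM z w : complex.Im (z * w) =
  complex.Re z * complex.Im w + complex.Im z * complex.Re w.
Proof. by case: z w => [a b] [c d]. Qed.
Lemma Re_conj z : complex.Re z^* = complex.Re z. Proof. by case: z. Qed.
Lemma Im_conj z : complex.Im z^* = - complex.Im z. Proof. by case: z. Qed.

Lemma complexP z w :
  complex.Re z = complex.Re w -> complex.Im z = complex.Im w -> z = w.
Proof. by case: z w => [a b] [c d] /= -> ->. Qed.

Lemma Re_le_normc z : complex.Re z <= normc z.
Proof. exact: le_trans (ler_norm _) (normc_Re _). Qed.

Lemma normc_expi t : normc (expi t) = 1.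
Proof. by rewrite normcE /= cos2Dsin2 sqrtr1. Qed.

Lemma expi_neq0 t : expi t != 0.
Proof. by rewrite -normc_gt0 normc_expi. Qed.

Lemma expi0 : expi (0 : R) = 1.
Proof. by rewrite /expi cos0 sin0. Qed.

Lemma expi_2pi : expi (2 * pi : R) = 1.
Proof. by rewrite /expi mulr_natl cos2pi sin2pi. Qed.

Lemma expiD x y : expi (x + y) = expi x * expi y.
Proof.
apply/complexP; rewrite ?ReM ?ImM /= ?cosD ?sinD; ring.
Qed.

Lemma expiN x : expi (- x) = (expi x)^*.
Proof. by rewrite /expi cosN sinN. Qed.

Lemma expi_mul_conj x : expi x * (expi x)^* = 1.
Proof. by rewrite mulc_conj normc_expi expr1n. Qed.

Lemma expiX x n : expi x ^+ n = expi (n%:R * x).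
Proof.
elim: n => [|n ih]; first by rewrite mul0r expi0.
by rewrite exprS ih -expiD -natr1 mulrDl mul1r addrC.
Qed.

Lemma normc_realM x z : normc (x%:C * z) = `|x| * normc z.
Proof. by rewrite normcM normc_real. Qed.

Lemma ReZ x z : complex.Re (x%:C * z) = x * complex.Re z.
Proof. by rewrite ReM /= mul0r subr0. Qed.
Lemma ImZ x z : complex.Im (x%:C * z) = x * complex.Im z.
Proof. by rewrite ImM /= mul0r addr0. Qed.

Lemma disk_realM x t : 0 <= x < 1 -> disk (x%:C * expi t).
Proof.
move=> /andP[x0 x1]; change (normc (x%:C * expi t) < 1).
by rewrite normc_realM normc_expi mulr1 ger0_norm.
Qed.

Lemma cvg_normcP (T : Type) (F : set_system T) (FF : Filter F)
    (f : T -> R[i]) (l : R[i]) :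
  ((f : T -> R[i]^o) @ F --> (l : R[i]^o)) <->
  (forall e : R, 0 < e -> \forall x \near F, normc (f x - l) < e).
Proof.
split=> [/cvgrPdist_lt h e e0|h].
  have /h : 0 < e%:C by rewrite ltcR.
  apply: filterS => x; rewrite [`| _ |]/(_%:C) ltcR normc_sub.
  by [].
apply/cvgrPdist_lt => e; rewrite ltcE => /andP[/eqP ime ree].
apply: filterS (h _ ree) => x.
rewrite normc_sub => hx; rewrite ltcE -ime.
by rewrite [`| _ |]/(_%:C) /= eqxx.
Qed.

End ComplexModulus.

(** * Complex differentiability and the chain rule *)

Section ComplexDerivative.
Variable R : realType.
Implicit Types (f g : R[i] -> R[i]) (z w d : R[i]) (e r : R).

(* A record, since unification would unfold a definition into limits of filters. *)
Record holo f z : Prop :=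
  Holo { holo_derivable : derivable (f : R[i]^o -> R[i]^o) z 1 }.

Lemma holo_cst c z : holo (fun _ => c) z.
Proof. by split; exact: derivable_cst. Qed.

Lemma holo_id z : holo id z.
Proof. by split; exact: derivable_id. Qed.

Lemma holoD f g z : holo f z -> holo g z -> holo (fun w => f w + g w) z.
Proof.
have h : derivable (f : R[i]^o -> R[i]^o) z 1 ->
    derivable (g : R[i]^o -> R[i]^o) z 1 ->
    derivable ((fun w => f w + g w) : R[i]^o -> R[i]^o) z 1 by exact: derivableD.
by move=> [hf] [hg]; split; exact: (h hf hg).
Qed.

Lemma holoB f g z : holo f z -> holo g z -> holo (fun w => f w - g w) z.
Proof.
have h : derivable (f : R[i]^o -> R[i]^o) z 1 ->
    derivable (g : R[i]^o -> R[i]^o) z 1 ->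
    derivable ((fun w => f w - g w) : R[i]^o -> R[i]^o) z 1 by exact: derivableB.
by move=> [hf] [hg]; split; exact: (h hf hg).
Qed.

Lemma holoM f g z : holo f z -> holo g z -> holo (fun w => f w * g w) z.
Proof.
have h : derivable (f : R[i]^o -> R[i]^o) z 1 ->
    derivable (g : R[i]^o -> R[i]^o) z 1 ->
    derivable ((fun w => f w * g w) : R[i]^o -> R[i]^o) z 1 by exact: derivableM.
by move=> [hf] [hg]; split; exact: (h hf hg).
Qed.

Lemma holoX f n z : holo f z -> holo (fun w => f w ^+ n) z.
Proof.
move=> hf; elim: n => [|n ih]; first exact: holo_cst.
under eq_fun do rewrite exprS.
exact: (holoM hf ih).
Qed.

Lemma holoV f z : f z != 0 -> holo f z -> holo (fun w => (f w)^-1) z.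
Proof. by move=> fz0 [hf]; split; exact: derivableV. Qed.

Lemma holo_sum (I : Type) (r : seq I) (F : I -> R[i] -> R[i]) z :
  (forall i, holo (F i) z) -> holo (fun w => \sum_(i <- r) F i w) z.
Proof.
move=> hF; elim: r => [|i r ih].
  under eq_fun do rewrite big_nil; exact: holo_cst.
under eq_fun do rewrite big_cons.
exact: (holoD (hF i) ih).
Qed.

(** Linear approximation without division by [w - z], so that the point [w = z] is no exception and
    compositions and quadratic estimates reduce to the triangle inequality. *)
Definition cdiff f z d := forall e, 0 < e -> exists2 r, 0 < r &
  forall w, normc (w - z) < r ->
    normc (f w - f z - d * (w - z)) <= e * normc (w - z).

Lemma nbhs_normcP z (P : set R[i]) :
  (\forall w \near (z : R[i]^o), P w) <->
  exists2 r, 0 < r & forall w, normc (w - z) < r -> P w.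
Proof.
split=> [/nbhs_ballP[r r0 zP]|[r r0 zP]].
  move: r0; rewrite /= ltcE => /andP[/= /eqP imr rer].
  exists (complex.Re r) => // w wz; apply: zP.
  rewrite -ball_normE /= ltcE imr /= eqxx /=.
  by move: wz; rewrite normc_sub.
apply/nbhs_ballP; exists r%:C; first by rewrite /= ltcR.
move=> w; rewrite -ball_normE /= ltcR => wz; apply: zP.
by rewrite normc_sub.
Qed.

Let quotientE (a d h : R[i]) : h != 0 ->
  h * (h^-1 *: (a : R[i]^o) - d : R[i]) = a - d * h.
Proof.
move=> h0; change (h * (h^-1 * a - d) = a - d * h).
by rewrite mulrBr mulVKf// mulrC.
Qed.

Lemma holoP f z : holo f z <-> exists d, cdiff f z d.
Proof.
split=> [[/cvg_ex[/= d /cvg_normcP hd]]|[d hd]].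
  exists d => e e0; have /= := hd _ e0.
  move/(@nbhs_normcP 0) => [r r0 hr]; exists r => // w wz.
  have [->|wzN] := eqVneq w z.
    by rewrite !subrr mulr0 subrr normc0 mulr0.
  have h0 : w - z != 0 by rewrite subr_eq0.
  have /= := hr (w - z); rewrite subr0 => /(_ wz h0) /ltW.
  rewrite [(w - z) *: 1]mulr1 subrK.
  have -> : f w - f z - d * (w - z) =
      (w - z) * ((w - z)^-1 *: (f w - f z : R[i]^o) - d).
    by rewrite (quotientE _ _ h0).
  by rewrite normcM mulrC => h; rewrite ler_wpM2r// normc_ge0.
split; apply/cvg_ex; exists d; apply/cvg_normcP => e e0.
have e20 : 0 < e / 2 by rewrite divr_gt0.
have [r r0 hr] := hd _ e20.
apply/(@nbhs_normcP 0); exists r => // h; rewrite subr0 => hlt /= h0.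
have := hr (h + z); rewrite addrK => /(_ hlt).
rewrite [h *: 1]mulr1.
have -> : f (h + z) - f z - d * h =
      h * (h^-1 *: (f (h + z) - f z : R[i]^o) - d).
  by rewrite (quotientE _ _ h0).
rewrite normcM mulrC ler_pM2r ?normc_gt0// => /le_lt_trans; apply.
by rewrite ltr_pdivrMr// mulr_natr mulr2n ltrDr.
Qed.

Definition ccont f z := forall e, 0 < e -> exists2 r, 0 < r &
  forall w, normc (w - z) < r -> normc (f w - f z) < e.

Lemma holo_ccont f z : holo f z -> ccont f z.
Proof.
move=> /holoP[d fd] e e0; have [r r0 hr] := fd _ (@ltr01 R).
have K0 : 0 < 1 + normc d by rewrite ltr_pwDl// normc_ge0.
exists (Num.min r (e / (1 + normc d))).
  by rewrite lt_min r0 divr_gt0.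
move=> w; rewrite lt_min => /andP[/hr h1 h2].
rewrite -[f w - f z](subrK (d * (w - z))).
apply: le_lt_trans (normcD _ _) _; rewrite normcM.
by move: h2; rewrite ltr_pdivlMr// => h2; move: (normc_ge0 (w-z)); nra.
Qed.

Lemma holo_comp f g z : holo f z -> holo g (f z) -> holo (fun w => g (f w)) z.
Proof.
move=> hf; have fc := holo_ccont hf.
move: hf => /holoP[d1 fd] /holoP[d2 gd].
apply/holoP; exists (d2 * d1) => e e0.
pose e1 := e / 2 / (1 + normc d1).
pose e2 := Num.min 1 (e / 2 / (1 + normc d2)).
have K1 : 0 < 1 + normc d1 by rewrite ltr_pwDl// normc_ge0.
have K2 : 0 < 1 + normc d2 by rewrite ltr_pwDl// normc_ge0.
have e10 : 0 < e1 by rewrite /e1 !divr_gt0.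
have e20 : 0 < e2 by rewrite lt_min ltr01 /= !divr_gt0.
have [r1 r10 h1] := gd _ e10.
have [r2 r20 h2] := fd _ e20.
have [r3 r30 h3] := fc _ r10.
exists (Num.min r2 r3); first by rewrite lt_min r20.
move=> w; rewrite lt_min => /andP[/h2 wz2 /h3 /h1 wz3].
have -> : g (f w) - g (f z) - d2 * d1 * (w - z) =
   (g (f w) - g (f z) - d2 * (f w - f z)) +
   d2 * (f w - f z - d1 * (w - z)) by ring.
apply: le_trans (normcD _ _) _; rewrite normcM.
have N := normc_ge0 (w - z).
have hf : normc (f w - f z) <= (1 + normc d1) * normc (w - z).
  rewrite -[f w - f z](subrK (d1 * (w - z))).
  apply: le_trans (normcD _ _) _; rewrite normcM mulrDl mul1r lerD2r.
  by apply: le_trans wz2 _; rewrite ler_piMl// ge_min lexx.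
rewrite (splitr e) mulrDl; apply: lerD.
  apply: le_trans wz3 _; rewrite /e1 -mulrA ler_wpM2l ?divr_ge0 ?(ltW e0)//.
  by rewrite mulrC ler_pdivrMr// mulrC.
apply: (@le_trans _ _ ((1 + normc d2) * (e / 2 / (1 + normc d2) * normc (w - z)))).
  apply: ler_pM => //; [exact: normc_ge0|exact: normc_ge0|by rewrite lerDr|].
  by apply: le_trans wz2 _; rewrite ler_wpM2r// ge_min lexx orbT.
by rewrite mulrA [X in X * _]mulrC divfK ?gt_eqF.
Qed.

(** The criterion by which Cauchy integrals and limits of analytic functions are shown analytic: a
    quadratic error bound survives integration and pointwise limits. *)
Lemma quad_holo f z d (K r : R) : 0 < r -> 0 <= K ->
  (forall w, normc (w - z) < r ->
    normc (f w - f z - d * (w - z)) <= K * normc (w - z) ^+ 2) -> holo f z.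
Proof.
move=> r0 K0 h; apply/holoP; exists d => e e0.
have K1 : 0 < K + 1 by rewrite ltr_wpDl.
exists (Num.min r (e / (K + 1))); first by rewrite lt_min r0 divr_gt0.
move=> w; rewrite lt_min ltr_pdivlMr// => /andP[/h h1 h2].
by apply: le_trans h1 _; move: (normc_ge0 (w-z)); nra.
Qed.

Lemma analytic_holo f : analytic_on_disk f <-> forall z, disk z -> holo f z.
Proof. by split=> h z /h; [move/Holo|case]. Qed.

End ComplexDerivative.

(** * Real and complex integrals over a compact interval *)

Section IntervalIntegral.
Variable R : realType.
Notation mu := (@lebesgue_measure R).
Implicit Types (a b c : R) (h : R -> R) (F : R -> R[i]).

Definition rintg a b h := mu.-integrable (`[a, b]) (EFin \o h).
Definition rint a b h : R := \int[mu]_(t in `[a, b]) h t.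

Lemma cont_rintg a b h : (forall t, t \in `[a, b] -> {for t, continuous h}) ->
  rintg a b h.
Proof.
move=> hc; apply: continuous_compact_integrable; first exact: segment_compact.
by apply: continuous_in_subspaceT => t; rewrite inE => /hc.
Qed.

Lemma rintg_cst a b c : rintg a b (fun=> c).
Proof. by apply: cont_rintg => t _; exact: cst_continuous. Qed.

Lemma eq_rintg a b h1 h2 : {in `[a, b], h1 =1 h2} -> rintg a b h1 -> rintg a b h2.
Proof.
by move=> e; apply: eq_integrable => // t /set_mem/= /e /= ->.
Qed.

Lemma rintgD a b h1 h2 : rintg a b h1 -> rintg a b h2 ->
  rintg a b (fun t => h1 t + h2 t).
Proof. by move=> i1 i2; apply: eq_integrable (integrableD _ i1 i2). Qed.

Lemma rintgZ a b c h : rintg a b h -> rintg a b (fun t => c * h t).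
Proof. by move=> i; apply: eq_integrable (integrableZl _ c i). Qed.

Lemma rintgN a b h : rintg a b h -> rintg a b (fun t => - h t).
Proof. by move=> i; apply: eq_integrable (integrableN i). Qed.

Lemma rintgB a b h1 h2 : rintg a b h1 -> rintg a b h2 ->
  rintg a b (fun t => h1 t - h2 t).
Proof. by move=> i1 i2; exact: (rintgD i1 (rintgN i2)). Qed.

Lemma rintD a b h1 h2 : rintg a b h1 -> rintg a b h2 ->
  rint a b (fun t => h1 t + h2 t) = rint a b h1 + rint a b h2.
Proof. exact: RintegralD. Qed.

Lemma rintB a b h1 h2 : rintg a b h1 -> rintg a b h2 ->
  rint a b (fun t => h1 t - h2 t) = rint a b h1 - rint a b h2.
Proof. exact: RintegralB. Qed.

Lemma rintZ a b c h : rintg a b h -> rint a b (fun t => c * h t) = c * rint a b h.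
Proof. exact: RintegralZl. Qed.

Lemma rint_cst a b c : a <= b -> rint a b (fun=> c) = c * (b - a).
Proof.
move=> ab; rewrite /rint Rintegral_cst//= lebesgue_measure_itv/= lte_fin.
case: ltP => [_|ba] /=; first by [].
by rewrite (@le_anti _ _ a b) ?ab// subrr.
Qed.

Lemma eq_rint a b h1 h2 : {in `[a, b], h1 =1 h2} -> rint a b h1 = rint a b h2.
Proof. by move=> e; apply: eq_Rintegral => t /set_mem/e. Qed.

Lemma le_rint a b h1 h2 : rintg a b h1 -> rintg a b h2 ->
  (forall t, t \in `[a, b] -> h1 t <= h2 t) -> rint a b h1 <= rint a b h2.
Proof. by move=> i1 i2 h; apply: le_Rintegral. Qed.

Lemma rint_ge0 a b h : (forall t, t \in `[a, b] -> 0 <= h t) -> 0 <= rint a b h.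
Proof. by move=> h0; apply: Rintegral_ge0. Qed.

Lemma rint_split a b c h : a <= b -> b <= c -> rintg a c h ->
  rint a c h = rint a b h + rint b c h.
Proof.
move=> ab bc i.
have -> : rint b c h = \int[mu]_(t in `]b, c]) h t.
  by rewrite Rintegral_itv_obnd_cbnd//; apply: integrableS i => //;
    apply: subset_itv; rewrite bnd_simp.
by rewrite -(Rintegral_itvB i) ?bnd_simp// addrC subrK.
Qed.

Lemma rint_FTC a b (f f' : R -> R) : a <= b -> (forall t : R, is_derive t (1 : R) f (f' t)) ->
  continuous f' -> rint a b f' = f b - f a.
Proof.
move=> ab df cf'; have [->|nab] := eqVneq a b.
  by rewrite /rint set_itv1 Rintegral_set1 subrr.
have ltab : a < b by rewrite lt_neqAle nab.
have fc t : {for t, continuous f}.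
  apply: differentiable_continuous; apply/derivable1_diffP.
  by have [] := df t.
rewrite /rint /Rintegral (@continuous_FTC2 _ _ f)//=.
- exact: continuous_subspaceT.
- split.
  + by move=> t _; have [] := df t.
  + by apply: cvg_at_right_filter; exact: fc.
  + by apply: cvg_at_left_filter; exact: fc.
- by move=> t _; rewrite derive1E; have [_ ->] := df t.
Qed.

Definition cintg a b F :=
  rintg a b (fun t => complex.Re (F t)) /\ rintg a b (fun t => complex.Im (F t)).
Definition cint a b F : R[i] :=
  rint a b (fun t => complex.Re (F t)) +i* rint a b (fun t => complex.Im (F t)).

Lemma cintgD a b F G : cintg a b F -> cintg a b G -> cintg a b (fun t => F t + G t).
Proof.
move=> [f1 f2] [g1 g2]; split.
  by apply: eq_rintg (rintgD f1 g1) => t _; rewrite ReD.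
by apply: eq_rintg (rintgD f2 g2) => t _; rewrite ImD.
Qed.

Lemma cintgM a b (c : R[i]) F : cintg a b F -> cintg a b (fun t => c * F t).
Proof.
move=> [f1 f2]; split.
  apply: eq_rintg (rintgB (rintgZ (complex.Re c) f1) (rintgZ (complex.Im c) f2)).
  by move=> t _; rewrite ReM.
apply: eq_rintg (rintgD (rintgZ (complex.Re c) f2) (rintgZ (complex.Im c) f1)).
by move=> t _; rewrite ImM.
Qed.

Lemma cintgN a b F : cintg a b F -> cintg a b (fun t => - F t).
Proof.
move=> [f1 f2]; split.
  by apply: eq_rintg (rintgN f1) => t _; rewrite ReN.
by apply: eq_rintg (rintgN f2) => t _; rewrite ImN.
Qed.

Lemma cintgB a b F G : cintg a b F -> cintg a b G -> cintg a b (fun t => F t - G t).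
Proof. by move=> f g; exact: (cintgD f (cintgN g)). Qed.

Lemma eq_cintg a b F G : {in `[a, b], F =1 G} -> cintg a b F -> cintg a b G.
Proof.
move=> e [h1 h2]; split; [move: h1|move: h2]; apply: eq_rintg => t ht;
  by rewrite e.
Qed.

Lemma eq_cint a b F G : {in `[a, b], F =1 G} -> cint a b F = cint a b G.
Proof. by move=> e; congr Complex; apply: eq_rint => t ht; rewrite e. Qed.

Lemma cintD a b F G : cintg a b F -> cintg a b G ->
  cint a b (fun t => F t + G t) = cint a b F + cint a b G.
Proof.
move=> [f1 f2] [g1 g2]; apply: complexP; rewrite ?ReD ?ImD /= -rintD//;
  by apply: eq_rint => t _; rewrite ?ReD ?ImD.
Qed.

Lemma cintM a b (c : R[i]) F : cintg a b F ->
  cint a b (fun t => c * F t) = c * cint a b F.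
Proof.
move=> [f1 f2]; apply: complexP.
  rewrite ReM /= -!rintZ// -rintB; [|exact: rintgZ..].
  by apply: eq_rint => t _; rewrite ReM.
rewrite ImM /= -!rintZ// -rintD; [|exact: rintgZ..].
by apply: eq_rint => t _; rewrite ImM.
Qed.

Lemma cintN a b F : cintg a b F -> cint a b (fun t => - F t) = - cint a b F.
Proof.
move=> fi; rewrite -mulN1r -cintM//.
by apply: eq_cint => t _; rewrite mulN1r.
Qed.

Lemma cintB a b F G : cintg a b F -> cintg a b G ->
  cint a b (fun t => F t - G t) = cint a b F - cint a b G.
Proof. by move=> f g; rewrite -(cintN g) -(cintD f (cintgN g)). Qed.

Lemma cintg_cst a b (c : R[i]) : cintg a b (fun=> c).
Proof. by split; exact: rintg_cst. Qed.

Lemma cint_cst a b (c : R[i]) : a <= b -> cint a b (fun=> c) = c * (b - a)%:C.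
Proof.
by move=> ab; apply: complexP; rewrite ?ReM ?ImM /= rint_cst// !mulr0 ?subr0 ?add0r.
Qed.

Lemma cint_split a b c F : a <= b -> b <= c -> cintg a c F ->
  cint a c F = cint a b F + cint b c F.
Proof.
by move=> ab bc [f1 f2]; apply: complexP; rewrite ?ReD ?ImD /=; apply: rint_split.
Qed.

(* Rotating the integral onto the positive axis reduces this to real parts. *)
Lemma normc_cint_le a b F h : cintg a b F -> rintg a b h ->
  (forall t, t \in `[a, b] -> normc (F t) <= h t) ->
  normc (cint a b F) <= rint a b h.
Proof.
move=> fi hi Fh; set I := cint a b F.
have [I0|I0] := eqVneq I 0.
  rewrite I0 normc0; apply: rint_ge0 => t /Fh; exact: le_trans (normc_ge0 _).
have N0 : 0 < normc I by rewrite normc_gt0.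
rewrite -(ler_pM2l N0) -expr2.
have -> : normc I ^+ 2 = complex.Re (I^* * I) by rewrite mulrC mulc_conj.
rewrite {2}/I -cintM//= -rintZ//; apply: le_rint.
- by have [] := cintgM (I^*) fi.
- exact: rintgZ.
- move=> t tab; apply: le_trans (Re_le_normc _) _.
  by rewrite normcM normc_conj ler_wpM2l ?normc_ge0// Fh.
Qed.

Lemma normc_cint_le_cst a b F M : a <= b -> cintg a b F ->
  (forall t, t \in `[a, b] -> normc (F t) <= M) ->
  normc (cint a b F) <= M * (b - a).
Proof.
move=> ab fi FM; rewrite -rint_cst//.
by apply: normc_cint_le => //; exact: rintg_cst.
Qed.

End IntervalIntegral.

(** * Continuity of complex functions of a real variable *)

Section ContinuousCurves.
Variable R : realType.
Implicit Types (F G : R -> R[i]) (t : R).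

Definition rcont F t :=
  {for t, continuous (fun s => complex.Re (F s))} /\
  {for t, continuous (fun s => complex.Im (F s))}.

Lemma rcont_eps F t :
  (forall e : R, 0 < e -> exists2 d : R, 0 < d &
     forall s, `|s - t| < d -> normc (F s - F t) < e) -> rcont F t.
Proof.
move=> h; split; apply/cvgrPdist_lt => e /h[d d0 hd];
    apply: filterS (nbhsx_ballx t _ d0) => s; rewrite /ball/= distrC => /hd;
    apply: le_lt_trans; rewrite normc_sub.
  by apply: le_trans (normc_Re _); rewrite ReD ReN.
by apply: le_trans (normc_Im _); rewrite ImD ImN.
Qed.

Lemma rcontP F t : rcont F t -> forall e : R, 0 < e -> exists2 d : R, 0 < d &
     forall s, `|s - t| < d -> normc (F s - F t) < e.
Proof.
move=> [/cvgrPdist_lt c1 /cvgrPdist_lt c2] e e0.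
have e20 : 0 < e / 2 by rewrite divr_gt0.
have /nbhs_ballP[d d0 hd] : \forall s \near t, normc (F s - F t) < e.
  have := c1 _ e20; have := c2 _ e20; apply: filterS2 => s h2 h1.
  apply: le_lt_trans (normc_le_ReIm _) _.
  by rewrite (splitr e) ReD ImD ReN ImN ltrD// distrC.
by exists d => // s st; apply: hd; rewrite /ball/= distrC.
Qed.

Lemma cont_ext (h1 h2 : R -> R) t : h1 =1 h2 ->
  {for t, continuous h1} -> {for t, continuous h2}.
Proof. by move=> /funext ->. Qed.

Lemma rcont_cst (c : R[i]) t : rcont (fun=> c) t.
Proof. by split; exact: cst_continuous. Qed.

Lemma rcontN F t : rcont F t -> rcont (fun s => - F s) t.
Proof.
move=> [f1 f2]; split.
  by apply: cont_ext (continuousN f1) => s; rewrite ReN.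
by apply: cont_ext (continuousN f2) => s; rewrite ImN.
Qed.

Lemma rcontD F G t : rcont F t -> rcont G t -> rcont (fun s => F s + G s) t.
Proof.
move=> [f1 f2] [g1 g2]; split.
  by apply: cont_ext (continuousD f1 g1) => s; rewrite ReD.
by apply: cont_ext (continuousD f2 g2) => s; rewrite ImD.
Qed.

Lemma rcontB F G t : rcont F t -> rcont G t -> rcont (fun s => F s - G s) t.
Proof. by move=> f g; exact: (rcontD f (rcontN g)). Qed.

Lemma rcontM F G t : rcont F t -> rcont G t -> rcont (fun s => F s * G s) t.
Proof.
move=> [f1 f2] [g1 g2]; split.
  by apply: cont_ext (continuousB (continuousM f1 g1) (continuousM f2 g2)) => s;
    rewrite ReM.
by apply: cont_ext (continuousD (continuousM f1 g2) (continuousM f2 g1)) => s;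
  rewrite ImM.
Qed.

Lemma rcont_real (h : R -> R) t : {for t, continuous h} ->
  rcont (fun s => (h s)%:C) t.
Proof. by move=> hc; split => //=; exact: cst_continuous. Qed.

Lemma rcont_cintg a b F : (forall t, t \in `[a, b] -> rcont F t) -> cintg a b F.
Proof. by move=> h; split; apply: cont_rintg => t /h[]. Qed.

Lemma rcont_normc F t : rcont F t -> {for t, continuous (fun s => normc (F s))}.
Proof.
move=> fc; apply/cvgrPdist_lt => e /(rcontP fc)[d d0 hd].
apply: filterS (nbhsx_ballx t _ d0) => s; rewrite /ball/= distrC => /hd.
by apply: le_lt_trans; rewrite distrC; exact: normc_dist.
Qed.

Lemma ccont_rcont (f : R[i] -> R[i]) (k : R -> R[i]) t :
  ccont f (k t) -> rcont k t -> rcont (fun s => f (k s)) t.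
Proof.
move=> fc kc; apply: rcont_eps => e /fc[r r0 hr].
by have [d d0 hd] := rcontP kc r0; exists d => // s /hd/hr.
Qed.

Lemma rcont_expi t : rcont (fun s => expi s) t.
Proof. by split; [exact: continuous_cos|exact: continuous_sin]. Qed.

End ContinuousCurves.

(** * Nested intervals under bisection *)

Section NestedBisection.
Variable R : realType.

(** Left ends increase and right ends decrease, so the supremum of the left ends lies in all the
    intervals. That [0 <= L] follows from the case [n = 0]. *)
Lemma nested_point (x : nat -> R) (L : R) :
  (forall n, x n <= x n.+1 /\ x n.+1 <= x n + L / 2 ^+ n.+1) ->
  exists s, forall n, x n <= s /\ s <= x n + L / 2 ^+ n.
Proof.
move=> h.
have mono m n : (m <= n)%N -> x m <= x n.
  elim: n => [|n ih]; first by rewrite leqn0 => /eqP ->.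
  rewrite leq_eqVlt => /predU1P[->//|]; rewrite ltnS => /ih mn.
  by apply: le_trans mn _; have [] := h n.
have half n : L / 2 ^+ n.+1 + L / 2 ^+ n.+1 = L / 2 ^+ n.
  by rewrite exprS; field.
have L0 : 0 <= L.
  have [h1 h2] := h 0%N; have := le_trans h1 h2; rewrite expr1; lra.
have anti m n : (m <= n)%N -> x n + L / 2 ^+ n <= x m + L / 2 ^+ m.
  elim: n => [|n ih]; first by rewrite leqn0 => /eqP ->.
  rewrite leq_eqVlt => /predU1P[->//|]; rewrite ltnS => /ih mn.
  by apply: le_trans mn; have [_] := h n; have := half n; lra.
have ub m n : x m <= x n + L / 2 ^+ n.
  have P i : 0 <= L / 2 ^+ i by rewrite divr_ge0// exprn_ge0.
  have [/mono mn|/ltnW/anti mn] := leqP m n; have := P n; have := P m; lra.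
exists (sup (range x)) => n; split.
  by apply: ub_le_sup; [exists (x 0%N + L / 2 ^+ 0) => _ [i _ <-]; exact: ub|exists n].
by apply: ge_sup => [|_ [i _ <-]]; [exists (x 0%N), 0%N|exact: ub].
Qed.

Lemma four_quarters (x1 x2 x3 x4 v : R) :
  4 * v <= x1 + x2 + (x3 + x4) -> x1 < v -> x2 < v -> x3 < v -> v <= x4.
Proof. lra. Qed.

End NestedBisection.

(** * Goursat's theorem in polar coordinates *)

Section Goursat.
Variable R : realType.
Variables (k kappa : R -> R[i]) (F : R -> R -> R[i]) (a0 b0 c0 d0 K : R).
Hypothesis a00 : 0 < a0.
Hypothesis kRe : forall t : R,
  is_derive t (1 : R) (fun s => complex.Re (k s)) (complex.Re (kappa t * k t)).
Hypothesis kIm : forall t : R,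
  is_derive t (1 : R) (fun s => complex.Im (k s)) (complex.Im (kappa t * k t)).
Hypothesis kappac : forall t, rcont kappa t.
Hypothesis kappaK : forall t, normc (kappa t) <= K.
Hypothesis FD : forall s t, s \in `[a0, b0] -> t \in `[c0, d0] ->
  exists D, forall e : R, 0 < e -> exists2 r : R, 0 < r &
    forall s' t', `|s' - s| < r -> `|t' - t| < r ->
    normc (F s' t' - F s t - D * (s'%:C * k t' - s%:C * k t)) <=
    e * (`|s' - s| + `|t' - t|).

Let kc t : rcont k t.
Proof.
split; apply: differentiable_continuous; apply/derivable1_diffP.
  by have [] := kRe t.
by have [] := kIm t.
Qed.

Let K_ge0 : 0 <= K. Proof. exact: le_trans (normc_ge0 _) (kappaK 0). Qed.

Let id_cont (t : R) : {for t, continuous (@id R)}. Proof. exact: cvg_id. Qed.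

Let FcP s t : s \in `[a0, b0] -> t \in `[c0, d0] ->
  rcont (fun s' => F s' t) s /\ rcont (fun t' => F s t') t.
Proof.
move=> sab tcd; have [D hD] := FD sab tcd.
have D0 : 0 < 1 + normc D by rewrite ltr_pwDl// normc_ge0.
split; apply: rcont_eps => e e0; have [r r0 hr] := hD _ (@ltr01 R).
  have kt0 : 0 < 1 + normc (D * k t) by rewrite ltr_pwDl// normc_ge0.
  exists (Num.min r (e / (1 + normc (D * k t)))); first by rewrite lt_min r0 divr_gt0.
  move=> s'; rewrite lt_min ltr_pdivlMr// => /andP[h1 h2].
  have := hr s' t h1; rewrite subrr normr0 => /(_ r0).
  have -> : D * (s'%:C * k t - s%:C * k t) = (s' - s)%:C * (D * k t).
    by rewrite rmorphB/=; ring.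
  rewrite mul1r addr0 => h3.
  rewrite -[F s' t - F s t](subrK ((s' - s)%:C * (D * k t))).
  apply: le_lt_trans (normcD _ _) _; rewrite normc_realM.
  by apply: le_lt_trans h2; rewrite mulrDr mulr1 lerD2r.
have sk := rcontM (rcont_cst (D * s%:C) t) (kc t).
have [r2 r20 hr2] : exists2 r2 : R, 0 < r2 & forall t', `|t' - t| < r2 ->
     normc (D * s%:C * k t' - D * s%:C * k t) < e / 2.
  by apply: (rcontP sk); rewrite divr_gt0.
exists (Num.min r (Num.min r2 (e / 2))); first by rewrite !lt_min r0 r20 divr_gt0.
move=> t'; rewrite !lt_min => /and3P[h1 /hr2 h2 h3].
have := hr s t'; rewrite subrr normr0 => /(_ r0 h1).
rewrite mul1r add0r => h4.
rewrite -[F s t' - F s t](subrK (D * (s%:C * k t' - s%:C * k t))).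
apply: le_lt_trans (normcD _ _) _; rewrite (splitr e) ler_ltD//.
  exact: le_trans h4 (ltW h3).
by move: h2; rewrite mulrBr !mulrA.
Qed.

(** Counterclockwise boundary integral of [F] times [dw / w] over the rectangle [[a, b]] by
    [[c, d]], in the coordinates [w = s * k t]. Since [kappa] is the logarithmic derivative of [k],
    one has [dw / w = ds / s + kappa t dt], which separates the variables. *)
Definition goursat_form a b c d :=
  cint c d (fun t => (F b t - F a t) * kappa t) -
  cint a b (fun s => (F s d - F s c) * (s^-1)%:C).

Arguments goursat_form : simpl never.

Let inS a b x : a0 <= a -> b <= b0 -> x \in `[a, b] -> x \in `[a0, b0].
Proof. by rewrite !in_itv/= => h1 h2 /andP[h3 h4]; apply/andP; split; lra. Qed.
Let inT a b x : c0 <= a -> b <= d0 -> x \in `[a, b] -> x \in `[c0, d0].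
Proof. by rewrite !in_itv/= => h1 h2 /andP[h3 h4]; apply/andP; split; lra. Qed.

Let intT s c d : s \in `[a0, b0] -> c0 <= c -> d <= d0 ->
  cintg c d (fun t => F s t * kappa t).
Proof.
move=> hs hc hd; apply: rcont_cintg => t tcd; apply: rcontM => //.
by have [] := FcP hs (inT hc hd tcd).
Qed.

Let inv_cont s : s \in `[a0, b0] -> rcont (fun s => (s^-1)%:C) s.
Proof.
rewrite in_itv/= => /andP[h1 _]; apply: rcont_real; apply: continuousV.
  by rewrite gt_eqF// (lt_le_trans a00).
exact: id_cont.
Qed.

Let intS t a b : t \in `[c0, d0] -> a0 <= a -> b <= b0 ->
  cintg a b (fun s => F s t * (s^-1)%:C).
Proof.
move=> ht ha hb; apply: rcont_cintg => s sab; have s0 := inS ha hb sab.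
by apply: rcontM; [have [] := FcP s0 ht|exact: inv_cont].
Qed.

Let in01 (a b : R) : a <= b -> a \in `[a, b] /\ b \in `[a, b].
Proof. by move=> ab; rewrite !in_itv/= !lexx ab. Qed.

Let formE a b c d : a0 <= a -> a <= b -> b <= b0 -> c0 <= c -> c <= d -> d <= d0 ->
  goursat_form a b c d =
  cint c d (fun t => F b t * kappa t) - cint c d (fun t => F a t * kappa t) -
  (cint a b (fun s => F s d * (s^-1)%:C) - cint a b (fun s => F s c * (s^-1)%:C)).
Proof.
move=> ha ab hb hc cd hd.
have [a1 b1] := in01 ab; have [c1 d1] := in01 cd.
have as_ := inS ha hb a1; have bs_ := inS ha hb b1.
have ct_ := inT hc hd c1; have dt_ := inT hc hd d1.
rewrite /goursat_form -!cintB; [|exact: intS|exact: intS|exact: intT|exact: intT].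
by congr (_ - _); apply: eq_cint => x _; rewrite mulrBl.
Qed.

Let split_s a m b c d : a0 <= a -> a <= m -> m <= b -> b <= b0 ->
  c0 <= c -> c <= d -> d <= d0 ->
  goursat_form a b c d = goursat_form a m c d + goursat_form m b c d.
Proof.
move=> ha am mb hb hc cd hd; have [c1 d1] := in01 cd.
have ct_ := inT hc hd c1; have dt_ := inT hc hd d1.
have ab := le_trans am mb.
rewrite (formE ha ab hb hc cd hd) (formE ha am (le_trans mb hb) hc cd hd).
rewrite (formE (le_trans ha am) mb hb hc cd hd).
rewrite (cint_split am mb (intS ct_ ha hb)) (cint_split am mb (intS dt_ ha hb)).
ring.
Qed.

Let split_t a b c m d : a0 <= a -> a <= b -> b <= b0 ->
  c0 <= c -> c <= m -> m <= d -> d <= d0 ->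
  goursat_form a b c d = goursat_form a b c m + goursat_form a b m d.
Proof.
move=> ha ab hb hc cm md hd; have [a1 b1] := in01 ab.
have as_ := inS ha hb a1; have bs_ := inS ha hb b1.
have cd := le_trans cm md.
rewrite (formE ha ab hb hc cd hd) (formE ha ab hb hc cm (le_trans md hd)).
rewrite (formE ha ab hb (le_trans hc cm) md hd).
rewrite (cint_split cm md (intT as_ hc hd)) (cint_split cm md (intT bs_ hc hd)).
ring.
Qed.

Let kint c d : c <= d -> cint c d (fun t => kappa t * k t) = k d - k c.
Proof.
have kkc t : rcont (fun t => kappa t * k t) t by exact: rcontM.
move=> cd; apply: complexP.
  by rewrite ReD ReN /=; apply: rint_FTC => // t; have [] := kkc t.
by rewrite ImD ImN /=; apply: rint_FTC => // t; have [] := kkc t.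
Qed.

Let neq0 (u : R) : u \in `[a0, b0] -> u%:C != 0.
Proof.
rewrite in_itv/= => /andP[/(lt_le_trans a00) h _].
by rewrite eq_complex /= gt_eqF.
Qed.

(** Constants and multiples of [w = s * k t] integrate to zero around the rectangle, so [F] may be
    replaced by its linearization error [E]. On a small cell [E] is at most [e] times the sum of the
    side lengths, and integration along the sides supplies a second such factor. *)
Let form_small s t D (e r a b c d : R) : s \in `[a, b] -> t \in `[c, d] ->
  a0 <= a -> b <= b0 -> c0 <= c -> d <= d0 -> 0 <= e ->
  b - a < r -> d - c < r ->
  (forall s' t', `|s' - s| < r -> `|t' - t| < r ->
    normc (F s' t' - F s t - D * (s'%:C * k t' - s%:C * k t)) <=
    e * (`|s' - s| + `|t' - t|)) ->
  normc (goursat_form a b c d) <=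
    e * (2 * (K + a0^-1)) * (b - a + (d - c)) ^+ 2.
Proof.
move=> sab tcd ha hb hc hd e0 lr mr hE.
have ab : a <= b by move: sab; rewrite in_itv/= => /andP[]; lra.
have cd : c <= d by move: tcd; rewrite in_itv/= => /andP[]; lra.
pose E s' t' := F s' t' - F s t - D * (s'%:C * k t' - s%:C * k t).
pose B := e * (b - a + (d - c)).
have EB s' t' : s' \in `[a, b] -> t' \in `[c, d] -> normc (E s' t') <= B.
  move=> hs' ht'.
  have ds : `|s' - s| <= b - a.
    move: hs' sab; rewrite !in_itv/= ler_norml => /andP[? ?] /andP[? ?].
    by apply/andP; split; lra.
  have dt : `|t' - t| <= d - c.
    move: ht' tcd; rewrite !in_itv/= ler_norml => /andP[? ?] /andP[? ?].
    by apply/andP; split; lra.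
  apply: le_trans (hE _ _ _ _) _; [exact: le_lt_trans ds lr|exact: le_lt_trans dt mr|].
  by rewrite ler_wpM2l// lerD.
have B0 : 0 <= B by rewrite mulr_ge0//; lra.
have [a1 b1] := in01 ab; have [c1 d1] := in01 cd.
have as_ := inS ha hb a1; have bs_ := inS ha hb b1.
have ct_ := inT hc hd c1; have dt_ := inT hc hd d1.
have kkc u : rcont (fun t => kappa t * k t) u by exact: rcontM.
have ik : cintg c d (fun t => kappa t * k t) by exact: rcont_cintg.
have iT : cintg c d (fun t => (E b t - E a t) * kappa t).
  apply: eq_cintg (cintgB (cintgB (intT bs_ hc hd) (intT as_ hc hd))
     (cintgM (D * (b - a)%:C) ik)) => u _.
  by rewrite /E rmorphB/=; ring.
have iS : cintg a b (fun s => (E s d - E s c) * (s^-1)%:C).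
  apply: eq_cintg (cintgB (cintgB (intS dt_ ha hb) (intS ct_ ha hb))
     (cintg_cst a b (D * (k d - k c)))) => u uab.
  rewrite /E fmorphV/=.
  have u0 : u%:C != 0.
    exact: neq0 (inS ha hb uab).
  by field.
have -> : goursat_form a b c d =
   cint c d (fun t => (E b t - E a t) * kappa t) -
   cint a b (fun s => (E s d - E s c) * (s^-1)%:C).
  rewrite formE//.
  have -> : cint c d (fun t => (E b t - E a t) * kappa t) =
     cint c d (fun t => F b t * kappa t) - cint c d (fun t => F a t * kappa t) -
     D * (b - a)%:C * (k d - k c).
    rewrite -(kint cd) -cintM// -!cintB//;
      [|exact: cintgB (intT bs_ hc hd) (intT as_ hc hd)|exact: cintgM
       |exact: intT|exact: intT].
    by apply: eq_cint => u _; rewrite /E rmorphB/=; ring.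
  have -> : cint a b (fun s => (E s d - E s c) * (s^-1)%:C) =
     cint a b (fun s => F s d * (s^-1)%:C) - cint a b (fun s => F s c * (s^-1)%:C)
     - D * (k d - k c) * (b - a)%:C.
    rewrite -(cint_cst _ ab) -!cintB//;
      [|exact: cintgB (intS dt_ ha hb) (intS ct_ ha hb)|exact: cintg_cst
       |exact: intS|exact: intS].
    apply: eq_cint => u uab; rewrite /E fmorphV/=.
    have u0 : u%:C != 0.
      exact: neq0 (inS ha hb uab).
    by field.
  ring.
apply: le_trans (normcB _ _) _.
have h1 : normc (cint c d (fun t => (E b t - E a t) * kappa t)) <=
    (B + B) * K * (d - c).
  apply: normc_cint_le_cst => // u ucd; rewrite normcM.
  apply: ler_pM => //; try exact: normc_ge0.
  apply: le_trans (normcB _ _) _.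
  by apply: lerD; apply: EB => //; apply: in01.
have h2 : normc (cint a b (fun s => (E s d - E s c) * (s^-1)%:C)) <=
    (B + B) * a0^-1 * (b - a).
  apply: normc_cint_le_cst => // u uab; rewrite normcM normc_real.
  have := inS ha hb uab; rewrite in_itv/= => /andP[hu _].
  have u0 := lt_le_trans a00 hu.
  apply: ler_pM => //; try exact: normc_ge0.
    apply: le_trans (normcB _ _) _.
    by apply: lerD; apply: EB.
  rewrite ger0_norm ?invr_ge0 ?(ltW u0)//.
  by rewrite lef_pV2// posrE.
apply: le_trans (lerD h1 h2) _.
have -> : e * (2 * (K + a0^-1)) * (b - a + (d - c)) ^+ 2 =
  (B + B) * (K + a0^-1) * (b - a + (d - c)) by rewrite /B; ring.
have ia0 : 0 <= a0^-1 by rewrite invr_ge0 ltW.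
have BB : 0 <= B + B by lra.
have p1 := mulr_ge0 (mulr_ge0 BB K_ge0) (_ : 0 <= b - a).
have p2 := mulr_ge0 (mulr_ge0 BB ia0) (_ : 0 <= d - c).
have : 0 <= b - a by lra.
have : 0 <= d - c by lra.
by move=> /p2 q2 /p1 q1; nra.
Qed.

(** The forms of the four subcells add up to that of the cell, so one of them keeps a quarter of the
    modulus. *)
Let quarter a c l m v : a0 <= a -> a + (l + l) <= b0 ->
  c0 <= c -> c + (m + m) <= d0 -> 0 <= l -> 0 <= m ->
  4 * v <= normc (goursat_form a (a + (l + l)) c (c + (m + m))) ->
  exists p : R * R, [/\ a <= p.1 /\ p.1 <= a + l, c <= p.2 /\ p.2 <= c + m &
    v <= normc (goursat_form p.1 (p.1 + l) p.2 (p.2 + m))].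
Proof.
move=> ha hb hc hd l0 m0.
have al : a <= a + l by rewrite lerDl.
have cm : c <= c + m by rewrite lerDl.
rewrite (@split_s a (a + l)); [|lra..].
rewrite (@split_t a (a + l) c (c + m)); [|lra..].
rewrite (@split_t (a + l) (a + (l + l)) c (c + m)); [|lra..].
set X1 := goursat_form a (a + l) c (c + m).
set X2 := goursat_form a (a + l) (c + m) _.
set X3 := goursat_form (a + l) _ c (c + m).
set X4 := goursat_form (a + l) _ (c + m) _.
move=> hX.
have [h1|h1] := leP v (normc X1); first by exists (a, c).
have [h2|h2] := leP v (normc X2); first by
  exists (a, c + m); split=> //=; rewrite -(addrA c).
have [h3|h3] := leP v (normc X3); first by
  exists (a + l, c); split=> //=; rewrite -(addrA a).
exists (a + l, c + m); split=> //=; rewrite -(addrA a) -(addrA c) -/X4.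
exact: four_quarters (le_trans hX (le_trans (normcD _ _)
  (lerD (normcD X1 X2) (normcD X3 X4)))) h1 h2 h3.
Qed.

Theorem goursat : a0 <= b0 -> c0 <= d0 -> goursat_form a0 b0 c0 d0 = 0.
Proof.
move=> ab cd; apply/eqP; rewrite -normc_eq0; apply: contraT => eta_neq0.
have eta0 : 0 < normc (goursat_form a0 b0 c0 d0) by rewrite lt_def eta_neq0 normc_ge0.
set eta := normc _ in eta0; exfalso.
pose L := b0 - a0; pose M := d0 - c0.
have L0 : 0 <= L by rewrite /L; lra.
have M0 : 0 <= M by rewrite /M; lra.
pose bad n (p : R * R) := [/\ a0 <= p.1, p.1 + L / 2 ^+ n <= b0,
  c0 <= p.2, p.2 + M / 2 ^+ n <= d0 &
  eta / 4 ^+ n <= normc (goursat_form p.1 (p.1 + L / 2 ^+ n) p.2 (p.2 + M / 2 ^+ n))].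
have step n p : bad n p -> {q | bad n.+1 q /\
   ((p.1 <= q.1 /\ q.1 <= p.1 + L / 2 ^+ n.+1) /\
    (p.2 <= q.2 /\ q.2 <= p.2 + M / 2 ^+ n.+1))}.
  case: p => a c [/= ha hb hc hd hbad]; apply: cid.
  set l := L / 2 ^+ n.+1; set m := M / 2 ^+ n.+1.
  have El : L / 2 ^+ n = l + l by rewrite /l exprS; field.
  have Em : M / 2 ^+ n = m + m by rewrite /m exprS; field.
  have l0 : 0 <= l by rewrite /l divr_ge0// exprn_ge0.
  have m0 : 0 <= m by rewrite /m divr_ge0// exprn_ge0.
  move: hb hd hbad; rewrite El Em => hb hd.
  have -> : eta / 4 ^+ n = 4 * (eta / 4 ^+ n.+1) by rewrite exprS; field.
  move=> /(quarter ha hb hc hd l0 m0)[[x y] [/= [h1 h2] [h3 h4] h5]].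
  exists (x, y); split; last by split.
  split=> //=; [exact: le_trans ha h1| |exact: le_trans hc h3|].
    by rewrite -/l; lra.
  by rewrite -/m; lra.
have bad0 : bad 0%N (a0, c0).
  by rewrite /bad /= !expr0 !divr1 /L /M !subrKC; split.
pose sq := fix sq n : {p | bad n p} := match n with
  | 0 => exist _ (a0, c0) bad0
  | m.+1 => exist _ (sval (step m _ (svalP (sq m)))) (svalP (step m _ (svalP (sq m)))).1
  end.
pose p n := sval (sq n).
have badp n : bad n (p n) by exact: (svalP (sq n)).
have stepp n := (svalP (step n _ (svalP (sq n)))).2.
have [s hs] : exists s, forall n, (p n).1 <= s /\ s <= (p n).1 + L / 2 ^+ n.
  by apply: nested_point => n; exact: (stepp n).1.
have [t ht] : exists t, forall n, (p n).2 <= t /\ t <= (p n).2 + M / 2 ^+ n.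
  by apply: nested_point => n; exact: (stepp n).2.
have sab : s \in `[a0, b0].
  have := hs 0%N; rewrite /p /= expr0 divr1 /L in_itv/=; lra.
have tcd : t \in `[c0, d0].
  have := ht 0%N; rewrite /p /= expr0 divr1 /M in_itv/=; lra.
have [D hD] := FD sab tcd.
(* The area of the cells shrinks like [4 ^- n], exactly as the lower bound on the forms. The [+ 1]
   makes [Q] positive for a degenerate rectangle and the final comparison [(Q - 1) / Q < 1]
   strict. *)
pose Q := 2 * (K + a0^-1) * (L + M) ^+ 2 + 1.
have ia0 : 0 < a0^-1 by rewrite invr_gt0.
have Q0 : 0 < Q.
  rewrite /Q ltr_wpDl// mulr_ge0 ?sqr_ge0// mulr_ge0//.
  by have := K_ge0; lra.
have e0 : 0 < eta / Q by rewrite divr_gt0.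
have [r r0 hr] := hD _ e0.
have [n hn] : exists n, (L + M) / 2 ^+ n < r.
  exists (Num.truncn ((L + M) / r)).+1.
  have LM : 0 <= (L + M) / r by rewrite divr_ge0//; [lra|exact: ltW].
  rewrite ltr_pdivrMr ?exprn_gt0//.
  have h : (L + M) / r < (Num.truncn ((L + M) / r)).+1%:R by exact: truncnS_gt.
  rewrite mulrC -ltr_pdivrMr//; apply: lt_le_trans h _.
  by rewrite -natrX ler_nat ltnW// ltn_expl.
have [hp1 hp2 hp3 hp4 hp5] := badp n.
have P2 : 0 < (2 : R) ^+ n by rewrite exprn_gt0.
have Ln0 : 0 <= L / 2 ^+ n by rewrite divr_ge0// ltW.
have Mn0 : 0 <= M / 2 ^+ n by rewrite divr_ge0// ltW.
have := @form_small s t D (eta / Q) r (p n).1 ((p n).1 + L / 2 ^+ n)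
   (p n).2 ((p n).2 + M / 2 ^+ n).
have [hs1 hs2] := hs n; have [ht1 ht2] := ht n.
rewrite !in_itv/= hs1 hs2 ht1 ht2 => /(_ isT isT hp1 hp2 hp3 hp4 (ltW e0)).
rewrite !(addrAC _ _ (- _)) !subrr !add0r.
move: hn; rewrite mulrDl => hn.
have lt1 : L / 2 ^+ n < r by lra.
have lt2 : M / 2 ^+ n < r by lra.
move=> /(_ lt1 lt2 hr)/(le_trans hp5).
have -> : (L / 2 ^+ n + M / 2 ^+ n) ^+ 2 = (L + M) ^+ 2 / 4 ^+ n.
  have -> : (4 : R) ^+ n = 2 ^+ n * 2 ^+ n by rewrite -exprMn; congr (_ ^+ _); lra.
  by field; rewrite gt_eqF.
rewrite mulrA ler_pM2r ?invr_gt0 ?exprn_gt0//.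
rewrite -mulrA [_ / Q]mulrC mulrAC.
apply/negP; rewrite -ltNge.
rewrite -[ltRHS]mul1r [ltLHS](_ : _ = (Q - 1) / Q * eta).
  rewrite ltr_pM2r// ltr_pdivrMr// mul1r; lra.
by rewrite /Q; ring.
Qed.

End Goursat.

(** * Normalized means over the circle *)

Section CircleMean.
Variable R : realType.
Implicit Types (h : R -> R) (F : R -> R[i]).

Definition imean h : R := (2 * pi)^-1 * rint 0 (2 * pi) h.
Definition cmean F : R[i] := ((2 * pi)^-1)%:C * cint 0 (2 * pi) F.
Definition itg h := rintg 0 (2 * pi) h.
Definition ctg F := cintg 0 (2 * pi) F.

Lemma twopi_gt0 : 0 < 2 * pi :> R.
Proof. by rewrite mulr_gt0// pi_gt0. Qed.

Lemma inv_twopi_ge0 : 0 <= (2 * pi)^-1 :> R.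
Proof. by rewrite invr_ge0; exact/ltW/twopi_gt0. Qed.

Lemma imean_cst (c : R) : imean (fun=> c) = c.
Proof.
rewrite /imean rint_cst ?(ltW twopi_gt0)// subr0 mulrCA mulVf ?mulr1//.
by rewrite gt_eqF ?twopi_gt0.
Qed.

Lemma imeanD h1 h2 : itg h1 -> itg h2 ->
  imean (fun t => h1 t + h2 t) = imean h1 + imean h2.
Proof. by move=> i1 i2; rewrite /imean rintD// mulrDr. Qed.

Lemma imeanB h1 h2 : itg h1 -> itg h2 ->
  imean (fun t => h1 t - h2 t) = imean h1 - imean h2.
Proof. by move=> i1 i2; rewrite /imean rintB// mulrBr. Qed.

Lemma imeanZ c h : itg h -> imean (fun t => c * h t) = c * imean h.
Proof. by move=> i; rewrite /imean rintZ// mulrCA. Qed.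

Lemma le_imean h1 h2 : itg h1 -> itg h2 ->
  (forall t, t \in `[0, 2 * pi] -> h1 t <= h2 t) -> imean h1 <= imean h2.
Proof.
move=> i1 i2 h; rewrite /imean ler_wpM2l ?inv_twopi_ge0//.
exact: (le_rint i1 i2 h).
Qed.

Lemma eq_imean h1 h2 : {in `[0, 2 * pi], h1 =1 h2} -> imean h1 = imean h2.
Proof. by move=> e; rewrite /imean (eq_rint e). Qed.

Lemma imean_ge0 h : (forall t, t \in `[0, 2 * pi] -> 0 <= h t) -> 0 <= imean h.
Proof.
by move=> e; rewrite /imean mulr_ge0 ?inv_twopi_ge0//; exact: rint_ge0.
Qed.

Lemma Re_cmean F : complex.Re (cmean F) = imean (fun t => complex.Re (F t)).
Proof. by rewrite ReZ. Qed.

Lemma Im_cmean F : complex.Im (cmean F) = imean (fun t => complex.Im (F t)).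
Proof. by rewrite ImZ. Qed.

Lemma cmean_cst (c : R[i]) : cmean (fun=> c) = c.
Proof. by apply: complexP; rewrite ?Re_cmean ?Im_cmean imean_cst. Qed.

Lemma cmeanD F G : ctg F -> ctg G -> cmean (fun t => F t + G t) = cmean F + cmean G.
Proof. by move=> i1 i2; rewrite /cmean cintD// mulrDr. Qed.

Lemma cmeanB F G : ctg F -> ctg G -> cmean (fun t => F t - G t) = cmean F - cmean G.
Proof. by move=> i1 i2; rewrite /cmean cintB// mulrBr. Qed.

Lemma cmeanM c F : ctg F -> cmean (fun t => c * F t) = c * cmean F.
Proof. by move=> i; rewrite /cmean cintM// mulrCA. Qed.

Lemma eq_cmean F G : {in `[0, 2 * pi], F =1 G} -> cmean F = cmean G.
Proof. by move=> e; rewrite /cmean (eq_cint e). Qed.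

Lemma cmean_conj F : ctg F -> cmean (fun t => (F t)^*) = (cmean F)^*.
Proof.
move=> [f1 f2]; apply: complexP.
  by rewrite Re_conj !Re_cmean; apply: eq_imean => t _; rewrite Re_conj.
rewrite Im_conj !Im_cmean -mulN1r -imeanZ//.
by apply: eq_imean => t _; rewrite Im_conj mulN1r.
Qed.

Lemma normc_cmean_le F h : ctg F -> itg h ->
  (forall t, t \in `[0, 2 * pi] -> normc (F t) <= h t) -> normc (cmean F) <= imean h.
Proof.
move=> i1 i2 h1; rewrite /cmean normc_realM /imean.
rewrite ger0_norm ?inv_twopi_ge0//.
rewrite ler_wpM2l ?inv_twopi_ge0//; exact: (normc_cint_le i1 i2 h1).
Qed.

Lemma rcont_ctg F : (forall t, rcont F t) -> ctg F.
Proof. by move=> h; apply: rcont_cintg => t _. Qed.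

Lemma cont_itg h : continuous h -> itg h.
Proof. by move=> hc; apply: cont_rintg => t _; exact: hc. Qed.

Lemma expi_lip s t : normc (expi t - expi s) <= `|t - s| :> R.
Proof.
wlog st : s t / s <= t.
  move=> W; have [/W//|/ltW/W] := leP s t.
  by rewrite normc_sub distrC.
have ic u : rcont (fun t : R => 'i * expi t) u.
  exact: rcontM (rcont_cst _ _) (rcont_expi _).
have <- : cint s t (fun u : R => 'i * expi u) = expi t - expi s.
  apply: complexP; rewrite ?ReD ?ImD ?ReN ?ImN /=.
    rewrite -(@rint_FTC _ _ _ cos (fun u => - sin u))//.
    - by apply: eq_rint => u _; rewrite mul0r mul1r sub0r.
    - by move=> u; apply: continuousN; exact: continuous_sin.
  rewrite -(@rint_FTC _ _ _ sin cos)//.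
  - by apply: eq_rint => u _; rewrite mul0r mul1r add0r.
  - exact: continuous_cos.
rewrite ger0_norm ?subr_ge0// -[leRHS]mul1r; apply: normc_cint_le_cst => //.
  by apply: rcont_cintg.
by move=> u _; rewrite normcM normc_expi mulr1 normcE /= expr0n expr1n add0r sqrtr1.
Qed.

Lemma rcontV F (t : R) : F t != 0 -> rcont F t -> rcont (fun s => (F s)^-1) t.
Proof.
move=> f0 fc; apply: (@ccont_rcont _ (fun z => z^-1)) => //.
by apply: holo_ccont; apply: holoV => //; exact: holo_id.
Qed.

End CircleMean.

(** * The Cauchy and Poisson formulas *)

Section CauchyFormula.
Variable R : realType.
Implicit Types (f g : R[i] -> R[i]) (z w : R[i]) (t : R).

(** Analyticity across the unit circle. A function analytic in the open disk reaches this class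
    through its dilations [f (r * z)] with [r < 1]. *)
Definition anbhd f := exists2 r : R, 1 < r & forall z, normc z < r -> holo f z.

(** The Cauchy kernel with [d zeta = 'i * zeta dt] absorbed, so that Cauchy's formula is a mean over
    [t]; [pk] is the Poisson kernel. *)
Definition cauchyk z t : R[i] := expi t / (expi t - z).
Definition pk z t : R := (1 - normc z ^+ 2) / normc (expi t - z) ^+ 2.

Lemma expi_sub_ge z t : 1 - normc z <= normc (expi t - z).
Proof. by rewrite -(normc_expi t); exact: normcB_ge. Qed.

Lemma expi_sub_neq0 z t : normc z < 1 -> expi t - z != 0.
Proof.
move=> z1; rewrite -normc_gt0; apply: lt_le_trans (expi_sub_ge _ _).
by rewrite subr_gt0.
Qed.

Lemma rcont_cauchyk z t : normc z < 1 -> rcont (cauchyk z) t.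
Proof.
move=> z1; apply: rcontM; first exact: rcont_expi.
apply: rcontV; first exact: expi_sub_neq0.
exact: rcontB (rcont_expi t) (rcont_cst z t).
Qed.

Lemma normc_cauchyk z t : normc z < 1 -> normc (cauchyk z t) <= (1 - normc z)^-1.
Proof.
move=> z1; rewrite normcf normc_expi mul1r lef_pV2 ?expi_sub_ge// posrE.
  by rewrite normc_gt0 expi_sub_neq0.
by rewrite subr_gt0.
Qed.

Lemma anbhd_rcont f t : anbhd f -> rcont (fun t => f (expi t)) t.
Proof.
move=> [r r1 fh]; apply: ccont_rcont (rcont_expi t).
by apply: holo_ccont; apply: fh; rewrite normc_expi.
Qed.

(** The circle is contracted to [z] along [z + s * (expi t - z)]. Goursat's theorem on [[a, 1]] by
    [[0, 2 pi]] makes the integral independent of the parameter [s], because the two radial sides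
    coincide; continuity of [f] at [z] then gives the value for small [a]. The factor [kappa] is the
    logarithmic derivative of [expi t - z]. *)
Let cauchy_circle f z : anbhd f -> normc z < 1 ->
  cint 0 (2 * pi) (fun t => f (expi t) * ('i * cauchyk z t)) =
  f z * cint 0 (2 * pi) (fun t => 'i * cauchyk z t).
Proof.
move=> [r r1 fh] z1.
pose k t := expi t - z.
pose kappa t := 'i * cauchyk z t.
pose K := (1 - normc z)^-1.
have ni : normc ('i : R[i]) = 1 by rewrite normcE /= expr0n expr1n add0r sqrtr1.
have kappaK t : normc (kappa t) <= K.
  by rewrite normcM ni mul1r; exact: normc_cauchyk.
have kappac t : rcont kappa t.
  exact: rcontM (rcont_cst _ _) (rcont_cauchyk _ z1).
have kk t : kappa t * k t = 'i * expi t.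
  by rewrite /kappa /cauchyk -mulrA divfK// expi_sub_neq0.
have kRe (t : R) : is_derive t (1 : R) (fun s => complex.Re (k s))
    (complex.Re (kappa t * k t)).
  rewrite kk ReM /= mul0r mul1r sub0r.
  have -> : (fun s => complex.Re (k s)) = (fun s : R => cos s - complex.Re z).
    by apply/funext => s; rewrite ReD ReN.
  by rewrite -[X in is_derive _ _ _ X]subr0; apply: is_deriveB.
have kIm (t : R) : is_derive t (1 : R) (fun s => complex.Im (k s))
    (complex.Im (kappa t * k t)).
  rewrite kk ImM /= mul0r mul1r add0r.
  have -> : (fun s => complex.Im (k s)) = (fun s : R => sin s - complex.Im z).
    by apply/funext => s; rewrite ImD ImN.
  by rewrite -[X in is_derive _ _ _ X]subr0; apply: is_deriveB.
have k2 t : normc (k t) <= 2.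
  by apply: le_trans (normcB _ _) _; rewrite normc_expi; have := ltW z1; lra.
pose F s t := f (z + s%:C * k t).
have FD (a s t : R) : 0 < a -> s \in `[a, 1] -> t \in `[0, 2 * pi] ->
  exists D, forall e : R, 0 < e -> exists2 r : R, 0 < r &
    forall s' t', `|s' - s| < r -> `|t' - t| < r ->
    normc (F s' t' - F s t - D * (s'%:C * k t' - s%:C * k t)) <=
    e * (`|s' - s| + `|t' - t|).
  rewrite in_itv/= => a0 /andP[sa s1] _.
  have s0 : 0 < s by exact: lt_le_trans sa.
  have : holo f (z + s%:C * k t).
    apply: fh; apply: le_lt_trans r1.
    have -> : z + s%:C * k t = (1 - s)%:C * z + s%:C * expi t.
      by rewrite rmorphB/= rmorph1 /k; ring.
    apply: le_trans (normcD _ _) _; rewrite !normc_realM normc_expi mulr1.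
    rewrite !ger0_norm ?(ltW s0) ?subr_ge0//.
    by have := ler_wpM2l (_ : 0 <= 1 - s) (ltW z1); rewrite subr_ge0 mulr1 => /(_ s1); lra.
  move=> /holoP[D hD]; exists D => e e0.
  have e20 : 0 < e / 2 by rewrite divr_gt0.
  have [r2 r20 hr] := hD _ e20; exists (r2 / 4); first by rewrite divr_gt0.
  move=> s' t' hs ht.
  have E : s'%:C * k t' - s%:C * k t =
      (s' - s)%:C * k t' + s%:C * (expi t' - expi t).
    by rewrite rmorphB/= /k; ring.
  have hw : normc (s'%:C * k t' - s%:C * k t) <= 2 * (`|s' - s| + `|t' - t|).
    rewrite E; apply: le_trans (normcD _ _) _; rewrite !normc_realM.
    rewrite (ger0_norm (ltW s0)).
    have h1 := ler_wpM2l (normr_ge0 (s' - s)) (k2 t').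
    have h2 := ler_pM (ltW s0) (normc_ge0 _) s1 (expi_lip t t').
    by have := normr_ge0 (t' - t); move: h1 h2; lra.
  have := hr (z + s'%:C * k t').
  have -> : z + s'%:C * k t' - (z + s%:C * k t) = s'%:C * k t' - s%:C * k t.
    by ring.
  move=> h; apply: le_trans (h _) _; first by apply: le_lt_trans hw _; lra.
  apply: le_trans (ler_wpM2l (ltW e20) hw) _; rewrite mulrA divfK//.
have J (a : R) : 0 < a -> a <= 1 ->
    cint 0 (2 * pi) (fun t => F 1 t * kappa t) =
    cint 0 (2 * pi) (fun t => F a t * kappa t) /\
    (ctg (fun t => F a t * kappa t)).
  move=> a0 a1.
  have Fint s : s \in `[a, 1] -> ctg (fun t => F s t * kappa t).
    move=> hs; apply: rcont_cintg => t ht; apply: rcontM => //.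
    have [D hD] := FD _ _ _ a0 hs ht.
    rewrite /F; apply: (@ccont_rcont _ f (fun t => z + s%:C * k t)).
      apply: holo_ccont; apply: fh; apply: le_lt_trans r1.
      move: hs; rewrite in_itv/= => /andP[sa s1].
      have s0 : 0 < s by exact: lt_le_trans sa.
      have -> : z + s%:C * k t = (1 - s)%:C * z + s%:C * expi t.
        by rewrite rmorphB/= rmorph1 /k; ring.
      apply: le_trans (normcD _ _) _; rewrite !normc_realM normc_expi mulr1.
      rewrite !ger0_norm ?(ltW s0) ?subr_ge0//.
      by have := ler_wpM2l (_ : 0 <= 1 - s) (ltW z1); rewrite subr_ge0 mulr1 => /(_ s1); lra.
    apply: rcontD (rcont_cst _ _) (rcontM (rcont_cst _ _) _).
    exact: rcontB (rcont_expi t) (rcont_cst z t).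
  have ha : a \in `[a, 1] by rewrite in_itv/= lexx.
  have h1 : 1 \in `[a, 1] by rewrite in_itv/= lexx andbT.
  split; last exact: Fint.
  have := goursat a0 kRe kIm kappac kappaK (fun s t => @FD a s t a0) a1
    (ltW (twopi_gt0 R)).
  rewrite /goursat_form (_ : cint a 1 _ = 0) ?subr0; last first.
    under eq_cint => s _ do rewrite /F /k expi_2pi expi0 subrr mul0r.
    by rewrite cint_cst// mul0r.
  under eq_cint => t _ do rewrite mulrBl.
  by rewrite cintB; [|exact: Fint..] => /eqP; rewrite subr_eq0 => /eqP.
have E1 : cint 0 (2 * pi) (fun t => f (expi t) * kappa t) =
    cint 0 (2 * pi) (fun t => F 1 t * kappa t).
  by apply: eq_cint => t _; rewrite /F /k mul1r subrKC.
rewrite E1; apply/eqP; rewrite -subr_eq0 -normc_eq0; apply/negPn/negP => neq0.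
set d := normc _ in neq0.
have d0 : 0 < d by rewrite lt_def neq0 normc_ge0.
have K0 : 0 < K by rewrite invr_gt0 subr_gt0.
have KP : 0 < K * (2 * pi) by rewrite mulr_gt0 ?twopi_gt0.
have e0 : 0 < d / 2 / (K * (2 * pi)) by rewrite !divr_gt0.
have [r2 r20 hr] := holo_ccont (fh _ (lt_trans z1 r1)) e0.
(* As [k] is bounded by 2, the contracted circle stays within [r2 / 2] of [z]. *)
pose a := Num.min 1 (r2 / 4).
have a0 : 0 < a by rewrite lt_min ltr01 divr_gt0.
have a1 : a <= 1 by rewrite ge_min lexx.
have ar : a <= r2 / 4 by rewrite ge_min lexx orbT.
have [Ea ia] := J a a0 a1.
have ik : ctg kappa by exact: rcont_ctg.
suff : d <= d / 2 / (K * (2 * pi)) * K * (2 * pi - 0).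
  by rewrite subr0 -mulrA divfK ?gt_eqF//; move: d0; lra.
rewrite {1}/d Ea -cintM// -cintB//; last exact: cintgM.
apply: normc_cint_le_cst; first exact: ltW (twopi_gt0 R).
  exact: cintgB ia (cintgM _ ik).
move=> t _; rewrite -mulrBl normcM; apply: ler_pM; rewrite ?normc_ge0 ?kappaK//.
rewrite /F; apply: ltW; apply: hr; rewrite addrAC subrr add0r normc_realM (ger0_norm (ltW a0)).
by have := ler_pM (ltW a0) (normc_ge0 _) ar (k2 t); move: r20; lra.
Qed.

Let cauchy_mean_aux f z : anbhd f -> normc z < 1 ->
  cmean (fun t => f (expi t) * cauchyk z t) = f z * cmean (cauchyk z).
Proof.
move=> fa z1; have := cauchy_circle fa z1.
have i0 : ('i : R[i]) != 0 by rewrite eq_complex /= oner_eq0 andbF.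
have ik : ctg (cauchyk z) by apply: rcont_ctg => t; exact: rcont_cauchyk.
have ifk : ctg (fun t => f (expi t) * cauchyk z t).
  by apply: rcont_ctg => t; apply: rcontM (rcont_cauchyk _ z1); exact: anbhd_rcont.
under eq_cint do rewrite mulrCA.
rewrite !cintM// mulrCA => /(mulfI i0) E.
by rewrite /cmean E mulrCA.
Qed.

Lemma mean_value f : anbhd f -> cmean (fun t => f (expi t)) = f 0.
Proof.
move=> fa; have := cauchy_mean_aux fa (_ : normc 0 < 1); rewrite normc0.
have -> : cauchyk 0 = (fun=> 1 : R[i]).
  by apply/funext => t; rewrite /cauchyk subr0 divff// expi_neq0.
rewrite cmean_cst mulr1 => <-//.
by apply: eq_cmean => t _; rewrite mulr1.
Qed.

Lemma anbhd_conj_kernel z : normc z < 1 -> anbhd (fun w => (1 - z^* * w)^-1).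
Proof.
move=> z1; have P : 0 < 1 + normc z by rewrite ltr_pwDl// normc_ge0.
exists (2 / (1 + normc z)); first by rewrite ltr_pdivlMr// mul1r; lra.
move=> w; rewrite ltr_pdivlMr// => hw.
apply: holoV.
  rewrite subr_eq0; apply/eqP => e.
  have := normcM z^* w; rewrite -e normc1 normc_conj => h.
  have := normc_ge0 z; nra.
exact: (holoB (holo_cst 1 w) (holoM (holo_cst z^* w) (holo_id w))).
Qed.

Lemma anbhdM f g : anbhd f -> anbhd g -> anbhd (fun w => f w * g w).
Proof.
move=> [r1 r11 h1] [r2 r21 h2]; exists (Num.min r1 r2); first by rewrite lt_min r11.
by move=> z; rewrite lt_min => /andP[/h1 f1 /h2 g1]; exact: (holoM f1 g1).
Qed.

(** No winding number is computed: on the circle the conjugate of the kernel is the analytic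
    function [1 / (1 - conj z * w)], whose mean is its value at the origin. The mean value property
    is available already, since the kernel at [z = 0] is constant. *)
Lemma cmean_cauchyk z : normc z < 1 -> cmean (cauchyk z) = 1.
Proof.
move=> z1; have := mean_value (anbhd_conj_kernel z1).
rewrite mulr0 subr0 invr1 => h.
rewrite -[LHS]conjcK -cmean_conj; last first.
  by apply: rcont_ctg => t; exact: rcont_cauchyk.
rewrite -[RHS]conjc1; congr (_^*); rewrite -h; apply: eq_cmean => t _.
rewrite /cauchyk rmorphM /= conjc_inv rmorphB/=.
rewrite -[X in X / _]invrK -invfM; congr (_^-1).
have -> : ((expi t)^*)^-1 = expi t.
  apply: (mulIf (x := (expi t)^*)); first by rewrite -normc_gt0 normc_conj normc_expi.
  by rewrite mulVf ?expi_mul_conj// -normc_gt0 normc_conj normc_expi.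
by rewrite mulrBr expi_mul_conj [expi t * z^*]mulrC.
Qed.

Lemma cauchy_formula f z : anbhd f -> normc z < 1 ->
  cmean (fun t => f (expi t) * cauchyk z t) = f z.
Proof. by move=> fa z1; rewrite cauchy_mean_aux// cmean_cauchyk// mulr1. Qed.

(** The term added to the Cauchy kernel is analytic in [expi t] and vanishes at the origin, hence
    has mean zero against an analytic function. This is how Poisson's formula follows from
    Cauchy's. *)
Lemma pkE z t : normc z < 1 ->
  (pk z t)%:C = cauchyk z t + z^* * expi t * (1 - z^* * expi t)^-1.
Proof.
move=> z1; have n0 := expi_sub_neq0 t z1.
have n1 : (expi t - z)^* != 0 by rewrite -normc_gt0 normc_conj normc_gt0.
rewrite /pk rmorphM fmorphV rmorphB rmorph1 /= -!mulc_conj.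
have e1 := expi_mul_conj t.
have -> : 1 - z^* * expi t = expi t * (expi t - z)^*.
  by rewrite rmorphB/= mulrBr e1 [z^* * _]mulrC.
rewrite /cauchyk rmorphB /= in n1 *.
have e0 := expi_neq0 t.
rewrite -{1}e1; field.
by rewrite n1 n0 e0.
Qed.

Lemma poisson_formula f z : anbhd f -> normc z < 1 ->
  cmean (fun t => (pk z t)%:C * f (expi t)) = f z.
Proof.
move=> fa z1.
pose g w := f w * (z^* * w * (1 - z^* * w)^-1).
have ga : anbhd g.
  apply: anbhdM fa _; apply: anbhdM (anbhd_conj_kernel z1).
  by exists 2; [lra|move=> w _; exact: (holoM (holo_cst z^* w) (holo_id w))].
have g0 := mean_value ga; rewrite /g mulr0 mul0r mulr0 in g0.
rewrite -[RHS]addr0 -g0 -(cauchy_formula fa z1) -cmeanD.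
- by apply: eq_cmean => t _; rewrite pkE//; ring.
- by apply: rcont_ctg => t; apply: rcontM (rcont_cauchyk _ z1); exact: anbhd_rcont.
- by apply: rcont_ctg => t; exact: (@anbhd_rcont g).
Qed.

End CauchyFormula.

(** * The Poisson kernel, the maximum principle, dilations *)

Section PoissonKernel.
Variable R : realType.
Implicit Types (f : R[i] -> R[i]) (z w : R[i]) (s t r : R).

Lemma pk_ge0 z t : normc z <= 1 -> 0 <= pk z t.
Proof.
move=> z1; rewrite /pk divr_ge0 ?sqr_ge0// subr_ge0.
by rewrite expr_le1 ?normc_ge0.
Qed.

Lemma pk_le z t : normc z < 1 -> pk z t <= 2 / (1 - normc z).
Proof.
move=> z1; have d0 : 0 < 1 - normc z by rewrite subr_gt0.
have h := expi_sub_ge z t; have n0 := normc_ge0 z.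
rewrite /pk ler_pdivrMr; last by rewrite exprn_gt0// (lt_le_trans d0).
rewrite mulrAC ler_pdivlMr//.
set x := normc (expi t - z) in h *; set y := normc z in h d0 n0 z1 *.
have : (1 - y) ^+ 2 <= x ^+ 2 by rewrite lerXn2r ?nnegrE ?(ltW d0)// (le_trans (ltW d0)).
have -> : (1 - y ^+ 2) * (1 - y) = (1 + y) * (1 - y) ^+ 2 by ring.
have : 0 <= x ^+ 2 by rewrite sqr_ge0.
nra.
Qed.

Lemma pk_cont z t : normc z < 1 -> {for t, continuous (pk z)}.
Proof.
move=> z1; have hc : {for t, continuous (fun s => normc (expi s - z))}.
  exact: rcont_normc (rcontB (rcont_expi t) (rcont_cst z t)).
apply: continuousM; first exact: cst_continuous.
apply: continuousV; last exact: (continuousM hc hc).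
by rewrite expf_neq0// gt_eqF// normc_gt0 expi_sub_neq0.
Qed.

Lemma anbhd_cst (c : R[i]) : anbhd (fun=> c).
Proof. by exists 2; [lra|move=> z _; exact: holo_cst]. Qed.

Lemma imean_pk z : normc z < 1 -> imean (pk z) = 1.
Proof.
move=> z1; have := congr1 (fun w => complex.Re w) (poisson_formula (anbhd_cst 1) z1).
rewrite Re_cmean => E; rewrite -[RHS]/(complex.Re (1 : R[i])) -E.
by apply: eq_imean => t _; rewrite mulr1.
Qed.

Lemma pk_itg z : normc z < 1 -> itg (pk z).
Proof. by move=> z1; apply: cont_itg => t; exact: pk_cont. Qed.

(** The kernel depends on [s - t] through its cosine only. This symmetry makes the Poisson operator
    self-adjoint. *)
Lemma pk_sym r s t : pk (r%:C * expi s) t = pk (r%:C * expi t) s.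
Proof.
rewrite /pk !normc_realM !normc_expi; congr (_ / _ ^+ 2).
have E x y : normc (expi x - r%:C * expi y) = normc ((expi x * conjc (expi y)) - r%:C).
  have e : normc (conjc (expi y)) = 1 by rewrite normc_conj normc_expi.
  rewrite -[LHS]mulr1 -[X in _ * X = _]e -normcM mulrBl.
  by rewrite -mulrA expi_mul_conj mulr1.
rewrite !E -!expiN -!expiD -[t - s]opprB !normcE /= cosN sinN.
by rewrite oppr0 !addr0 sqrrN.
Qed.

Lemma poisson_Re f z : anbhd f -> normc z < 1 ->
  complex.Re (f z) = imean (fun t => pk z t * complex.Re (f (expi t))).
Proof.
move=> fa z1; rewrite -{1}(poisson_formula fa z1) Re_cmean.
by apply: eq_imean => t _; rewrite ReZ.
Qed.

Lemma poisson_Im f z : anbhd f -> normc z < 1 ->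
  complex.Im (f z) = imean (fun t => pk z t * complex.Im (f (expi t))).
Proof.
move=> fa z1; rewrite -{1}(poisson_formula fa z1) Im_cmean.
by apply: eq_imean => t _; rewrite ImZ.
Qed.

Lemma poisson_normc f z : anbhd f -> normc z < 1 ->
  normc (f z) <= imean (fun t => pk z t * normc (f (expi t))).
Proof.
move=> fa z1; rewrite -{1}(poisson_formula fa z1).
have pc t : rcont (fun t => (pk z t)%:C) t.
  by apply: rcont_real; exact: pk_cont.
apply: normc_cmean_le.
- by apply: rcont_ctg => t; apply: rcontM => //; exact: anbhd_rcont.
- apply: cont_itg => t; apply: continuousM; first exact: pk_cont.
  by apply: rcont_normc; exact: anbhd_rcont.
- by move=> t _; rewrite normc_realM ger0_norm// pk_ge0// ltW.
Qed.

Lemma max_principle f z M : anbhd f -> (forall t, normc (f (expi t)) <= M) ->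
  normc z < 1 -> normc (f z) <= M.
Proof.
move=> fa fM z1; apply: le_trans (poisson_normc fa z1) _.
rewrite -[leRHS]mulr1 -(imean_pk z1) -imeanZ; last exact: pk_itg.
apply: le_imean.
- apply: cont_itg => t; apply: continuousM; first exact: pk_cont.
  by apply: rcont_normc; exact: anbhd_rcont.
- by apply: rintgZ; exact: pk_itg.
- by move=> t _; rewrite mulrC ler_wpM2r ?pk_ge0// ltW.
Qed.

Definition dil r f : R[i] -> R[i] := fun z => f (r%:C * z).

Lemma anbhd_dil r f : 0 <= r < 1 -> analytic_on_disk f -> anbhd (dil r f).
Proof.
move=> /andP[r0 r1] /analytic_holo fa.
have P : 0 < 1 + r by rewrite ltr_pwDl.
exists (2 / (1 + r)); first by rewrite ltr_pdivlMr// mul1r; lra.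
move=> w; rewrite ltr_pdivlMr// => hw.
apply: (@holo_comp _ (fun w => r%:C * w) f).
  exact: (holoM (holo_cst r%:C w) (holo_id w)).
apply: fa; change (normc (r%:C * w) < 1); rewrite normc_realM ger0_norm//.
by have := normc_ge0 w; nra.
Qed.

Lemma disk_dil r z : 0 <= r < 1 -> normc z <= 1 -> disk (r%:C * z).
Proof.
move=> /andP[r0 r1] z1; change (normc (r%:C * z) < 1).
rewrite normc_realM ger0_norm//; have := normc_ge0 z; nra.
Qed.

End PoissonKernel.

(** * Second-order estimates from the Cauchy integral *)

Section QuadraticEstimate.
Variable R : realType.
Implicit Types (f : R[i] -> R[i]) (z w : R[i]) (t d M : R).

Definition cauchyint (h : R -> R[i]) z := cmean (fun t => h t * cauchyk z t).

(** After its linear term at [z], the kernel [1 / (expi t - w)] has remainder exactly [(w - z)^2 /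
    ((expi t - w) (expi t - z)^2)], and [d] bounds all the denominators from below. *)
Lemma cauchyint_quad (h : R -> R[i]) z d : (forall t, rcont h t) -> 0 < d ->
  normc z <= 1 - d ->
  exists D, normc D <= imean (fun t => normc (h t)) / d ^+ 2 /\
    forall w, normc w <= 1 - d ->
      normc (cauchyint h w - cauchyint h z - D * (w - z)) <=
      imean (fun t => normc (h t)) / d ^+ 3 * normc (w - z) ^+ 2.
Proof.
move=> hc d0 zd.
have lt1 w : normc w <= 1 - d -> normc w < 1 by move=> /le_lt_trans; apply; lra.
have inv_le w t : normc w <= 1 - d -> (normc (expi t - w))^-1 <= d^-1.
  move=> wd; have h1 := expi_sub_ge w t.
  have h2 : d <= normc (expi t - w) by apply: le_trans h1; move: wd; lra.
  by rewrite lef_pV2// posrE (lt_le_trans d0).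
have ib w t : 0 <= (normc (expi t - w))^-1 by rewrite invr_ge0 normc_ge0.
pose k2 t := h t * (expi t / (expi t - z) ^+ 2).
have vc w t : normc w <= 1 - d -> rcont (fun t => (expi t - w)^-1) t.
  move=> wd; apply: rcontV; first exact: expi_sub_neq0 (lt1 _ wd).
  exact: rcontB (rcont_expi t) (rcont_cst w t).
have kc w t : normc w <= 1 - d -> rcont (fun t => h t * cauchyk w t) t.
  by move=> wd; apply: rcontM => //; exact: rcont_cauchyk (lt1 _ wd).
have k2c t : rcont k2 t.
  have -> : k2 = fun t => h t * (expi t * ((expi t - z)^-1 * (expi t - z)^-1)).
    by apply/funext => u; rewrite /k2 -expr2 exprVn.
  apply: rcontM => //; apply: rcontM (rcont_expi t) _.
  by apply: rcontM; exact: vc.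
have nhc : itg (fun t => normc (h t)).
  by apply: cont_itg => t; exact: rcont_normc.
exists (cmean k2); split.
  rewrite mulrC -imeanZ//; apply: normc_cmean_le.
  - by apply: rcont_ctg.
  - exact: rintgZ.
  - move=> t _; rewrite /k2 normcM normcf normc_expi mul1r normcX mulrC.
    rewrite ler_wpM2r ?normc_ge0// -!exprVn.
    by rewrite lerXn2r ?nnegrE ?ib ?inv_le// invr_ge0 ltW.
move=> w wd.
have i1 : ctg (fun t => h t * cauchyk w t) by apply: rcont_ctg => t; exact: kc.
have i2 : ctg (fun t => h t * cauchyk z t) by apply: rcont_ctg => t; exact: kc.
have i3 : ctg k2 by exact: rcont_ctg.
have i4 : ctg (fun t => (w - z) * k2 t) by exact: cintgM.
have E t : h t * cauchyk w t - h t * cauchyk z t - (w - z) * k2 t =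
  h t * (expi t * (w - z) ^+ 2 * (expi t - w)^-1 * (expi t - z) ^- 2).
  have := expi_sub_neq0 t (lt1 _ wd); have := expi_sub_neq0 t (lt1 _ zd).
  rewrite /cauchyk /k2 => n1 n2; field.
  by rewrite n1 n2.
have -> : cauchyint h w - cauchyint h z - cmean k2 * (w - z) =
    cmean (fun t => h t * cauchyk w t - h t * cauchyk z t - (w - z) * k2 t).
  rewrite cmeanB//; last exact: cintgB.
  by rewrite cmeanB// cmeanM// [_ * cmean _]mulrC.
apply: (@le_trans _ _ (imean (fun t => (d ^- 3 * normc (w - z) ^+ 2) * normc (h t)))).
  apply: normc_cmean_le.
  - by apply: cintgB => //; exact: cintgB.
  - exact: rintgZ.
  - move=> t _; rewrite E !(normcM, normcX, normcV) normc_expi mul1r mulrC.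
    rewrite ler_wpM2r ?normc_ge0// [d ^- 3 * _]mulrC -mulrA ler_wpM2l ?sqr_ge0//.
    rewrite -!exprVn (exprS _ 2); apply: ler_pM; rewrite ?ib ?inv_le ?sqr_ge0//.
    by rewrite lerXn2r ?nnegrE ?ib ?inv_le// invr_ge0 ltW.
by rewrite imeanZ// mulrC mulrA.
Qed.

Lemma cauchyint_analytic (h : R -> R[i]) : (forall t, rcont h t) ->
  analytic_on_disk (cauchyint h).
Proof.
move=> hc; apply/analytic_holo => z z1.
have z1' : normc z < 1 by [].
pose d := (1 - normc z) / 2.
have d0 : 0 < d by rewrite /d divr_gt0// subr_gt0.
have zd : normc z <= 1 - d by rewrite /d; lra.
have [D [_ hD]] := cauchyint_quad hc d0 zd.
apply: (@quad_holo _ _ z D (imean (fun t => normc (h t)) / d ^+ 3) d d0).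
  apply: divr_ge0; last by rewrite exprn_ge0// ltW.
  by apply: imean_ge0 => t _; exact: normc_ge0.
move=> w wz; apply: hD.
have := normcD (w - z) z; rewrite subrK; move: wz; rewrite /d; lra.
Qed.

Lemma cauchyint_anbhd f z : anbhd f -> normc z < 1 ->
  cauchyint (fun t => f (expi t)) z = f z.
Proof. exact: cauchy_formula. Qed.

(** The constant depends on [r] alone, so a family that is bounded on the larger disk has common
    bounds for its derivatives and its quadratic errors: the equicontinuity in Montel's theorem. *)
Lemma analytic_quad (r : R) : 0 <= r < 1 -> exists2 C : R, 0 <= C &
  forall f M, analytic_on_disk f ->
  (forall z, normc z <= (1 + r) / 2 -> normc (f z) <= M) ->
  forall z, normc z <= r -> exists D, normc D <= C * M /\
  forall w, normc w <= r ->
    normc (f w - f z - D * (w - z)) <= C * M * normc (w - z) ^+ 2.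
Proof.
(* Cauchy's formula is used on the circle of radius [rho]; rescaling it to the unit circle sends the
   disk of radius [r] to that of radius [1 - d]. *)
move=> /andP[r0 r1]; pose rho := (1 + r) / 2; pose d := 1 - r / rho.
have rho0 : 0 < rho by rewrite /rho; lra.
have rho1 : rho < 1 by rewrite /rho; lra.
have d0 : 0 < d by rewrite /d subr_gt0 ltr_pdivrMr// mul1r /rho; lra.
have nn n : 0 <= d ^- n by rewrite invr_ge0 exprn_ge0// ltW.
have rr n : 0 <= rho ^- n by rewrite invr_ge0 exprn_ge0// ltW.
have c1 : 0 <= rho^-1 * d ^- 2 by rewrite mulr_ge0// invr_ge0 ltW.
have c2 : 0 <= rho ^- 2 * d ^- 3 by rewrite mulr_ge0.
exists (rho^-1 * d ^- 2 + rho ^- 2 * d ^- 3); first exact: addr_ge0.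
move=> f M fa fM z zr.
have M0 : 0 <= M.
  by apply: le_trans (normc_ge0 _) (fM 0 _); rewrite normc0 ltW.
have rin : 0 <= rho < 1 by rewrite ltW.
have fna := anbhd_dil rin fa.
have rc0 : rho%:C != 0 by rewrite eq_complex /= gt_eqF.
have hc t : rcont (fun t => dil rho f (expi t)) t by exact: anbhd_rcont.
pose u z := rho^-1%:C * z.
have uE w : rho%:C * u w = w by rewrite /u fmorphV mulVKf.
have un w : normc w <= r -> normc (u w) <= 1 - d.
  move=> wr; rewrite /u normc_realM ger0_norm ?invr_ge0 ?(ltW rho0)//.
  by rewrite /d subKr mulrC ler_wpM2r// invr_ge0 ltW.
have u1 w : normc w <= r -> normc (u w) < 1.
  by move=> /un /le_lt_trans; apply; lra.
have [D [D1 D2]] := cauchyint_quad hc d0 (un _ zr).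
have mM : imean (fun t => normc (dil rho f (expi t))) <= M.
  rewrite -[leRHS](imean_cst M); apply: le_imean.
  - by apply: cont_itg => t; exact: rcont_normc.
  - exact: rintg_cst.
  - move=> t _; apply: fM.
    by rewrite normc_realM normc_expi mulr1 ger0_norm// ltW.
exists (rho^-1%:C * D); split.
  rewrite normc_realM ger0_norm ?invr_ge0 ?(ltW rho0)//.
  apply: (@le_trans _ _ (rho^-1 * (M / d ^+ 2))).
    rewrite ler_wpM2l ?invr_ge0 ?(ltW rho0)//; apply: le_trans D1 _.
    by rewrite ler_wpM2r.
  by rewrite mulrDl -mulrA [_ * M]mulrC lerDl mulr_ge0.
move=> w wr; have := D2 _ (un _ wr).
rewrite !cauchyint_anbhd ?u1// /dil !uE.
have -> : D * (u w - u z) = rho^-1%:C * D * (w - z) by rewrite /u; ring.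
move=> /le_trans; apply.
have -> : u w - u z = rho^-1%:C * (w - z) by rewrite /u; ring.
rewrite normc_realM ger0_norm ?invr_ge0 ?(ltW rho0)// exprMn mulrA.
rewrite ler_wpM2r ?sqr_ge0//.
apply: (@le_trans _ _ (M / d ^+ 3 * rho^-1 ^+ 2)).
  by rewrite ler_wpM2r ?sqr_ge0// ler_wpM2r.
rewrite exprVn mulrDl -[leLHS]add0r; apply: lerD; first exact: mulr_ge0.
by rewrite [leRHS]mulrC -mulrA [_ * rho ^- 2]mulrC.
Qed.

End QuadraticEstimate.

(** * Limits of analytic functions along an ultrafilter *)

Section UltrafilterLimits.
Variables (R : realType) (T : Type) (U : set_system T).
Hypothesis UU : UltraFilter U.

Lemma ultra_limR (g : T -> R) (M : R) : (forall x, `|g x| <= M) ->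
  exists l : R, forall e : R, 0 < e -> \forall x \near U, `|g x - l| < e.
Proof.
move=> gM; have := @segment_compact R (- M) M.
have gi : (g @ U) (`[- M, M]%classic : set R).
  change (\forall x \near U, g x \in `[- M, M]).
  apply: filterE => x; rewrite in_itv/= -ler_norml.
  exact: gM.
move=> /(_ (g @ U) _ gi) [l [_ cl]]; exists l => e e0.
have [//|h] := in_ultra_setVsetC [set x | `|g x - l| < e] UU.
have h' : (g @ U) [set y | ~ `|y - l| < e] by exact: h.
have [y [/= y1 y2]] := cl _ _ h' (nbhsx_ballx l e e0).
by exfalso; apply: y1; rewrite distrC.
Qed.

Lemma ultra_lim (g : T -> R[i]) M : (forall x, normc (g x) <= M) ->
  exists l : R[i], forall e : R, 0 < e -> \forall x \near U, normc (g x - l) < e.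
Proof.
move=> gM.
have [a ha] := ultra_limR (fun x => le_trans (normc_Re (g x)) (gM x)).
have [b hb] := ultra_limR (fun x => le_trans (normc_Im (g x)) (gM x)).
exists (a +i* b) => e e0; have e20 : 0 < e / 2 by rewrite divr_gt0.
have := ha _ e20; have := hb _ e20; apply: filterS2 => x h2 h1.
apply: le_lt_trans (normc_le_ReIm _) _.
by rewrite (splitr e) ReD ImD ReN ImN /= ltrD.
Qed.

Definition ulim (g : T -> R[i]) (l : R[i]) :=
  forall e : R, 0 < e -> \forall x \near U, normc (g x - l) < e.

Lemma ulim_le (g : T -> R[i]) l M : ulim g l -> (forall x, normc (g x) <= M) ->
  normc l <= M.
Proof.
move=> gl gM; apply/ler_addgt0Pr => e /gl/filter_ex[x hx].
rewrite -[l](subrKC (g x)); apply: le_trans (normcD _ _) _.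
by rewrite normc_sub in hx; apply: lerD => //; exact: ltW.
Qed.

Lemma ulimD g1 g2 l1 l2 : ulim g1 l1 -> ulim g2 l2 ->
  ulim (fun x => g1 x + g2 x) (l1 + l2).
Proof.
move=> h1 h2 e e0; have e20 : 0 < e / 2 by rewrite divr_gt0.
have := h1 _ e20; have := h2 _ e20; apply: filterS2 => x x2 x1.
rewrite opprD addrACA; apply: le_lt_trans (normcD _ _) _.
by rewrite (splitr e) ltrD.
Qed.

Lemma ulimM c g l : ulim g l -> ulim (fun x => c * g x) (c * l).
Proof.
move=> h e e0; have c0 : 0 < 1 + normc c by rewrite ltr_pwDl// normc_ge0.
have := h _ (divr_gt0 e0 c0); apply: filterS => x.
rewrite -mulrBr normcM ltr_pdivlMr// => hx.
by apply: le_lt_trans hx; rewrite mulrC ler_wpM2l ?normc_ge0// lerDr.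
Qed.

(** The derivatives at [z] are bounded too, so they have an ultralimit [l], and the quadratic
    estimate passes to the limit with [l] as the derivative of [f]. *)
Lemma analytic_ulim (F : T -> R[i] -> R[i]) f :
  (forall x, analytic_on_disk (F x)) ->
  (forall r : R, 0 <= r < 1 -> exists M, forall x z, normc z <= r -> normc (F x z) <= M) ->
  (forall z, disk z -> ulim (F^~ z) (f z)) -> analytic_on_disk f.
Proof.
move=> Fa FM Ff; apply/analytic_holo => z z1.
have z1' : normc z < 1 by [].
have n0 := normc_ge0 z.
pose r := (1 + normc z) / 2.
have r1 : 0 <= r < 1 by rewrite /r; apply/andP; split; lra.
have rr1 : 0 <= (1 + r) / 2 < 1 by move: r1 => /andP[? ?]; apply/andP; split; lra.
have [C C0 hC] := analytic_quad r1.
have [M hM] := FM _ rr1.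
have zr : normc z <= r by rewrite /r; lra.
have /choice[D hD] : forall x, exists D, normc D <= C * M /\ forall w, normc w <= r ->
    normc (F x w - F x z - D * (w - z)) <= C * M * normc (w - z) ^+ 2.
  by move=> x; apply: hC => // w; exact: hM.
have [l hl] := ultra_lim (fun x => (hD x).1).
have CM : 0 <= C * M.
  by have [x _] := filter_ex (filterT : U setT); exact: le_trans (normc_ge0 _) (hD x).1.
apply: (@quad_holo _ f z l (C * M) ((1 - normc z) / 2)) => //.
  by rewrite divr_gt0// subr_gt0.
move=> w wz; have wr : normc w <= r.
  by have := normcD (w - z) z; rewrite subrK /r; move: wz; lra.
have w1 : disk w.
  by change (normc w < 1); move: r1 wr => /andP[_ ?]; lra.
apply: (@ulim_le (fun x => F x w - F x z - D x * (w - z))); last first.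
  by move=> x; exact: (hD x).2.
have h1 := ulimD (ulimD (Ff _ w1) (ulimM (-1) (Ff _ z1))) (ulimM (z - w) hl).
rewrite mulN1r in h1.
have -> : f w - f z - l * (w - z) = f w - f z + (z - w) * l by ring.
move=> e e0; apply: filterS (h1 e e0) => x.
by congr (normc (_ - _) < e); ring.
Qed.

End UltrafilterLimits.

(** * Integral means and the growth of Hardy functions *)

Section PowerMeans.
Variable R : realType.
Implicit Types (f : R[i] -> R[i]) (z w : R[i]) (t r p a x A : R) (h : R -> R).

Lemma itg_bounded h M : measurable_fun setT h ->
  (forall t, t \in `[0, 2 * pi] -> `|h t| <= M) -> itg h.
Proof.
move=> mh hM; apply: measurable_bounded_integrable => //.
- by rewrite /= lebesgue_measure_itv/=; case: ifP => // _; rewrite -EFinB ltry.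
- exact: measurable_funS mh.
- exists M; split; first exact: num_real.
  by move=> y My t /= /hM /le_trans; apply; exact: ltW.
Qed.

Lemma circle_integral_itg (h : R[i] -> R) : itg (fun t => h (expi t)) ->
  circle_integral (fun xi => (h xi)%:E) = (imean (fun t => h (expi t)))%:E.
Proof.
move=> hi; rewrite /circle_integral /imean EFinM /rint /Rintegral fineK//.
exact: integrable_fin_num.
Qed.

Lemma cont_bounded h : continuous h ->
  exists M, forall t, t \in `[0, 2 * pi] -> h t <= M.
Proof.
move=> hc; have [c _ hM] := EVT_max (ltW (twopi_gt0 R)) (continuous_subspaceT hc).
by exists (h c).
Qed.

Lemma dil_cont f r : analytic_on_disk f -> 0 <= r < 1 ->
  continuous (fun t => normc (f (r%:C * expi t))).
Proof.
move=> fa r01 t; apply: (@rcont_normc _ (fun t => dil r f (expi t))).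
exact: anbhd_rcont (anbhd_dil r01 fa).
Qed.

Lemma powR_itg h p : continuous h -> 0 <= p ->
  (forall t, 0 <= h t) -> itg (fun t => h t `^ p).
Proof.
move=> hc p0 h0; have [M hM] := cont_bounded hc.
apply: (@itg_bounded _ (M `^ p)).
  apply: (@measurableT_comp _ _ _ _ _ _ (fun x : R => x `^ p)).
    exact: measurable_powR.
  exact: continuous_measurable_fun.
move=> t /hM tM; rewrite ger0_norm ?powR_ge0//.
by apply: ge0_ler_powR => //; rewrite nnegrE// (le_trans (h0 t)).
Qed.

Definition pmean p r f := imean (fun t => normc (f (r%:C * expi t)) `^ p).

Lemma pmean_itg p r f : analytic_on_disk f -> 0 <= r < 1 -> 0 <= p ->
  itg (fun t => normc (f (r%:C * expi t)) `^ p).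
Proof.
move=> fa r01 p0; apply: powR_itg => //; first exact: dil_cont.
by move=> t; exact: normc_ge0.
Qed.

Lemma pmean_ge0 p r f : 0 <= pmean p r f.
Proof. by apply: imean_ge0 => t _; exact: powR_ge0. Qed.

Lemma hardy_norm_le p f A : 0 < p -> 0 <= A -> analytic_on_disk f ->
  (hardy_norm p f <= A%:E)%E <-> forall r, 0 < r < 1 -> pmean p r f <= A `^ p.
Proof.
move=> p0 A0 fa.
have E r : 0 < r < 1 -> (circle_integral
    (fun xi => (normc (f (r%:C * xi)) `^ p)%:E) `^ p^-1)%E =
    (pmean p r f `^ p^-1)%:E.
  move=> /andP[r0 r1].
  rewrite (@circle_integral_itg (fun xi => normc (f (r%:C * xi)) `^ p)) ?poweR_EFin//.
  by apply: pmean_itg => //; rewrite ?r1 ltW.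
have pK x : 0 <= x -> (x `^ p^-1) `^ p = x.
  by move=> x0; rewrite -powRrM mulVf ?gt_eqF// powRr1.
have pK' x : 0 <= x -> (x `^ p) `^ p^-1 = x.
  by move=> x0; rewrite -powRrM mulfV ?gt_eqF// powRr1.
split=> [h r r01|h].
  have : ((pmean p r f `^ p^-1)%:E <= A%:E)%E.
    apply: le_trans h; rewrite -E//; apply: ereal_sup_ubound.
    by exists r => //=; rewrite in_itv.
  rewrite lee_fin => /(ge0_ler_powR (ltW p0)).
  by rewrite !nnegrE powR_ge0 A0 pK ?pmean_ge0//; apply.
apply: ge_ereal_sup => _ [r /= r01 <-]; rewrite in_itv/= in r01.
rewrite E// lee_fin -[leRHS](pK' A A0); apply: ge0_ler_powR.
- by rewrite invr_ge0 ltW.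
- by rewrite nnegrE pmean_ge0.
- by rewrite nnegrE powR_ge0.
- exact: h.
Qed.

Lemma hardy_norm_ge0 p f : (0 <= hardy_norm p f)%E.
Proof.
apply: le_trans (_ : (0 <= (circle_integral
   (fun xi => (normc (f ((2^-1)%:C * xi)) `^ p)%:E) `^ p^-1))%E) _.
  exact: poweR_ge0.
apply: ereal_sup_ubound; exists 2^-1 => //=.
by rewrite in_itv/= invr_gt0 ltr0n/= invf_lt1// ltr1n.
Qed.

Lemma hardyP p f : 0 < p -> hardy p f <->
  analytic_on_disk f /\ exists2 A, 0 <= A & forall r, 0 < r < 1 -> pmean p r f <= A.
Proof.
move=> p0; split=> [[fa foo]|[fa [A A0 hA]]].
  split => //; have := hardy_norm_ge0 p f; move: foo.
  case e : (hardy_norm p f) => [a| |]// _ a0.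
  have a0' : 0 <= a by rewrite -lee_fin.
  exists (a `^ p); first exact: powR_ge0.
  by apply/(hardy_norm_le p0 a0' fa); rewrite e.
split => //; apply: (@le_lt_trans _ _ (A `^ p^-1)%:E); last exact: ltry.
apply/(hardy_norm_le p0 _ fa); first exact: powR_ge0.
by rewrite -powRrM mulVf ?gt_eqF// powRr1.
Qed.

(** For [x > a] the factor [x ^ (p - 1)] exceeds [a ^ (p - 1)]. Integrated, with [a] the p-th root
    of the mean of the powers, this is Jensen's inequality up to a factor 2. *)
Lemma weak_jensen p a x : 1 <= p -> 0 < a -> 0 <= x ->
  x <= a + a `^ (1 - p) * x `^ p.
Proof.
move=> p1 a0 x0; have [xa|ax] := leP x a.
  by apply: le_trans xa _; rewrite lerDl mulr_ge0// powR_ge0.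
have x1 : 0 < x by exact: lt_trans ax.
rewrite -[leLHS]add0r; apply: lerD; first exact: ltW.
rewrite -opprB powRN mulrC ler_pdivlMr ?powR_gt0//.
rewrite -(mulr_powRB1 x0 (lt_le_trans ltr01 p1)) ler_wpM2l//.
by apply: ge0_ler_powR; rewrite ?nnegrE ?subr_ge0 ?(ltW a0)// ltW.
Qed.

Lemma jensen_solve p a B x : 1 <= p -> 0 < a -> B = a `^ p ->
  x <= a + a `^ (1 - p) * B -> x <= 2 * a.
Proof.
move=> p1 a0 -> /le_trans; apply; rewrite -powRD; last by
  rewrite (gt_eqF a0); apply/implyP.
by rewrite subrK powRr1 ?(ltW a0)//; lra.
Qed.

Lemma growth p f A z : 1 <= p -> analytic_on_disk f -> 0 < A ->
  (forall r, 0 < r < 1 -> pmean p r f <= A) -> disk z ->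
  normc (f z) <= 2 * (2 * A / (1 - normc z)) `^ p^-1.
Proof.
move=> p1 fa A0 fA z1; have z1' : normc z < 1 by [].
have p0 : 0 < p by exact: lt_le_trans p1.
apply/ler_addgt0Pr => e e0.
have fc := holo_ccont ((analytic_holo f).1 fa z z1).
have [d d0 hd] := fc _ e0.
pose K := 2 * A / (1 - normc z).
have K0 : 0 < K by rewrite divr_gt0 ?mulr_gt0// subr_gt0.
set a := _ `^ p^-1; have a0 : 0 < a by rewrite powR_gt0.
(* The means are controlled on circles inside the disk, so the estimate is proved for the dilation
   of [f] by [r], with [r * z] close enough to [z] for continuity to conclude. *)
pose r := Num.max 2^-1 (1 - d / 2).
have r01 : 0 < r < 1.
  apply/andP; split; first by rewrite lt_max invr_gt0 ltr0n.
  by rewrite gt_max invf_lt1 ?ltr1n//= ltrBlDr ltrDl divr_gt0.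
have r01' : 0 <= r < 1 by move: r01 => /andP[/ltW -> ->].
have near_z : normc (r%:C * z - z) < d.
  have -> : r%:C * z - z = (r - 1)%:C * z by rewrite rmorphB rmorph1; ring.
  rewrite normc_realM distrC ger0_norm ?subr_ge0; last by move: r01 => /andP[_ /ltW].
  have : 1 - r <= d / 2 by rewrite lerBlDr -lerBlDl le_max lexx orbT.
  have := normc_ge0 z; move: z1' d0; nra.
have h := hd _ near_z.
suff : normc (f (r%:C * z)) <= 2 * a.
  have := normcD (f z - f (r%:C * z)) (f (r%:C * z)).
  by rewrite subrK normc_sub => h1 h2; apply: le_trans h1 _; rewrite addrC lerD// ltW.
have fna := anbhd_dil r01' fa.
apply: (@jensen_solve p a K) => //.
  by rewrite /a -powRrM mulVf ?gt_eqF// powRr1// ltW.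
apply: le_trans (poisson_normc fna z1') _.
have i1 := pk_itg z1'.
have cf : continuous (fun t => normc (f (r%:C * expi t))) by exact: dil_cont.
have i2 := pmean_itg fa r01' (ltW p0).
have pb t := pk_le t z1'.
have c0 : 0 <= a `^ (1 - p) by exact: powR_ge0.
apply: (@le_trans _ _ (imean (fun t => a * pk z t +
    (a `^ (1 - p) * (2 / (1 - normc z))) * normc (f (r%:C * expi t)) `^ p))).
  apply: le_imean.
  - apply: cont_itg => t; apply: continuousM; first exact: pk_cont.
    exact: cf.
  - by apply: rintgD; apply: rintgZ.
  - move=> t _; have P := pk_ge0 t (ltW z1').
    apply: le_trans (ler_wpM2l P (weak_jensen p1 a0 (normc_ge0 (dil r f (expi t))))) _.
    rewrite mulrDr [pk z t * a]mulrC lerD2l mulrCA -mulrA ler_wpM2l//.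
    by rewrite ler_wpM2r ?powR_ge0.
rewrite (imeanD (rintgZ a i1) (rintgZ _ i2)) (imeanZ _ i1) (imeanZ _ i2).
rewrite (imean_pk z1') mulr1.
rewrite lerD2l -mulrA ler_wpM2l// /K mulrAC ler_wpM2r ?invr_ge0 ?subr_ge0 ?(ltW z1')//.
by rewrite ler_wpM2l//; exact: fA.
Qed.

End PowerMeans.

(** * From pointwise to uniform convergence on smaller disks *)

Section UniformConvergence.
Variable R : realType.

Let cell_close (x y N : R) : 0 < N -> -1 <= x -> -1 <= y ->
  Num.truncn ((x + 1) * N) = Num.truncn ((y + 1) * N) -> `|x - y| <= N^-1.
Proof.
move=> N0 x1 y1 e.
have hx : 0 <= (x + 1) * N by rewrite mulr_ge0 ?(ltW N0)//; lra.
have hy : 0 <= (y + 1) * N by rewrite mulr_ge0 ?(ltW N0)//; lra.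
have /andP[a1 a2] := truncn_itv hx; have /andP[b1 b2] := truncn_itv hy.
rewrite e in a1 a2; rewrite -natr1 in a2 b2.
have P : 0 < N^-1 by rewrite invr_gt0.
have E : `|x - y| * N <= 1.
  rewrite -[X in _ * X](ger0_norm (ltW N0)) -normrM ler_norml.
  by apply/andP; split; move: a1 a2 b1 b2; lra.
by rewrite -[leRHS]mul1r ler_pdivlMr.
Qed.

Lemma net_disk (r d : R) : 0 <= r <= 1 -> 0 < d -> exists s : seq R[i],
  (forall z, z \in s -> normc z <= r) /\
  forall z, normc z <= r -> exists2 w, w \in s & normc (z - w) <= d.
Proof.
move=> /andP[r0 r1] d0.
pose n := (Num.truncn (2 / d)).+1.
have n0 : 0 < n%:R :> R by rewrite ltr0n.
pose c (x : R) := Num.truncn ((x + 1) * n%:R).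
pose P i j (z : R[i]) := [/\ normc z <= r, c (complex.Re z) = i & c (complex.Im z) = j].
(* Each grid cell that meets the disk of radius [r] is represented by one of its points in that
   disk; the other cells get 0, which lies in the disk as well. *)
pose rep i j := match pselect (exists z, P i j z) with
  | left h => sval (cid h) | right _ => 0 end.
have repP i j z : P i j z -> P i j (rep i j).
  by move=> h; rewrite /rep; case: pselect => [h'|[]]; [exact: (svalP (cid h'))|exists z].
pose m := (2 * n).+1.
have cm x : `|x| <= 1 -> (c x < m)%N.
  rewrite ler_norml => /andP[x1 x2].
  have h : 0 <= (x + 1) * n%:R by rewrite mulr_ge0 ?(ltW n0)//; lra.
  rewrite /m ltnS -(@ler_nat R).
  have /andP[h1 _] := truncn_itv h; apply: le_trans h1 _.
  by rewrite natrM ler_wpM2r ?(ltW n0)//; lra.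
exists [seq rep i j | i <- iota 0 m, j <- iota 0 m]; split.
  move=> _ /allpairsP[[i j] [_ _ ->]] /=; rewrite /rep.
  by case: pselect => [h|_]; [have [] := svalP (cid h)|rewrite normc0].
move=> z zr.
have zP : P (c (complex.Re z)) (c (complex.Im z)) z by split.
have [h1 h2 h3] := repP _ _ _ zP.
have R1 w : normc w <= r -> `|complex.Re w| <= 1 by move=> h; rewrite (le_trans (normc_Re _))// (le_trans h).
have I1 w : normc w <= r -> `|complex.Im w| <= 1 by move=> h; rewrite (le_trans (normc_Im _))// (le_trans h).
exists (rep (c (complex.Re z)) (c (complex.Im z))).
  apply/allpairsP; exists (c (complex.Re z), c (complex.Im z)); split=> //.
    by rewrite mem_iota add0n; apply/andP; split=> //; apply: cm; exact: R1.
  by rewrite mem_iota add0n; apply/andP; split=> //; apply: cm; exact: I1.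
have lo (x : R) : `|x| <= 1 -> -1 <= x by rewrite ler_norml => /andP[].
apply: le_trans (normc_le_ReIm _) _; rewrite ReD ImD ReN ImN.
have k1 := cell_close n0 (lo _ (R1 _ zr)) (lo _ (R1 _ h1)) (esym h2).
have k2 := cell_close n0 (lo _ (I1 _ zr)) (lo _ (I1 _ h1)) (esym h3).
apply: le_trans (lerD k1 k2) _.
have h : 2 / d < n%:R by exact: truncnS_gt.
rewrite ltr_pdivrMr// in h.
have -> : n%:R^-1 + n%:R^-1 = 2 / n%:R :> R by rewrite mulrDl mul1r.
by rewrite ler_pdivrMr// mulrC ltW.
Qed.

Lemma near_seq (T : Type) (U : set_system T) (FU : Filter U) (I : eqType)
    (s : seq I) (P : I -> T -> Prop) :
  (forall i, i \in s -> \forall x \near U, P i x) ->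
  \forall x \near U, forall i, i \in s -> P i x.
Proof.
elim: s => [|i s ih] h; first by apply: filterE.
have h1 := h i (mem_head _ _).
have h2 : \forall x \near U, forall j, j \in s -> P j x.
  by apply: ih => j js; apply: h; rewrite inE js orbT.
apply: filterS2 h1 h2 => x x1 x2 j; rewrite inE => /predU1P[->//|]; exact: x2.
Qed.

Variables (T : Type) (U : set_system T).
Hypothesis UU : UltraFilter U.

(** The family and its limit share a Lipschitz constant on the disk of radius [r], so convergence on
    a finite net is enough. *)
Lemma ulim_unif (F : T -> R[i] -> R[i]) f :
  (forall x, analytic_on_disk (F x)) ->
  (forall r : R, 0 <= r < 1 -> exists M, forall x z, normc z <= r -> normc (F x z) <= M) ->
  (forall z, disk z -> ulim U (F^~ z) (f z)) ->
  forall r e : R, 0 <= r < 1 -> 0 < e ->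
  \forall x \near U, forall z, normc z <= r -> normc (F x z - f z) <= e.
Proof.
move=> Fa FM Ff r e r01 e0; have /andP[r0 r1] := r01.
have rr1 : 0 <= (1 + r) / 2 < 1 by apply/andP; split; lra.
have [C C0 hC] := analytic_quad r01.
have [M hM] := FM _ rr1.
have [x0 _] := filter_ex (filterT : U setT).
have M0 : 0 <= M by apply: le_trans (normc_ge0 _) (hM x0 0 _); rewrite normc0; lra.
(* [C * M] from the derivative and twice as much from the quadratic term, where
   [normc (w - z) <= 2]; the [+ 1] allows division by [L]. *)
pose L := 3 * (C * M) + 1.
have CM : 0 <= C * M by rewrite mulr_ge0.
have L0 : 0 < L by rewrite /L; lra.
have lip x z w : normc z <= r -> normc w <= r ->
    normc (F x w - F x z) <= L * normc (w - z).
  move=> zr wr; have [D [D1 D2]] := hC _ _ (Fa x) (hM x) z zr.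
  rewrite -[F x w - F x z](subrK (D * (w - z))).
  apply: le_trans (normcD _ _) _; apply: le_trans (lerD (D2 w wr) (lexx _)) _.
  rewrite normcM expr2 mulrA -mulrDl ler_wpM2r ?normc_ge0//.
  have h : normc (w - z) <= 2.
    by apply: le_trans (normcB _ _) _; move: zr wr r1; lra.
  by have := ler_wpM2l CM h; rewrite /L; move: D1; lra.
have limlip z w : normc z <= r -> normc w <= r ->
    normc (f w - f z) <= L * normc (w - z).
  move=> zr wr; apply: (@ulim_le _ _ _ UU (fun x => F x w - F x z)); last by move=> x; exact: lip.
  have zd : disk z by exact: le_lt_trans r1.
  have wd : disk w by exact: le_lt_trans r1.
  have h := ulimD UU (Ff _ wd) (ulimM UU (-1) (Ff _ zd)).
  rewrite mulN1r in h => e1 e10; apply: filterS (h e1 e10) => x.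
  by rewrite mulN1r.
have [s [s1 s2]] : exists s : seq R[i], (forall z, z \in s -> normc z <= r) /\
  forall z, normc z <= r -> exists2 w, w \in s & normc (z - w) <= e / 3 / L.
  by apply: net_disk; [rewrite r0 ltW|rewrite !divr_gt0].
have e30 : 0 < e / 3 by rewrite divr_gt0.
have : \forall x \near U, forall w, w \in s -> normc (F x w - f w) < e / 3.
  apply: near_seq => w /s1 wr; apply: Ff => //; exact: le_lt_trans r1.
apply: filterS => x hx z zr; have [w ws zw] := s2 _ zr.
have h1 := lip x _ _ (s1 _ ws) zr.
have h2 := limlip _ _ zr (s1 _ ws).
have h3 := hx _ ws.
have zw' : L * normc (z - w) <= e / 3 by rewrite mulrC -ler_pdivlMr.
have -> : F x z - f z = (F x z - F x w) + (F x w - f w) + (f w - f z) by ring.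
apply: le_trans (normcD _ _) _.
apply: le_trans (lerD (normcD _ _) (lexx _)) _.
rewrite (normc_sub w z) in h2.
by move: h1 h2 h3 zw'; lra.
Qed.

End UniformConvergence.

(** * A sufficient condition for compactness on Hardy spaces *)

Section CompactHardy.
Variable R : realType.

Lemma extract_subseq (a : nat -> \bar R) : (forall n, 0 <= a n)%E ->
  (forall (e : R) m, 0 < e -> exists n, (m < n)%N /\ (a n <= e%:E)%E) ->
  exists s : nat -> nat, {homo s : m n / (m < n)%N} /\
    a (s n) @[n --> \oo] --> 0%E.
Proof.
move=> a0 h.
have /choice[g hg] : forall km : nat * nat, exists n, (km.2 < n)%N /\
    (a n <= (km.1.+1%:R^-1 : R)%:E)%E.
  by move=> [k m]; apply: h; rewrite invr_gt0.
pose s := fix s n := match n with 0 => g (0%N, 0%N) | k.+1 => g (k.+1, s k) end.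
exists s; split.
  by apply: homo_ltn; [exact: ltn_trans|move=> n; exact: (hg (n.+1, s n)).1].
apply: (@squeeze_cvge _ _ _ _ (cst 0%E) _ (fun n => (n.+1%:R^-1 : R)%:E)).
- by near=> n; rewrite a0/=; case: (n) => [|k]; [exact: (hg (0%N, 0%N)).2|exact: (hg (k.+1, s k)).2].
- exact: cvg_cst.
- exact: cvge_harmonic.
Unshelve. all: by end_near. Qed.

Lemma analytic_comp (u phi : R[i] -> R[i]) : self_map phi -> analytic_on_disk u ->
  analytic_on_disk (u \o phi).
Proof.
move=> [/analytic_holo pa pd] /analytic_holo ua; apply/analytic_holo => z z1.
by apply: (@holo_comp _ phi u); [exact: pa|apply: ua; exact: pd].
Qed.

Lemma pmean_le (p r : R) (f : R[i] -> R[i]) (w : R -> R) :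
  analytic_on_disk f -> 0 <= r < 1 -> 0 <= p -> itg w ->
  (forall t, t \in `[0, 2 * pi] -> normc (f (r%:C * expi t)) `^ p <= w t) ->
  pmean p r f <= imean w.
Proof. by move=> fa r01 p0 wi h; apply: le_imean => //; exact: pmean_itg. Qed.

Variables (p : R) (phi : R[i] -> R[i]).
Hypothesis p1 : 1 <= p.
Hypothesis phis : self_map phi.
(** The integrals of [1 / (1 - |phi|)] over the sets where [|phi| > 1 - eta] tend to 0 with [eta],
    uniformly over the circles of radius [r]. An integrable majorant [w], which may depend on [r],
    stands for the integrand cut off to such a set. *)
Hypothesis phi_tail : forall e : R, 0 < e -> exists2 eta : R, 0 < eta < 1 &
  forall r, 0 < r < 1 -> exists w : R -> R, [/\ itg w, imean w <= e &
    forall t, t \in `[0, 2 * pi] -> 0 <= w t /\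
      (normc (phi (r%:C * expi t)) <= 1 - eta \/
       (1 - normc (phi (r%:C * expi t)))^-1 <= w t)].

(* Compactness of the limit set is obtained along an ultrafilter on nat, which
   replaces the diagonal extraction in Montel's theorem. *)
Theorem compact_hardy : compact_composition (hardy p) (hardy_norm p) phi.
Proof.
move=> u uX [M uM].
have p0 : 0 < p by exact: lt_le_trans p1.
pose A := (Num.max M 1) `^ p.
have A0 : 0 < A by rewrite powR_gt0// lt_max ltr01 orbT.
have ua n : analytic_on_disk (u n) by have [] := uX n.
have uA n r : 0 < r < 1 -> pmean p r (u n) <= A.
  apply: (hardy_norm_le p0 _ (ua n)).1; first by rewrite le_max ler01 orbT.
  by apply: le_trans (uM n) _; rewrite lee_fin le_max lexx.
have [U [UU Uoo]] := ultraFilterLemma (_ : ProperFilter \oo).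
pose g (z : R[i]) := 2 * (2 * A / (1 - normc z)) `^ p^-1.
have ug n z : disk z -> normc (u n z) <= g z.
  by move=> z1; apply: growth => //; exact: uA.
have /choice[v hv] : forall z, exists l, disk z -> ulim U (u^~ z) l.
  move=> z; have [z1|z1] := pselect (disk z); last by exists 0.
  by have [l hl] := ultra_lim UU (fun n => ug n z z1); exists l.
have ub (r : R) : 0 <= r < 1 ->
    exists M, forall n z, normc z <= r -> normc (u n z) <= M.
  move=> /andP[r0 r1]; exists (2 * (2 * A / (1 - r)) `^ p^-1) => n z zr.
  have z1 : disk z by exact: le_lt_trans r1.
  apply: le_trans (ug n z z1) _; rewrite ler_wpM2l//.
  have z1' : normc z < 1 by [].
  apply: ge0_ler_powR; rewrite ?nnegrE ?invr_ge0 ?(ltW p0)//.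
  - by rewrite divr_ge0 ?mulr_ge0 ?(ltW A0)// subr_ge0 ltW.
  - by rewrite divr_ge0 ?mulr_ge0 ?(ltW A0)// subr_ge0 ltW.
  - rewrite ler_wpM2l ?mulr_ge0 ?(ltW A0)// lef_pV2 ?posrE ?subr_gt0//.
    by rewrite lerB.
have va : analytic_on_disk v by exact: (analytic_ulim UU ua ub hv).
have vg z : disk z -> normc (v z) <= g z.
  by move=> z1; apply: (ulim_le UU (hv z z1)) => n; exact: ug.
have gp z : disk z -> (g z) `^ p = 2 `^ p * (2 * A) / (1 - normc z).
  move=> z1; have z1' : normc z < 1 by [].
  rewrite /g powRM ?powR_ge0// -powRrM mulVf ?gt_eqF// powRr1 ?mulrA//.
  by rewrite divr_ge0 ?mulr_ge0 ?(ltW A0)// subr_ge0 ltW.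
have g0 z : 0 <= g z by rewrite mulr_ge0 ?powR_ge0.
(* The estimate must cover differences of two functions bounded by [g], hence [2 * g], and [g]
   already carries a factor 2. *)
pose K := 4 `^ p * (2 * A).
have K0 : 0 < K by rewrite /K mulr_gt0 ?powR_gt0 ?mulr_gt0.
have bound f z : disk z -> normc (f z) <= 2 * g z ->
    normc (f z) `^ p <= K / (1 - normc z).
  move=> z1 /(ge0_ler_powR (ltW p0)).
  rewrite !nnegrE normc_ge0 mulr_ge0// => /(_ isT isT) /le_trans; apply.
  have -> : K = 2 `^ p * (2 `^ p * (2 * A)).
    by rewrite /K [RHS]mulrA -powRM//; congr (_ `^ p * _); lra.
  by rewrite powRM// gp// mulrA.
have pd (r t : R) : 0 < r < 1 -> disk (phi (r%:C * expi t)).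
  by move=> /andP[r0 r1]; apply: phis.2; apply: disk_realM; rewrite r1 ltW.
have r01' (r : R) : 0 < r < 1 -> 0 <= r < 1 by move=> /andP[/ltW -> ->].
have vphi_a := analytic_comp phis va.
(* Where [|phi| <= 1 - eta] the bound [d] applies, elsewhere growth and [w] do. It is used twice:
   for the limit [v], with a large [d], to see that [v \o phi] belongs to the space, and for
   [u n - v], with a small [d]. *)
have tail_bound (e : R) (f : R[i] -> R[i]) (d eta : R) (w : R -> R) r :
    analytic_on_disk f -> (forall z, disk z -> normc (f z) <= 2 * g z) ->
    0 < r < 1 -> 0 <= d -> itg w -> imean w <= e ->
    (forall t, t \in `[0, 2 * pi] -> 0 <= w t /\
      (normc (phi (r%:C * expi t)) <= 1 - eta \/
       (1 - normc (phi (r%:C * expi t)))^-1 <= w t)) ->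
    (forall z, normc z <= 1 - eta -> disk z -> normc (f z) `^ p <= d) ->
    pmean p r (f \o phi) <= d + K * e.
  move=> fa fg r01 d0 wi we hw hd.
  have fpa := analytic_comp phis fa.
  apply: (@le_trans _ _ (imean (fun t => d + K * w t))).
    apply: pmean_le => //; [exact: r01'|exact: ltW|by apply: rintgD; [exact: rintg_cst|exact: rintgZ]|].
    move=> t tI; have [w0 [h|h]] := hw t tI.
      by apply: le_trans (hd _ h (pd _ _ r01)) _; rewrite lerDl mulr_ge0 ?(ltW K0).
    apply: le_trans (bound f _ (pd _ _ r01) (fg _ (pd _ _ r01))) _.
    rewrite -[leLHS]add0r; apply: lerD => //.
    by rewrite ler_wpM2l ?(ltW K0).
  rewrite (imeanD (rintg_cst _ _ d) (rintgZ K wi)) imean_cst (imeanZ K wi).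
  by rewrite lerD2l ler_wpM2l ?(ltW K0).
have vX : hardy p (v \o phi).
  apply/(hardyP _ p0); split => //.
  have [eta /andP[eta0 eta1] hw] := phi_tail ltr01.
  exists (K / eta + K * 1).
    by rewrite addr_ge0 ?divr_ge0 ?mulr_ge0 ?(ltW K0)// ltW.
  move=> r r01; have [w [wi we hw']] := hw r r01.
  apply: (tail_bound 1 v (K / eta) eta w r) => //.
  - by move=> z z1; apply: le_trans (vg _ z1) _; have := g0 z; lra.
  - by rewrite divr_ge0 ?(ltW K0)// ltW.
  - move=> z zeta z1; apply: le_trans (bound v z z1 _) _.
      by apply: le_trans (vg _ z1) _; have := g0 z; lra.
    rewrite ler_wpM2l ?(ltW K0)// lef_pV2 ?posrE ?subr_gt0//.
    by move: zeta; lra.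
pose D n : R[i] -> R[i] := (u n \o phi) \- (v \o phi).
have small (e : R) : 0 < e -> \forall n \near U, (hardy_norm p (D n) <= e%:E)%E.
  (* Half of the p-th power for the uniform convergence inside, half for the tail. *)
  move=> e0; pose e' := e `^ p / 2.
  have e'0 : 0 < e' by rewrite divr_gt0// powR_gt0.
  have [eta /andP[eta0 eta1] hw] := phi_tail (divr_gt0 e'0 K0).
  have eta01 : 0 <= 1 - eta < 1 by apply/andP; split; lra.
  have d0 : 0 < e' `^ p^-1 by rewrite powR_gt0.
  apply: filterS (ulim_unif UU ua ub hv eta01 d0) => n hn.
  have da : analytic_on_disk (fun z => u n z - v z).
    apply/analytic_holo => z z1.
    exact: (holoB ((analytic_holo _).1 (ua n) z z1) ((analytic_holo _).1 va z z1)).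
  apply/(hardy_norm_le p0 (ltW e0) (analytic_comp phis da)) => r r01.
  have [w [wi we hw']] := hw r r01.
  have -> : e `^ p = e' + K * (e' / K).
    by rewrite mulrC divfK ?gt_eqF// /e' -splitr.
  apply: (tail_bound (e' / K) (fun z => u n z - v z) e' eta w r) => //.
  - move=> z z1; apply: le_trans (normcB _ _) _.
    by have := ug n z z1; have := vg z z1; lra.
  - exact: ltW.
  - move=> z zeta z1.
    have := hn z zeta => /(ge0_ler_powR (ltW p0)).
    rewrite !nnegrE normc_ge0 (ltW d0) => /(_ isT isT) /le_trans; apply.
    by rewrite -powRrM mulVf ?gt_eqF// powRr1 ?(ltW e'0).
have [s [s1 s2]] : exists s : nat -> nat, {homo s : m n / (m < n)%N} /\
    hardy_norm p (D (s n)) @[n --> \oo] --> 0%E.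
  apply: (@extract_subseq (fun n => hardy_norm p (D n))).
    by move=> n; exact: hardy_norm_ge0.
  move=> e m e0; have h1 := small e e0.
  (* [U] refines the filter at infinity, so every set of [U] contains arbitrarily large indices;
     ordinary subsequences can be extracted from it. *)
  have h2 : \forall n \near U, (m < n)%N by apply: Uoo; exists m.+1.
  by have [n [n1 n2]] := filter_ex (filterI h2 h1); exists n.
by exists s, (v \o phi); split.
Qed.

End CompactHardy.

(** * The lacunary symbol *)

Section LacunarySymbol.
Variable R : realType.
Implicit Types (z w : R[i]) (t : R).

(** The product of consecutive integers makes the reciprocals telescope in the tail estimate; 16 is
    the sum of [(j + 1) (j + 2) / 2 ^ j]. *)
Definition lacw (j : nat) : R := j.+1%:R * j.+2%:R / (16 * 2 ^+ j).
(** Closed form of the sum of the weights from [J] on: the quadratic solution of the recursion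
    [lactailS], with value 1 at [J = 0]. Tails are thus handled without infinite sums. *)
Definition lactail (J : nat) : R := (J%:R ^+ 2 + 5 * J%:R + 8) / (8 * 2 ^+ J).
Definition lacsum (J : nat) z : R[i] := \sum_(j < J) (lacw j)%:C * z ^+ (2 ^ j).

Lemma lacw_gt0 j : 0 < lacw j.
Proof. by rewrite /lacw divr_gt0 ?mulr_gt0 ?exprn_gt0 ?ltr0n. Qed.

Lemma lactail_ge0 J : 0 <= lactail J.
Proof.
by apply: divr_ge0; rewrite ?addr_ge0 ?mulr_ge0 ?sqr_ge0 ?ler0n ?exprn_ge0.
Qed.

Lemma lactailS J : lactail J = lacw J + lactail J.+1.
Proof.
rewrite /lactail /lacw (exprS 2 J) -[J.+2%:R]natr1 -[J.+1%:R]natr1.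
have : (2 : R) ^+ J != 0 by rewrite expf_neq0// pnatr_eq0.
move: (2 ^+ J) => x x0; field.
by rewrite x0.
Qed.

Lemma sum_lacw J : \sum_(j < J) lacw j = 1 - lactail J.
Proof.
elim: J => [|J ih].
  by rewrite big_ord0 /lactail expr0n mulr0 !add0r mulr1 divff ?subrr// pnatr_eq0.
by rewrite big_ord_recr /= ih (lactailS J); ring.
Qed.

Lemma lactail_small J : lactail J <= 8 / J.+1%:R.
Proof.
have h : (J.+1 * (J ^ 2 + 5 * J + 8) <= 64 * 2 ^ J)%N.
  case: J => [//|[//|J]]; elim: J => [//|J ih].
  by rewrite (expnS 2 J.+2); move: ih; move: (2 ^ J.+2)%N => y; nia.
rewrite /lactail ler_pdivrMr ?mulr_gt0 ?exprn_gt0//.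
rewrite mulrAC ler_pdivlMr ?ltr0n//.
have := h; rewrite -(@ler_nat R) !(natrM, natrD, natrX).
by rewrite mulrC => /le_trans; apply; rewrite mulrA -natrM.
Qed.

Lemma lacsum_Re J z : complex.Re (lacsum J z) =
  \sum_(j < J) lacw j * complex.Re (z ^+ (2 ^ j)).
Proof.
by rewrite /lacsum; elim/big_rec2: _ => [//|j x y _ <-]; rewrite ReD ReZ.
Qed.

Let powc_le1 z n : normc z <= 1 -> normc (z ^+ n) <= 1.
Proof. by move=> z1; rewrite normcX exprn_ile1 ?normc_ge0. Qed.

Lemma lacsum_diff m n z : normc z <= 1 -> (m <= n)%N ->
  normc (lacsum n z - lacsum m z) <= lactail m - lactail n.
Proof.
move=> z1; elim: n => [|n ih].
  by rewrite leqn0 => /eqP ->; rewrite !subrr normc0.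
rewrite leq_eqVlt => /predU1P[->|]; first by rewrite !subrr normc0.
rewrite ltnS => /ih h; rewrite /lacsum big_ord_recr /= -/(lacsum n z) addrAC.
apply: le_trans (normcD _ _) _; apply: le_trans (lerD h _) (_ : _ + lacw n <= _).
  rewrite normc_realM gtr0_norm ?lacw_gt0// -[leRHS]mulr1.
  by rewrite ler_wpM2l ?powc_le1// ltW ?lacw_gt0.
by rewrite (lactailS n); lra.
Qed.

Lemma lacsum_le1 J z : normc z <= 1 -> normc (lacsum J z) <= 1.
Proof.
move=> z1; have := lacsum_diff z1 (leq0n J).
rewrite {2}/lacsum big_ord0 subr0 => /le_trans; apply.
have := sum_lacw 0; rewrite big_ord0; have := lactail_ge0 J; lra.
Qed.

Lemma holo_lacsum J z : holo (lacsum J) z.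
Proof.
apply: holo_sum => j; apply: holoM; first exact: holo_cst.
by apply: holoX; exact: holo_id.
Qed.

(** The limit is taken on the closed disk, so that the series has values on the circle as well, with
    the same tail bound there. *)
Lemma lacunary_limit : exists W : R[i] -> R[i], analytic_on_disk W /\
  forall z J, normc z <= 1 -> normc (W z - lacsum J z) <= lactail J.
Proof.
have [U [UU Uoo]] := ultraFilterLemma (_ : ProperFilter \oo).
have /choice[W hW] : forall z, exists l, normc z <= 1 -> ulim U (lacsum^~ z) l.
  move=> z; have [z1|z1] := leP (normc z) 1; last by exists 0.
  have [l hl] := ultra_lim UU (fun J => lacsum_le1 J z1).
  by exists l.
exists W; split.
  apply: (@analytic_ulim _ _ U UU lacsum).
  - by move=> J; apply/analytic_holo => z _; exact: holo_lacsum.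
  - by move=> r /andP[r0 r1]; exists 1 => J z zr; apply: lacsum_le1; lra.
  - by move=> z z1; apply: hW; exact: ltW.
move=> z J z1; apply/ler_addgt0Pr => e e0.
have h1 := hW z z1 e e0.
have h2 : \forall n \near U, (J <= n)%N by apply: Uoo; exists J.
have [n [n1 n2]] := filter_ex (filterI h1 h2).
have h3 := lacsum_diff z1 n2.
have := normc_tri (W z) (lacsum n z) (lacsum J z).
rewrite (normc_sub (W z) (lacsum n z)); have := lactail_ge0 n.
by move: n1 h3; lra.
Qed.

Definition lacseries : R[i] -> R[i] := sval (cid lacunary_limit).
Definition symbol z : R[i] := (2^-1)%:C * (1 + lacseries z).

Let lacseries_approx z J : normc z <= 1 ->
  normc (lacseries z - lacsum J z) <= lactail J.
Proof. exact: (svalP (cid lacunary_limit)).2. Qed.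

Let lacseries_le1 z : normc z <= 1 -> normc (lacseries z) <= 1.
Proof.
move=> /(lacseries_approx 0); rewrite /lacsum big_ord0 subr0 => /le_trans; apply.
by have := sum_lacw 0; rewrite big_ord0; lra.
Qed.

(** Every term other than the one of index [j] is estimated by its weight, and the weights add up to
    1. *)
Let lacseries_Re z j : normc z <= 1 ->
  complex.Re (lacseries z) <= 1 - lacw j * (1 - complex.Re (z ^+ (2 ^ j))).
Proof.
move=> z1.
have h : complex.Re (lacsum j.+1 z) <=
    1 - lactail j.+1 - lacw j * (1 - complex.Re (z ^+ (2 ^ j))).
  rewrite lacsum_Re -sum_lacw !big_ord_recr /= -addrA.
  apply: lerD; last by lra.
  apply: ler_sum => i _; rewrite -[leRHS]mulr1 ler_wpM2l ?(ltW (lacw_gt0 _))//.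
  by apply: le_trans (Re_le_normc _) _; exact: powc_le1.
have := le_trans (Re_le_normc _) (lacseries_approx j.+1 z1).
by rewrite ReD ReN; move: h; lra.
Qed.

(** Averaging with 1 turns a deficit of the real part into a deficit of the modulus: as [|W| <= 1],
    the square of [|1 + W| / 2] is at most [(1 + Re W) / 2]. *)
Lemma symbol_gap z j : normc z <= 1 ->
  lacw j / 4 * (1 - complex.Re (z ^+ (2 ^ j))) <= 1 - normc (symbol z).
Proof.
move=> z1; have h1 := lacseries_Re j z1; have h2 := lacseries_le1 z1.
set W := lacseries z in h1 h2; set x := normc (symbol z).
have x0 : 0 <= x by exact: normc_ge0.
have W2 : normc W ^+ 2 <= 1 by rewrite expr_le1 ?normc_ge0.
have x2 : x ^+ 2 = (1 + 2 * complex.Re W + normc W ^+ 2) / 4.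
  rewrite /x normc_sqr /symbol -/W ReZ ImZ ReD ImD normc_sqr /=.
  by field.
have : x ^+ 2 <= (1 + complex.Re W) / 2 by rewrite x2; lra.
have : 1 - x ^+ 2 <= 2 * (1 - x) by rewrite -subr_ge0; have := sqr_ge0 (1 - x); nra.
lra.
Qed.

Lemma symbol_le1 z : normc z <= 1 -> normc (symbol z) <= 1.
Proof.
move=> z1; have := symbol_gap 0 z1; rewrite expn0 expr1.
have : complex.Re z <= 1 by exact: le_trans (Re_le_normc _) z1.
have := lacw_gt0 0; nra.
Qed.

Lemma symbol_self_map : self_map symbol.
Proof.
have [Wa _] := svalP (cid lacunary_limit).
split.
  apply/analytic_holo => z z1; apply: holoM; first exact: holo_cst.
  apply: holoD; first exact: holo_cst.
  exact: (analytic_holo _).1 Wa z z1.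
move=> z z1; have z1' : normc z < 1 by [].
have := symbol_gap 0 (ltW z1'); rewrite expn0 expr1.
have : complex.Re z < 1 by exact: le_lt_trans (Re_le_normc _) z1'.
change (complex.Re z < 1 ->
  lacw 0 / 4 * (1 - complex.Re z) <= 1 - normc (symbol z) -> normc (symbol z) < 1).
have := lacw_gt0 0; nra.
Qed.

Lemma symbol_cont z (e : R) : normc z <= 1 -> 0 < e -> exists2 d : R, 0 < d &
  forall w, normc w <= 1 -> normc (w - z) < d -> normc (symbol w - symbol z) < e.
Proof.
move=> z1 e0.
pose J := (Num.truncn (8 * 4 / e)).+1.
have TJ : lactail J < e / 4.
  apply: le_lt_trans (lactail_small _) _.
  rewrite ltr_pdivrMr ?ltr0n// -ltr_pdivrMl ?divr_gt0// invf_div mulrC.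
  have h : 8 * 4 / e < J%:R by exact: truncnS_gt.
  rewrite mulrA; apply: lt_trans h _; by rewrite ltr_nat.
have e20 : 0 < e / 2 by rewrite divr_gt0.
have [d d0 hd] := holo_ccont (holo_lacsum J z) e20.
exists d => // w w1 wz; rewrite /symbol -mulrBr normc_realM ger0_norm; last by rewrite invr_ge0.
have h1 := lacseries_approx J z1; have h2 := lacseries_approx J w1.
have h3 := hd w wz.
have -> : 1 + lacseries w - (1 + lacseries z) =
  (lacseries w - lacsum J w) + (lacsum J w - lacsum J z) - (lacseries z - lacsum J z) by ring.
have := normcB ((lacseries w - lacsum J w) + (lacsum J w - lacsum J z)) (lacseries z - lacsum J z).
have := normcD (lacseries w - lacsum J w) (lacsum J w - lacsum J z).
move: h1 h2 h3 TJ; lra.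
Qed.

(** The term of index [j < J] is Lipschitz in [t] with constant [lacw j * 2 ^ j], and these
    constants sum to [J (J + 1) (J + 2) / 48]; the remaining terms cost twice their weights. *)
Lemma symbol_near1 t J : normc (1 - symbol (expi t)) <=
  2^-1 * (`|t| * (J%:R * J.+1%:R * J.+2%:R / 48) + 2 * lactail J).
Proof.
have x1 : normc (expi t) <= 1 by rewrite normc_expi.
have -> : 1 - symbol (expi t) = (2^-1)%:C * (1 - lacseries (expi t)).
  rewrite /symbol; apply: complexP; rewrite !(ReD, ReN, ReZ, ImD, ImN, ImZ) /=; lra.
rewrite normc_realM ger0_norm ?invr_ge0// ler_wpM2l ?invr_ge0//.
have h1 := lacseries_approx J x1.
have h2 : normc ((1 - lactail J)%:C - lacsum J (expi t)) <=
    `|t| * (J%:R * J.+1%:R * J.+2%:R / 48).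
  have -> : (1 - lactail J)%:C - lacsum J (expi t) =
      \sum_(j < J) (lacw j)%:C * (1 - expi (2 ^+ j * t)).
    rewrite -sum_lacw rmorph_sum /lacsum -sumrB; apply: eq_bigr => j _.
    by rewrite expiX natrX mulrBr mulr1.
  elim: (J) => [|K ih]; first by rewrite big_ord0 normc0 !mul0r mulr0.
  rewrite big_ord_recr /=; apply: le_trans (normcD _ _) _.
  apply: le_trans (lerD ih (_ : _ <= `|t| * (K.+1%:R * K.+2%:R / 16))) _.
    rewrite normc_realM gtr0_norm ?lacw_gt0// -expi0.
    have := expi_lip (2 ^+ K * t) 0; rewrite sub0r normrN normrM gtr0_norm ?exprn_gt0// => h.
    apply: le_trans (ler_wpM2l (ltW (lacw_gt0 K)) h) _.
    have k0 : (2 : R) ^+ K != 0 by rewrite expf_neq0// pnatr_eq0.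
    rewrite /lacw le_eqVlt; apply/orP; left; apply/eqP; move: (2 ^+ K) k0 => y y0.
    by field; rewrite y0.
  rewrite -mulrDr ler_wpM2l// -[K.+3%:R]natr1 -[K.+2%:R]natr1 -[K.+1%:R]natr1 le_eqVlt; apply/orP; left; apply/eqP; by field.
have -> : 1 - lacseries (expi t) = (lactail J)%:C +
   ((1 - lactail J)%:C - lacsum J (expi t)) - (lacseries (expi t) - lacsum J (expi t)).
  by rewrite rmorphB rmorph1; ring.
have := normcB ((lactail J)%:C + ((1 - lactail J)%:C - lacsum J (expi t)))
   (lacseries (expi t) - lacsum J (expi t)).
have := normcD (lactail J)%:C ((1 - lactail J)%:C - lacsum J (expi t)).
rewrite normc_real ger0_norm ?lactail_ge0//; move: h1 h2; lra.
Qed.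

(** Cutting at [J = 3 * k] leaves a tail of order [k^2 * 8 ^- k], well below [2 ^- k], while the
    Lipschitz constant is of order [k^3]. That constant is the cube of the logarithm lost in the
    length of the arc. *)
Lemma symbol_contact (k : nat) t : (2 <= k)%N ->
  0 <= t <= 2 ^- k / (2 * k%:R ^+ 3) -> normc (1 - symbol (expi t)) <= 2 ^- k.
Proof.
move=> k2 /andP[t0 tk]; apply: le_trans (symbol_near1 t (3 * k)) _.
have k0 : 0 < k%:R :> R by rewrite ltr0n; apply: leq_trans k2.
have k1 : 1 <= k%:R :> R by rewrite ler1n; apply: leq_trans k2.
have P0 : 0 < (2 : R) ^- k by rewrite invr_gt0 exprn_gt0.
have h1 : `|t| * ((3 * k)%:R * (3 * k).+1%:R * (3 * k).+2%:R / 48) <= 5 / 8 * 2 ^- k.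
  have e3 : (3 * k)%:R * (3 * k).+1%:R * (3 * k).+2%:R / 48 <= 60 * k%:R ^+ 3 / 48 :> R.
    rewrite ler_pM2r ?invr_gt0// -[(3 * k).+2%:R]natr1 -[(3 * k).+1%:R]natr1 natrM; move: k%:R k1 => x x1.
    by have := sqr_ge0 x; nra.
  rewrite ger0_norm//.
  have c0 : 0 <= 60 * k%:R ^+ 3 / 48 :> R by rewrite divr_ge0// mulr_ge0// exprn_ge0// ltW.
  apply: le_trans (ler_pM t0 _ tk e3) _; first by rewrite divr_ge0// !mulr_ge0.
  have x0 : k%:R != 0 :> R by rewrite gt_eqF.
  rewrite le_eqVlt; apply/orP; left; apply/eqP; move: (2 ^- k) (k%:R) x0 => y x x0.
  by field.
have h2 : lactail (3 * k) <= 5 / 8 * 2 ^- k.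
  have h : (9 * k ^ 2 + 15 * k + 8 <= 5 * 4 ^ k)%N.
    move: k2; clear; case: k => [//|[//|k]] _; elim: k => [//|k ih].
    by rewrite (expnS 4 k.+2); move: ih; move: (4 ^ k.+2)%N => y; nia.
  have h' : 9 * k%:R ^+ 2 + 15 * k%:R + 8 <= 5 * 4 ^+ k :> R.
    by have := h; rewrite -(@ler_nat R) !(natrM, natrD, natrX).
  rewrite /lactail exprM natrM.
  have e8 : (2 ^+ 3) ^+ k = 2 ^+ k * 4 ^+ k :> R.
    by rewrite -exprMn; congr (_ ^+ _); lra.
  have y0 : 0 < (2 : R) ^+ k by rewrite exprn_gt0.
  have u0 : 0 < (4 : R) ^+ k by rewrite exprn_gt0.
  rewrite e8 ler_pdivrMr ?mulr_gt0//.
  move: (2 ^+ k) (4 ^+ k) y0 u0 h' => y u y0 u0 h'.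
  have -> : 5 / 8 * y^-1 * (8 * (y * u)) = 5 * u by field; rewrite gt_eqF.
  by apply: le_trans h'; rewrite exprMn; lra.
by move: h1 h2; lra.
Qed.

End LacunarySymbol.

(** * Vanishing tails of the symbol *)

Section SymbolTail.
Variable R : realType.
Implicit Types (t x r a e : R).

Lemma itg_sum (F : nat -> R -> R) n : (forall j, itg (F j)) ->
  itg (fun t => \sum_(j < n) F j t) /\
  imean (fun t => \sum_(j < n) F j t) = \sum_(j < n) imean (F j).
Proof.
move=> hF; elim: n => [|n [ih1 ih2]].
  have -> : (fun t => \sum_(j < 0) F j t) = fun=> 0 :> R.
    by apply/funext => t; rewrite big_ord0.
  by split; [exact: rintg_cst|rewrite imean_cst big_ord0].
have -> : (fun t => \sum_(j < n.+1) F j t) = (fun t => \sum_(j < n) F j t + F n t).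
  by apply/funext => t; rewrite big_ord_recr.
by split; [exact: (rintgD ih1 (hF n))|rewrite (imeanD ih1 (hF n)) ih2 big_ord_recr].
Qed.

Lemma imean_indic_itv a b : a <= b ->
  itg (\1_(`[a, b]%classic : set R)) /\ imean (\1_(`[a, b]%classic : set R)) <= b - a.
Proof.
move=> ab; set A := (`[a, b]%classic : set R).
pose D : set R := `[0, 2 * pi]%classic.
have mA : measurable A by exact: measurable_itv.
have i1 : itg (\1_A).
  apply: (@itg_bounded _ _ 1); first exact: measurable_indic.
  by move=> t _; rewrite indicE; case: (_ \in _); rewrite ?normr1 ?normr0.
split => //; rewrite /imean /rint /Rintegral integral_indic// -/D.
have le1 : (2 * pi)^-1 <= 1 :> R.
  by rewrite invf_le1 ?twopi_gt0//; have := pi_ge2 R; lra.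
have mle : (lebesgue_measure (A `&` D) <= (b - a)%:E)%E.
  apply: (@le_trans _ _ (lebesgue_measure A)).
    by apply: le_measure; rewrite ?inE//; apply: measurableI => //; exact: measurable_itv.
  rewrite lebesgue_measure_itv/= lte_fin; case: ifP => _; first by rewrite -EFinB.
  by rewrite lee_fin subr_ge0.
have mf : lebesgue_measure (A `&` D) \is a fin_num.
  by rewrite ge0_fin_numE//; apply: le_lt_trans mle _; exact: ltry.
have h1 : fine (lebesgue_measure (A `&` D)) <= b - a by rewrite -lee_fin fineK.
have h0 : 0 <= fine (lebesgue_measure (A `&` D)) by exact: fine_ge0.
apply: le_trans h1; rewrite -[leRHS]mul1r; exact: ler_wpM2r h0 _ _ le1.
Qed.

(** The arc of half-width [a] around 1, which the parametrization cuts into two end pieces of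
    [[0, 2 pi]]. *)
Definition endind a t : R :=
  \1_(`[0, a]%classic : set R) t + \1_(`[2 * pi - a, 2 * pi]%classic : set R) t.

Lemma endind_mean a : 0 <= a -> itg (endind a) /\ imean (endind a) <= 2 * a.
Proof.
move=> a0; have [i1 m1] := imean_indic_itv a0.
have h : 2 * pi - a <= 2 * pi by rewrite lerBlDr lerDl.
have [i2 m2] := imean_indic_itv h.
split; first exact: (rintgD i1 i2).
by rewrite /endind imeanD//; move: m1 m2; rewrite subr0 subKr; lra.
Qed.

Lemma endind_ge0 a t : 0 <= endind a t.
Proof. by rewrite addr_ge0// indicE ler0n. Qed.

Lemma endind_ge1 a t : t \in `[0, 2 * pi] -> Num.min t (2 * pi - t) <= a ->
  1 <= endind a t.
Proof.
rewrite in_itv/= => /andP[t0 t1]; rewrite ge_min => /orP[ta|ta].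
  rewrite /endind [X in X + _]indicE mem_set; last by rewrite /= in_itv/= t0.
  by rewrite lerDl indicE ler0n.
rewrite /endind [X in _ + X]indicE mem_set; last by rewrite /= in_itv/= t1 andbT; lra.
by rewrite lerDr indicE ler0n.
Qed.

(** The factor in [symbol_gap] when the angle at scale [j] is one radian away from 0. *)
Let c1 : R := (1 - cos 1) / 4.

Let cos1lt : cos 1 < 1 :> R.
Proof.
have p2 := pi_ge2 R.
rewrite -[ltRHS]cos0 ltr_cos ?in_itv/= ?ler01 ?lexx ?pi_ge0//=; lra.
Qed.

Let c10 : 0 < c1. Proof. by rewrite /c1; move: cos1lt; lra. Qed.
Let c11 : c1 < 1. Proof. by rewrite /c1; have := cos1_gt0 R; lra. Qed.

Let cos_sym (n : nat) t : cos (2 ^+ n * Num.min t (2 * pi - t)) = cos (2 ^+ n * t).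
Proof.
rewrite minElt; case: ifP => // _.
have e k : expi (k%:R * (2 * pi)) = 1 :> R[i] by rewrite -expiX expi_2pi expr1n.
have := congr1 (fun z => complex.Re z) (expiD ((2 ^ n)%:R * (2 * pi)) (- (2 ^+ n * t))).
by rewrite e mul1r natrX -mulrBr /= cosN.
Qed.

Let gap t r j : 0 < r < 1 -> cos (2 ^+ j * Num.min t (2 * pi - t)) <= cos 1 ->
  c1 * lacw R j <= 1 - normc (symbol (r%:C * expi t)).
Proof.
move=> /andP[r0 r1]; rewrite cos_sym => hc.
have z1 : normc (r%:C * expi t) <= 1.
  by rewrite normc_realM normc_expi mulr1 ger0_norm ltW.
apply: le_trans (symbol_gap j z1); rewrite exprMn expiX natrX.
have -> : complex.Re (r%:C ^+ (2 ^ j) * expi (2 ^+ j * t)) = r ^+ (2 ^ j) * cos (2 ^+ j * t).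
  by rewrite -rmorphXn ReZ.
have rn0 : 0 <= r ^+ (2 ^ j) by rewrite exprn_ge0// ltW.
have rn1 : r ^+ (2 ^ j) <= 1 by rewrite exprn_ile1// ltW.
have w0 := lacw_gt0 R j; have C := cos1_gt0 R.
have h : r ^+ (2 ^ j) * cos (2 ^+ j * t) <= cos 1 by nra.
have -> : c1 * lacw R j = lacw R j / 4 * (1 - cos 1) by rewrite /c1; field.
by rewrite ler_wpM2l ?lerB// divr_ge0// ltW.
Qed.

(** Double [x] until it first reaches 1: the angle then lies in [[1, 2]], within [[1, pi]], unless
    no doubling was made. The bound by 2 confines [x] to the arc of half-width [2 / 2 ^ j]. *)
Let find_scale x (J : nat) : 0 < x <= pi -> 1 <= 2 ^+ J * x ->
  exists j, [/\ (j <= J)%N, cos (2 ^+ j * x) <= cos 1 & j = 0%N \/ 2 ^+ j * x <= 2].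
Proof.
move=> /andP[x0 xpi]; have p2 := pi_ge2 R.
have cle y : 1 <= y <= pi -> cos y <= cos 1.
  move=> /andP[y1 y2]; have [->//|ne] := eqVneq y 1.
  apply: ltW; rewrite ltr_cos ?in_itv/=; [|by apply/andP; split; lra..].
  by rewrite lt_neqAle eq_sym ne.
elim: J => [|J ih] h.
  exists 0%N; split => //; last by left.
  by apply: cle; move: h; rewrite expr0 mul1r => ->.
have [/ih[j [j1 j2 j3]]|lt1] := leP 1 (2 ^+ J * x).
  by exists j; split => //; exact: leqW.
have e : 2 ^+ J.+1 * x = 2 * (2 ^+ J * x) by rewrite exprS mulrA.
exists J.+1; split => //; [apply: cle; rewrite h /=|right]; rewrite e; lra.
Qed.

Let tele (J n : nat) : \sum_(j < n) (if (J < j)%N then (j.+1%:R * j.+2%:R)^-1 else 0 : R) <=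
  J.+2%:R^-1 - (if (J < n)%N then n.+1%:R^-1 else J.+2%:R^-1).
Proof.
elim: n => [|n ih]; first by rewrite big_ord0 ltn0 subrr.
rewrite big_ord_recr /=; apply: le_trans (lerD ih (lexx _)) _.
have [Jn|nJ] := ltnP J n.
  rewrite ltnS (ltnW Jn) -[n.+2%:R]natr1.
  have n0 : 0 < n.+1%:R :> R by rewrite ltr0n.
  move: (n.+1%:R) n0 (J.+2%:R^-1) => y y0 q.
  have n1 : 0 < y + 1 by lra.
  rewrite le_eqVlt; apply/orP; left; apply/eqP.
  by field; rewrite (gt_eqF y0) (gt_eqF n1).
rewrite addr0 subrr; case: ifP => Jn; last by rewrite subrr.
have -> : n = J by apply/eqP; rewrite eqn_leq nJ -ltnS Jn.
by rewrite subrr.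
Qed.

Lemma symbol_tail e : 0 < e -> exists2 eta : R, 0 < eta < 1 &
  forall r, 0 < r < 1 -> exists w : R -> R, [/\ itg w, imean w <= e &
    forall t, t \in `[0, 2 * pi] -> 0 <= w t /\
      (normc (symbol (r%:C * expi t)) <= 1 - eta \/
       (1 - normc (symbol (r%:C * expi t)))^-1 <= w t)].
Proof.
move=> e0.
(* The shell of index [j] contributes at most [2 * (2 / 2 ^ j)] divided by [c1 * lacw j], that is
   [64 / c1] over [(j + 1) (j + 2)]. Beyond [J] this telescopes to at most [64 / c1 / (J + 2)], half
   of the budget. *)
pose J := (Num.truncn (64 / c1 * 2 / e)).+1.
have hJ : 64 / c1 * J.+2%:R^-1 <= e / 2.
  have h : 64 / c1 * 2 / e < J%:R by exact: truncnS_gt.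
  have h2 : J%:R <= J.+2%:R :> R by rewrite ler_nat (leq_trans (leqnSn _) (leqnSn _)).
  rewrite ler_pdivrMr ?ltr0n//.
  rewrite ltr_pdivrMr// in h; have h3 := ler_wpM2r (ltW e0) h2.
  by move: (64 / c1) h h3 => q; lra.
have P2 n : 0 < (2 : R) ^+ n by rewrite exprn_gt0.
(* A lower bound for the gap at every scale up to [J], from [(j + 1) (j + 2) >= 2]: points of the
   outer shells fall under the first alternative. *)
pose eta := c1 / (8 * 2 ^+ J).
have eta0 : 0 < eta by rewrite divr_gt0// mulr_gt0.
have eta1 : eta < 1.
  rewrite ltr_pdivrMr ?mulr_gt0// mul1r; apply: lt_trans c11 _.
  have : 1 <= (2 : R) ^+ J by rewrite exprn_ege1// ler1n.
  lra.
have lacw_lo j : (j <= J)%N -> eta <= c1 * lacw R j.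
  move=> jJ; rewrite /eta ler_wpM2l ?(ltW c10)// /lacw.
  apply: (@le_trans _ _ (2 / (16 * 2 ^+ j))).
    rewrite -[(8 * _)^-1]mul1r ler_pdivrMr ?mulr_gt0// mulrAC ler_pdivlMr ?mulr_gt0//.
    have : (2 : R) ^+ j <= 2 ^+ J by rewrite ler_eXn2l// ltr1n.
    lra.
  rewrite ler_pM2r ?invr_gt0 ?mulr_gt0// -natrM ler_nat.
  by rewrite mulSn; lia.
exists eta; first by rewrite eta0.
move=> r r01; have /andP[r0 r1] := r01.
(* The gap of index 0, with [lacw 0 / 4 = 1 / 32], bounds [1 / (1 - |symbol|)] by [B] on the whole
   circle of radius [r]. It serves on the innermost arc, whose size [2 ^- N] is chosen after [r]. *)
pose B := 32 / (1 - r).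
have B0 : 0 < B by rewrite divr_gt0// subr_gt0.
pose N := (Num.truncn (2 * B * 2 / e)).+1.
have hN : B * (2 * 2 ^- N) <= e / 2.
  have h : 2 * B * 2 / e < N%:R by exact: truncnS_gt.
  have h2 : N%:R <= 2 ^+ N :> R by rewrite -natrX ler_nat ltnW// ltn_expl.
  rewrite mulrA ler_pdivrMr//.
  rewrite ltr_pdivrMr// in h; have := ler_wpM2r (ltW e0) h2.
  by move: h; lra.
pose cj (j : nat) : R := if (J < j)%N then (c1 * lacw R j)^-1 else 0.
have cj0 j : 0 <= cj j.
  by rewrite /cj; case: ifP => // _; rewrite invr_ge0 mulr_ge0 ?(ltW c10) ?(ltW (lacw_gt0 _ _)).
pose F j t := cj j * endind (2 / 2 ^+ j) t.
have d0 j : 0 <= 2 / (2 : R) ^+ j by rewrite divr_ge0// ltW.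
have Fi j : itg (F j) by apply: rintgZ; exact: (endind_mean (d0 j)).1.
have [S1 S2] := itg_sum N.+1 Fi.
have N0 : 0 <= (2 : R) ^- N by rewrite invr_ge0 ltW.
have [E1 E2] := endind_mean N0.
exists (fun t => \sum_(j < N.+1) F j t + B * endind (2 ^- N) t).
have F0 j t : 0 <= F j t by rewrite mulr_ge0// endind_ge0.
split.
- exact: (rintgD S1 (rintgZ B E1)).
- rewrite (imeanD S1 (rintgZ B E1)) (imeanZ B E1) S2 (splitr e).
  apply: lerD; last first.
    by apply: le_trans hN; rewrite ler_wpM2l// ltW.
  apply: le_trans hJ; apply: (@le_trans _ _ (\sum_(j < N.+1)
    (64 / c1) * (if (J < j)%N then (j.+1%:R * j.+2%:R)^-1 else 0 : R))).
    apply: ler_sum => j _; rewrite /F imeanZ; last exact: (endind_mean (d0 j)).1.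
    apply: le_trans (ler_wpM2l (cj0 j) (endind_mean (d0 j)).2) _.
    rewrite /cj; case: ifP => _; last by rewrite mul0r mulr0.
    have k0 := P2 j; have n1 : j.+1%:R != 0 :> R by rewrite pnatr_eq0.
    have n2 : j.+2%:R != 0 :> R by rewrite pnatr_eq0.
    have cc : c1 != 0 by rewrite gt_eqF.
    rewrite /lacw le_eqVlt; apply/orP; left; apply/eqP.
    move: (2 ^+ j) (j.+1%:R) (j.+2%:R) k0 n1 n2 => y n m k0 n1 n2.
    by field; rewrite cc n1 n2 gt_eqF.
  rewrite -mulr_sumr ler_wpM2l ?divr_ge0 ?(ltW c10)//.
  apply: le_trans (tele J N.+1) _; rewrite gerBl.
  by case: ifP => _; rewrite invr_ge0 ler0n.
- move=> t tI; have S0 : 0 <= \sum_(j < N.+1) F j t by apply: sumr_ge0 => j _.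
  have B1 : 0 <= B * endind (2 ^- N) t by rewrite mulr_ge0 ?endind_ge0// ltW.
  split; first exact: addr_ge0.
  pose x := Num.min t (2 * pi - t).
  have /andP[t0 t1] : 0 <= t <= 2 * pi by move: tI; rewrite in_itv.
  have z1 : normc (r%:C * expi t) <= 1.
    by rewrite normc_realM normc_expi mulr1 ger0_norm ltW.
  have [hx|hx] := leP 1 (2 ^+ N * x); last first.
    right; apply: (@le_trans _ _ B).
      have g0 := symbol_gap 0 z1.
      have cl : 1 - r <= 1 - complex.Re ((r%:C * expi t) ^+ (2 ^ 0)).
        rewrite expn0 expr1 ReZ; apply: lerB => //.
        by rewrite -[leRHS]mulr1; apply: ler_wpM2l; [exact: ltW|exact: cos_le1].
      have lb : (1 - r) / 32 <= 1 - normc (symbol (r%:C * expi t)).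
        apply: le_trans g0; rewrite /lacw expr0; move: cl; lra.
      rewrite /B -[32 / _]invrK invf_div lef_pV2// posrE.
        by apply: lt_le_trans lb; rewrite divr_gt0// subr_gt0.
      by rewrite divr_gt0// subr_gt0.
    rewrite -[leLHS]add0r; apply: lerD => //; rewrite -[leLHS]mulr1 ler_wpM2l ?(ltW B0)//.
    apply: endind_ge1 => //; rewrite -/x -[leRHS]mul1r ler_pdivlMr// mulrC; exact: ltW.
  have x0 : 0 < x.
    have : 0 < 2 ^+ N * x by exact: lt_le_trans hx.
    by rewrite pmulr_rgt0.
  have xpi : x <= pi.
    by rewrite /x ge_min; have [] := leP t pi => //= ?; lra.
  have [j [jN cjl jx]] : exists j, [/\ (j <= N)%N, cos (2 ^+ j * x) <= cos 1 & j = 0%N \/ 2 ^+ j * x <= 2].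
    by apply: find_scale => //; rewrite x0.
  have g := gap r01 cjl.
  have [jJ|Jj] := leqP j J.
    by left; have := le_trans (lacw_lo _ jJ) g; lra.
  right; have jx2 : 2 ^+ j * x <= 2 by case: jx => // j0; rewrite j0 in Jj.
  apply: (@le_trans _ _ (cj j)).
    have cl0 : 0 < c1 * lacw R j by rewrite mulr_gt0// lacw_gt0.
    by rewrite /cj Jj lef_pV2// posrE// (lt_le_trans cl0).
  rewrite -[leLHS]addr0; apply: lerD => //.
  have jN' : (j < N.+1)%N by [].
  rewrite (bigD1 (Ordinal jN'))//= -[leLHS]addr0; apply: lerD; last by apply: sumr_ge0.
  rewrite /F -[leLHS]mulr1 ler_wpM2l//; apply: endind_ge1 => //.
  by rewrite -/x ler_pdivlMr// mulrC.
Qed.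

Theorem compact_hardy_symbol (p : R) : 1 <= p ->
  compact_composition (hardy p) (hardy_norm p) (@symbol R).
Proof.
move=> p1; exact: (compact_hardy p1 (symbol_self_map R) symbol_tail).
Qed.

End SymbolTail.

(** * Self-adjointness of the Poisson operator *)

Section PoissonSwap.
Variable R : realType.
Notation mu := (@lebesgue_measure R).
Implicit Types (A B : R -> R) (s t r : R).

Definition circ : set R := `[0, 2 * pi]%classic.

Lemma measurable_circ : measurable circ.
Proof. exact: measurable_itv. Qed.

Lemma eint_swap (H : R * R -> R) : measurable_fun setT H -> (forall x, 0 <= H x) ->
  (\int[mu]_(s in circ) \int[mu]_(t in circ) (H (s, t))%:E =
   \int[mu]_(t in circ) \int[mu]_(s in circ) (H (s, t))%:E)%E.
Proof.
move=> mH H0; have mD := measurable_circ.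
pose f (x : R * R) : \bar R := (H x * (\1_circ x.1 * \1_circ x.2))%:E.
have mf : measurable_fun setT f.
  apply/measurable_EFinP; apply: measurable_funM => //; apply: measurable_funM.
    apply: (@measurableT_comp _ _ _ _ _ _ (\1_circ : R -> R)) => //; exact: measurable_indic.
  apply: (@measurableT_comp _ _ _ _ _ _ (\1_circ : R -> R)) => //; exact: measurable_indic.
have f0 x : (0 <= f x)%E.
  by rewrite lee_fin mulr_ge0// mulr_ge0// indicE ler0n.
have Fub := @fubini_tonelli _ _ _ _ _ mu mu f mf f0.
have E1 s : (\int[mu]_t f (s, t) = ((fun s => \int[mu]_(t in circ) (H (s, t))%:E) \_ circ) s)%E.
  rewrite patchE; case: ifPn => sD.
    rewrite [RHS]integral_mkcond; apply: eq_integral => t _; rewrite /f /= patchE !indicE sD mul1r.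
    by case: ifP => _; rewrite ?mulr1 ?mulr0.
  rewrite -[RHS](integral0 mu setT); apply: eq_integral => t _.
  by rewrite /f /= !indicE (negbTE sD) mul0r mulr0.
have E2 t : (\int[mu]_s f (s, t) = ((fun t => \int[mu]_(s in circ) (H (s, t))%:E) \_ circ) t)%E.
  rewrite patchE; case: ifPn => sD.
    rewrite [RHS]integral_mkcond; apply: eq_integral => s _; rewrite /f /= patchE !indicE sD mulr1.
    by case: ifP => _; rewrite ?mulr1 ?mulr0.
  rewrite -[RHS](integral0 mu setT); apply: eq_integral => s _.
  by rewrite /f /= !indicE (negbTE sD) !mulr0.
rewrite [LHS]integral_mkcond [RHS]integral_mkcond.
transitivity (\int[mu]_s \int[mu]_t f (s, t))%E.
  by apply: eq_integral => s _; rewrite E1.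
by rewrite Fub; apply: eq_integral => t _; rewrite E2.
Qed.

Lemma measurable_pk r : 0 <= r < 1 ->
  measurable_fun setT (fun x : R * R => pk (r%:C * expi x.1) x.2).
Proof.
move=> /andP[r0 r1].
have mcos (p : R * R -> R) : measurable_fun setT p -> measurable_fun setT (fun x => cos (p x)).
  move=> mp; apply: (@measurableT_comp _ _ _ _ _ _ (@cos R)) => //.
  by apply: continuous_measurable_fun; exact: continuous_cos.
have msin (p : R * R -> R) : measurable_fun setT p -> measurable_fun setT (fun x => sin (p x)).
  move=> mp; apply: (@measurableT_comp _ _ _ _ _ _ (@sin R)) => //.
  by apply: continuous_measurable_fun; exact: continuous_sin.
pose q (x : R * R) : R := (cos x.2 - r * cos x.1) * (cos x.2 - r * cos x.1) +
  (sin x.2 - r * sin x.1) * (sin x.2 - r * sin x.1).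
have -> : (fun x : R * R => pk (r%:C * expi x.1) x.2) =
  fun x => (1 - r ^+ 2) * (q x) `^ (-1).
  apply/funext => x; rewrite /pk normc_realM normc_expi mulr1 ger0_norm//.
  rewrite powR_inv1; last by rewrite /q addr_ge0// -expr2 sqr_ge0.
  by rewrite normc_sqr ReD ImD ReN ImN ReZ ImZ.
apply: measurable_funM => //.
apply: (@measurableT_comp _ _ _ _ _ _ (fun x : R => x `^ (-1))).
  exact: measurable_powR.
have m1 : measurable_fun setT (fun x : R * R => cos x.2 - r * cos x.1).
  by apply: measurable_funB; [exact: mcos|apply: measurable_funM => //; exact: mcos].
have m2 : measurable_fun setT (fun x : R * R => sin x.2 - r * sin x.1).
  by apply: measurable_funB; [exact: msin|apply: measurable_funM => //; exact: msin].
by apply: measurable_funD; exact: measurable_funM.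
Qed.

Lemma eint_itg (h : R -> R) : itg h ->
  (\int[mu]_(t in circ) (h t)%:E = (2 * pi * imean h)%:E)%E.
Proof.
move=> hi; rewrite /imean mulrA divff ?gt_eqF ?twopi_gt0// mul1r.
by rewrite /rint /Rintegral fineK//; exact: integrable_fin_num.
Qed.

(** Tonelli's theorem and the symmetry of the kernel. The Poisson integrals enter as named functions
    [A'] and [B'], so that closed forms can be substituted for them. *)
Lemma imean_swap A B A' B' r : 0 <= r < 1 ->
  measurable_fun setT A -> measurable_fun setT B ->
  (forall t, 0 <= A t) -> (forall t, 0 <= B t) ->
  (forall s, itg (fun t => pk (r%:C * expi s) t * A t)) ->
  (forall s, itg (fun t => pk (r%:C * expi s) t * B t)) ->
  (forall s, imean (fun t => pk (r%:C * expi s) t * A t) = A' s) ->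
  (forall s, imean (fun t => pk (r%:C * expi s) t * B t) = B' s) ->
  itg (fun t => A' t * B t) -> itg (fun t => A t * B' t) ->
  imean (fun t => A' t * B t) = imean (fun t => A t * B' t).
Proof.
move=> r01 mA mB A0 B0 iA iB EA EB i1 i2.
have z1 s : normc (r%:C * expi s) <= 1.
  by move: r01 => /andP[r0 r1]; rewrite normc_realM normc_expi mulr1 ger0_norm// ltW.
pose H (x : R * R) := pk (r%:C * expi x.1) x.2 * (A x.2 * B x.1).
have mH : measurable_fun setT H.
  apply: measurable_funM; first exact: measurable_pk.
  by apply: measurable_funM; [exact: (@measurableT_comp _ _ _ _ _ _ A)|
    exact: (@measurableT_comp _ _ _ _ _ _ B)].
have H0 x : 0 <= H x by rewrite mulr_ge0 ?pk_ge0// mulr_ge0.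
have := eint_swap mH H0.
have E1 s : (\int[mu]_(t in circ) (H (s, t))%:E = (2 * pi * (A' s * B s))%:E)%E.
  have -> : (\int[mu]_(t in circ) (H (s, t))%:E =
    \int[mu]_(t in circ) ((fun t => B s * (pk (r%:C * expi s) t * A t)) t)%:E)%E.
    by apply: eq_integral => t _; rewrite /H /=; congr (_%:E); ring.
  rewrite eint_itg; last exact: (rintgZ (B s) (iA s)).
  by rewrite (imeanZ _ (iA s)) EA [B s * _]mulrC.
have E2 t : (\int[mu]_(s in circ) (H (s, t))%:E = (2 * pi * (A t * B' t))%:E)%E.
  have -> : (\int[mu]_(s in circ) (H (s, t))%:E =
    \int[mu]_(s in circ) ((fun s => A t * (pk (r%:C * expi t) s * B s)) s)%:E)%E.
    by apply: eq_integral => s _; rewrite /H /= pk_sym; congr (_%:E); ring.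
  rewrite eint_itg; last exact: (rintgZ (A t) (iB t)).
  by rewrite (imeanZ _ (iB t)) EB.
have -> : (\int[mu]_(s in circ) \int[mu]_(t in circ) (H (s, t))%:E =
    \int[mu]_(s in circ) (2 * pi * (A' s * B s))%:E)%E.
  by apply: eq_integral => s _; exact: E1.
have -> : (\int[mu]_(t in circ) \int[mu]_(s in circ) (H (s, t))%:E =
    \int[mu]_(t in circ) (2 * pi * (A t * B' t))%:E)%E.
  by apply: eq_integral => t _; exact: E2.
rewrite (eint_itg (rintgZ (2 * pi) i1)) (eint_itg (rintgZ (2 * pi) i2)).
rewrite (imeanZ _ i1) (imeanZ _ i2) => -[].
by do 2 move=> /(mulfI (lt0r_neq0 (twopi_gt0 R))).
Qed.

End PoissonSwap.

(** * Mean-square convergence of dilations *)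

Section DilationL2.
Variable R : realType.
Implicit Types (r s t rho tau : R) (z w : R[i]).
Variable u : R[i] -> R.
Hypothesis u_poisson : forall rho w, 0 <= rho < 1 -> normc w < 1 ->
  u (rho%:C * w) = imean (fun t => pk w t * u (rho%:C * expi t)).
Hypothesis u_cont : forall rho, 0 <= rho < 1 ->
  continuous (fun t => u (rho%:C * expi t)).
Hypothesis u_bound : forall z, disk z -> 0 <= u z <= 2.

Let circle_disk rho t : 0 <= rho < 1 -> disk (rho%:C * expi t).
Proof. exact: disk_realM. Qed.

Definition sqmean rho := imean (fun t => u (rho%:C * expi t) * u (rho%:C * expi t)).

Let u2_itg rho rho' : 0 <= rho < 1 -> 0 <= rho' < 1 ->
  itg (fun t => u (rho%:C * expi t) * u (rho'%:C * expi t)).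
Proof.
by move=> h h'; apply: cont_itg => t; apply: continuousM; exact: u_cont.
Qed.

(** The Poisson operator at [tau] maps the trace at radius [rho] to that at [tau * rho], and the
    latter to that at [tau^2 * rho]. By self-adjointness the mixed term is therefore the mean square
    at the intermediate radius, and the distance is a second difference of [sqmean]. *)
Let dist rho tau : 0 <= rho < 1 -> 0 <= tau < 1 ->
  imean (fun t => (u (rho%:C * expi t) - u ((tau ^+ 2 * rho)%:C * expi t)) ^+ 2) =
  sqmean rho - 2 * sqmean (tau * rho) + sqmean (tau ^+ 2 * rho).
Proof.
move=> r01 t01; have /andP[r0 r1] := r01; have /andP[t0 t1] := t01.
have tr01 : 0 <= tau * rho < 1.
  by rewrite mulr_ge0//=; apply: le_lt_trans r1; rewrite ler_piMl// ltW.
have ttr01 : 0 <= tau ^+ 2 * rho < 1.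
  rewrite mulr_ge0 ?sqr_ge0//=; apply: le_lt_trans r1; rewrite ler_piMl//.
  by rewrite exprn_ile1// ltW.
have z1 s : normc (tau%:C * expi s) < 1 by rewrite normc_realM normc_expi mulr1 ger0_norm.
have iA rho' s : 0 <= rho' < 1 -> itg (fun t => pk (tau%:C * expi s) t * u (rho'%:C * expi t)).
  move=> h; apply: cont_itg => t; apply: continuousM; last exact: u_cont.
  exact: pk_cont.
have u0 rho' t : 0 <= rho' < 1 -> 0 <= u (rho'%:C * expi t).
  by move=> h; have /andP[] := u_bound (circle_disk t h).
have key : imean (fun t => u ((tau ^+ 2 * rho)%:C * expi t) * u (rho%:C * expi t)) =
    sqmean (tau * rho).
  apply: (@imean_swap _ _ _ (fun s => u ((tau ^+ 2 * rho)%:C * expi s))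
     (fun t => u ((tau * rho)%:C * expi t)) tau) => //.
  - by apply: continuous_measurable_fun; exact: u_cont.
  - by apply: continuous_measurable_fun; exact: u_cont.
  - by move=> t; exact: u0.
  - by move=> t; exact: u0.
  - by move=> s; exact: iA.
  - by move=> s; exact: iA.
  - move=> s; rewrite -u_poisson//; congr u.
    by rewrite mulrA -rmorphM; congr ((_)%:C * _); ring.
  - move=> s; rewrite -u_poisson//; congr u.
    by rewrite mulrA -rmorphM; congr ((_)%:C * _); ring.
  - exact: u2_itg.
  - exact: u2_itg.
pose a t := u (rho%:C * expi t); pose b t := u ((tau ^+ 2 * rho)%:C * expi t).
have E : imean (fun t => (a t - b t) ^+ 2) =
   imean (fun t => a t * a t - 2 * (b t * a t) + b t * b t).
  by apply: eq_imean => t _; ring.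
have i1 : itg (fun t => a t * a t) by exact: u2_itg.
have i2 : itg (fun t => b t * a t) by exact: u2_itg.
have i3 : itg (fun t => b t * b t) by exact: u2_itg.
rewrite E (imeanD (rintgB i1 (rintgZ 2 i2)) i3) (imeanB i1 (rintgZ 2 i2)) (imeanZ 2 i2).
by rewrite key.
Qed.

Let sqmean_bound rho : 0 <= rho < 1 -> 0 <= sqmean rho <= 4.
Proof.
move=> h; apply/andP; split.
  by apply: imean_ge0 => t _; rewrite -expr2 sqr_ge0.
rewrite -(imean_cst 4); apply: le_imean; [exact: u2_itg|exact: rintg_cst|].
by move=> t _; have /andP[] := u_bound (circle_disk t h); nra.
Qed.

(* Along a geometric sequence of radii the second differences of [sqmean] are
   nonnegative, so a decrease would make it unbounded near the origin. *)
Let sqmean_mono rho tau : 0 <= rho < 1 -> 0 <= tau < 1 ->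
  sqmean (tau * rho) <= sqmean rho.
Proof.
move=> r01 t01; have /andP[r0 r1] := r01; have /andP[t0 t1] := t01.
pose a k := sqmean (tau ^+ k * rho).
have ak01 k : 0 <= tau ^+ k * rho < 1.
  rewrite mulr_ge0 ?exprn_ge0//=; apply: le_lt_trans r1; rewrite ler_piMl//.
  by rewrite exprn_ile1// ltW.
have conv k : 0 <= a k - 2 * a k.+1 + a k.+2.
  have := dist (ak01 k) t01.
  have -> : tau * (tau ^+ k * rho) = tau ^+ k.+1 * rho by rewrite mulrA exprS.
  have -> : tau ^+ 2 * (tau ^+ k * rho) = tau ^+ k.+2 * rho by rewrite mulrA -exprD.
  move=> <-.
  by apply: imean_ge0 => t _; rewrite sqr_ge0.
rewrite leNgt; apply/negP => lt.
have e0 : a 0%N = sqmean rho by rewrite /a expr0 mul1r.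
have e1 : a 1%N = sqmean (tau * rho) by rewrite /a expr1.
set d := sqmean (tau * rho) - sqmean rho.
have d0 : 0 < d by rewrite /d subr_gt0.
have inc k : d <= a k.+1 - a k.
  by elim: k => [|k ih]; [rewrite e0 e1|have := conv k; move: ih; lra].
have lin k : k%:R * d <= a k.
  elim: k => [|k ih].
    by rewrite mul0r e0; have /andP[] := sqmean_bound r01.
  by rewrite -natr1 mulrDl mul1r; have := inc k; move: ih; lra.
have h : 4 / d < (Num.truncn (4 / d)).+1%:R by exact: truncnS_gt.
have := lin (Num.truncn (4 / d)).+1.
have /andP[_] := sqmean_bound (ak01 (Num.truncn (4 / d)).+1).
rewrite -/(a _); rewrite ltr_pdivrMr// in h; move: h; lra.
Qed.

Let sqsup := sup [set sqmean rho | rho in [set rho | 0 <= rho < 1]].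

Let sq_has_sup : has_sup [set sqmean rho | rho in [set rho : R | 0 <= rho < 1]].
Proof.
split; first by exists (sqmean 0), 0 => //=; rewrite lexx ltr01.
by exists 4 => _ [rho h <-]; have /andP[] := sqmean_bound h.
Qed.

Let sqmean_mono' rho rho' : 0 <= rho' -> rho' <= rho -> rho < 1 -> sqmean rho' <= sqmean rho.
Proof.
move=> r0 rr r1; have [->//|ne] := eqVneq rho' rho.
have lt : rho' < rho by rewrite lt_neqAle ne.
have p0 : 0 < rho by exact: le_lt_trans lt.
have -> : rho' = (rho' / rho) * rho by rewrite divfK// gt_eqF.
apply: sqmean_mono; first by rewrite (ltW p0).
by rewrite divr_ge0 ?(ltW p0)//= ltr_pdivrMr// mul1r.
Qed.

Lemma dilation_L2_close (d : R) : 0 < d -> exists2 rho0, 0 <= rho0 < 1 &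
  forall rho rho', rho0 <= rho' -> rho' <= rho -> rho < 1 ->
  imean (fun t => (u (rho%:C * expi t) - u (rho'%:C * expi t)) ^+ 2) <= d.
Proof.
move=> d0; have d20 : 0 < d / 2 by rewrite divr_gt0.
have [_ [rho0 /= h <-] hs] := sup_adherent d20 sq_has_sup.
exists rho0 => // rho rho' r1 r2 r3; have /andP[h0 h1] := h.
have [->|ne] := eqVneq rho' rho.
  have -> : (fun t => (u (rho%:C * expi t) - u (rho%:C * expi t)) ^+ 2) = fun=> 0.
    by apply/funext => t; rewrite subrr expr0n.
  by rewrite imean_cst ltW.
have lt : rho' < rho by rewrite lt_neqAle ne.
have p0 : 0 < rho by apply: le_lt_trans lt; exact: le_trans r1.
have q0 : 0 <= rho' / rho by rewrite divr_ge0 ?(ltW p0)// (le_trans h0).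
(* The geometric mean of the two radii is the intermediate one; all three mean squares lie within
   [d / 2] of the supremum. *)
pose tau := Num.sqrt (rho' / rho).
have t2 : tau ^+ 2 = rho' / rho by rewrite sqr_sqrtr.
have t0 : 0 <= tau by exact: sqrtr_ge0.
have q1 : rho' / rho < 1 by rewrite ltr_pdivrMr// mul1r.
have t1 : tau < 1.
  rewrite ltNge; apply/negP => t1; have : 1 <= tau ^+ 2 by rewrite exprn_ege1.
  by rewrite t2; move: q1; lra.
have e : tau ^+ 2 * rho = rho' by rewrite t2 divfK// gt_eqF.
have r01 : 0 <= rho < 1 by rewrite ltW.
have := @dist rho tau r01; rewrite t0 t1 e => /(_ isT) ->.
have ub r : 0 <= r < 1 -> sqmean r <= sqsup.
  by move=> hr; apply: ub_le_sup; [exact: sq_has_sup.2|exists r].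
have lo r : rho0 <= r -> r < 1 -> sqsup - d / 2 <= sqmean r.
  by move=> hr hr1; apply: le_trans (ltW hs) _; exact: sqmean_mono'.
have r'1 : 0 <= rho' < 1 by rewrite (le_trans h0 r1) (lt_trans lt).
have tr : rho' <= tau * rho.
  by rewrite -e expr2 -mulrA ler_piMl ?mulr_ge0// ltW.
have tr1 : tau * rho < 1.
  by apply: le_lt_trans r3; rewrite ler_piMl// ltW.
have := ub _ r01; have := ub _ r'1.
have := lo (tau * rho) (le_trans r1 tr) tr1.
by lra.
Qed.

End DilationL2.

(** * Bounded harmonic functions as Poisson integrals *)

Section BoundaryDensity.
Variable R : realType.
Notation mu := (@lebesgue_measure R).
Implicit Types (r s t rho tau : R) (z w : R[i]).

Let geo_sum n : \sum_(0 <= k < n) 2 ^- k <= 2 :> R.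
Proof.
suff -> : \sum_(0 <= k < n) 2 ^- k = 2 - 2 * 2 ^- n :> R.
  by rewrite lerBlDr lerDl mulr_ge0// invr_ge0 exprn_ge0.
elim: n => [|n ih]; first by rewrite big_nil expr0 invr1; lra.
rewrite big_nat_recr//= ih exprS invfM.
have : (2 : R) ^- n = 2 ^- n by [].
by lra.
Qed.

(** The increment is dominated by [F k = 2 ^- k + 2 ^ k * (v k.+1 - v k) ^ 2], by the
    arithmetic-geometric inequality, and [F k] has mean at most [2 * 2 ^- k]. The sum of the [F k]
    is integrable, hence finite almost everywhere. *)
Lemma ae_cvg_of_sq (v : nat -> R -> R) : (forall k, measurable_fun setT (v k)) ->
  (forall k, itg (fun t => (v k.+1 t - v k t) ^+ 2)) ->
  (forall k, imean (fun t => (v k.+1 t - v k t) ^+ 2) <= 4 ^- k) ->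
  {ae mu, forall t, @circ R t -> cvgn (v ^~ t)}.
Proof.
move=> mv iv hv; have mD : measurable (@circ R : set (measurableTypeR R)) by exact: measurable_itv.
pose F k t : R := 2 ^- k + 2 ^+ k * (v k.+1 t - v k t) ^+ 2.
have P0 k : 0 <= (2 : R) ^+ k by rewrite exprn_ge0.
have N0 k : 0 <= (2 : R) ^- k by rewrite invr_ge0.
have F0 k t : 0 <= F k t by rewrite addr_ge0// mulr_ge0// sqr_ge0.
have mF k : measurable_fun setT (F k).
  apply: measurable_funD => //; apply: measurable_funM => //.
  by apply: measurable_funX; exact: measurable_funB.
have iF k : itg (F k) by apply: (rintgD (rintg_cst _ _ _) (rintgZ _ (iv k))).
have mF' k : measurable_fun (@circ R) (fun t => (F k t)%:E).
  by apply/measurable_EFinP; exact: measurable_funS (mF k).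
have F0' k t : @circ R t -> (0 <= (F k t)%:E)%E by rewrite lee_fin.
have FM k : imean (F k) <= 2 * 2 ^- k.
  rewrite /F (imeanD (rintg_cst _ _ _) (rintgZ _ (iv k))) imean_cst (imeanZ _ (iv k)).
  have h := ler_wpM2l (P0 k) (hv k).
  have e : 2 ^+ k * 4 ^- k = 2 ^- k :> R.
    have -> : (4 : R) ^+ k = 2 ^+ k * 2 ^+ k by rewrite -exprMn; congr (_ ^+ _); lra.
    by rewrite invfM mulrA divff ?mul1r// expf_neq0// pnatr_eq0.
  by move: h; rewrite e; lra.
pose S t := (\sum_(0 <= k <oo) (F k t)%:E)%E.
have S0 t : (0 <= S t)%E by apply: nneseries_ge0 => k _ _; rewrite lee_fin.
have iS : mu.-integrable (@circ R) S.
  apply/integrableP; split.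
    apply: (@ge0_emeasurable_sum _ _ _ _ (fun k t => (F k t)%:E) xpredT) => //.
    by move=> k t Dt _; exact: F0'.
  under eq_integral do rewrite gee0_abs//.
  rewrite /S integral_nneseries//.
  apply: (@le_lt_trans _ _ (2 * pi * 4)%:E); last exact: ltry.
  apply: lime_le.
    by apply: is_cvg_nneseries => k _ _; apply: integral_ge0 => t Dt; exact: F0'.
  apply: nearW => n.
  under eq_bigr do rewrite (eint_itg (iF _)).
  rewrite sumEFin lee_fin -mulr_sumr ler_wpM2l ?(ltW (twopi_gt0 R))//.
  apply: (@le_trans _ _ (\sum_(0 <= k < n) 2 * 2 ^- k)); first exact: ler_sum.
  by rewrite -mulr_sumr; have := geo_sum n; lra.
apply: filterS (integrable_ae mD iS) => t h Dt.
have /fineK Sfin := h Dt.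
have : cvgn (series (telescope (v ^~ t))).
  apply: normed_cvg.
  have cF : cvgn (series (fun k => F k t)).
    apply: nondecreasing_is_cvgn.
      by apply/nondecreasing_seqP => n; rewrite /series/= big_nat_recr//= lerDl.
    exists (fine (S t)) => _ [n _ <-]; rewrite -lee_fin Sfin /series/= -sumEFin.
    by apply: nneseries_lim_ge => k _ _; rewrite lee_fin.
  apply: (@series_le_cvg _ (fun k => `|telescope (v ^~ t) k|) (fun k => F k t)) => //.
  move=> k; rewrite /telescope /F.
  set d := v k.+1 t - v k t.
  have p0 : 0 < (2 : R) ^+ k by rewrite exprn_gt0.
  move: (2 ^+ k) p0 => p p0; rewrite -(ler_pM2l p0) mulrDr divff ?gt_eqF// -(real_normK (num_real d)).
  move: `|d| (normr_ge0 d) => x x0; have := sqr_ge0 (p * x - 1); have := mulr_ge0 (ltW p0) x0.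
  by nra.
rewrite telescopeK => c.
have -> : v ^~ t = (fun n => (v n t - v 0%N t) + v 0%N t).
  by apply/funext => n; rewrite subrK.
by apply: is_cvgD => //; exact: is_cvg_cst.
Qed.

Variable u : R[i] -> R.
Hypothesis u_poisson : forall rho w, 0 <= rho < 1 -> normc w < 1 ->
  u (rho%:C * w) = imean (fun t => pk w t * u (rho%:C * expi t)).
Hypothesis u_cont : forall rho, 0 <= rho < 1 ->
  continuous (fun t => u (rho%:C * expi t)).
Hypothesis u_contd : forall z (e : R), disk z -> 0 < e -> exists2 d : R, 0 < d &
  forall w, normc (w - z) < d -> `|u w - u z| < e.
Hypothesis u_bound : forall z, disk z -> 0 <= u z <= 2.

Lemma boundary_density : exists g : R -> R, [/\ measurable_fun setT g,
  forall t, 0 <= g t <= 2 &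
  forall w, normc w < 1 -> u w = imean (fun t => pk w t * g t)].
Proof.
have P4 k : 0 < (4 : R) ^- k by rewrite invr_gt0 exprn_gt0.
have /choice[q hq] : forall k : nat, exists rho0, 0 <= rho0 < 1 /\
  forall rho rho', rho0 <= rho' -> rho' <= rho -> rho < 1 ->
  imean (fun t => (u (rho%:C * expi t) - u (rho'%:C * expi t)) ^+ 2) <= 4 ^- k.
  by move=> k; have [r h1 h2] := dilation_L2_close u_poisson u_cont u_bound (P4 k); exists r.
(* The radii must pass the thresholds of mean-square closeness and also tend to 1. *)
pose b k : R := Num.max (q k) (1 - k.+2%:R^-1).
have b1 k : b k < 1.
  rewrite gt_max; have /andP[_ ->] := (hq k).1 => /=.
  by rewrite ltrBlDr ltrDl invr_gt0 ltr0n.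
pose rho := fix rho k := match k with 0 => b 0%N | m.+1 => Num.max (rho m) (b m.+1) end.
have rhoS k : rho k <= rho k.+1 by rewrite /= le_max lexx.
have rhob k : b k <= rho k by case: k => [//|k]; rewrite /= le_max lexx orbT.
have rho1 k : rho k < 1 by elim: k => [|k ih] /=; [exact: b1|rewrite gt_max ih; exact: b1].
have rhoq k : q k <= rho k by apply: le_trans (rhob k); rewrite le_max lexx.
have rho01 k : 0 <= rho k < 1.
  by rewrite rho1 andbT; apply: le_trans (rhoq k); have /andP[] := (hq k).1.
pose v k t := u ((rho k)%:C * expi t).
have mv k : measurable_fun setT (v k) by apply: continuous_measurable_fun; exact: u_cont.
have vb k t : 0 <= v k t <= 2 by apply: u_bound; exact: disk_realM.
have iv k : itg (fun t => (v k.+1 t - v k t) ^+ 2).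
  apply: cont_itg => t.
  have c : {for t, continuous (fun t => v k.+1 t - v k t)}.
    by apply: continuousB; exact: u_cont.
  by apply: cont_ext (continuousM c c) => x /=; rewrite expr2.
have ae := ae_cvg_of_sq mv iv (fun k => (hq k).2 _ _ (rhoq k) (rhoS k) (rho1 k.+1)).
pose g0 t := limn_sup (v ^~ t).
have mg0 : measurable_fun setT g0.
  apply: measurable_fun_limn_sup => //.
  - by move=> t _; exists 2 => _ [k _ <-]; have /andP[] := vb k t.
  - by move=> t _; exists 0 => _ [k _ <-]; have /andP[] := vb k t.
(* The upper limit is measurable without restriction to the set of convergence; clipping keeps it in
   [[0, 2]] on the exceptional null set and changes nothing where the sequence converges. *)
pose g t := Num.min 2 (Num.max 0 (g0 t)).
have mg : measurable_fun setT g.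
  exact: (measurable_minr (measurable_cst _) (measurable_maxr (measurable_cst _) mg0)).
have gb t : 0 <= g t <= 2.
  by rewrite /g le_min ge_min !lexx ler0n le_max lexx.
have vg t : cvgn (v ^~ t) -> (v ^~ t) @ \oo --> g t.
  move=> c; have e : g0 t = limn (v ^~ t) by exact: cvg_limn_supE.
  suff -> : g t = limn (v ^~ t) by [].
  have h0 : 0 <= limn (v ^~ t).
    by apply: limr_ge => //; apply: nearW => k; have /andP[] := vb k t.
  have h2 : limn (v ^~ t) <= 2.
    by apply: limr_le => //; apply: nearW => k; have /andP[] := vb k t.
  by rewrite /g e max_r// min_r.
exists g; split => // w w1.
have mD : measurable (@circ R : set (measurableTypeR R)) by exact: measurable_itv.
have mpk : measurable_fun setT (pk w).
  by apply: continuous_measurable_fun => t; exact: pk_cont.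
have bnd (h : R -> R) : measurable_fun setT h -> (forall t, 0 <= h t <= 2) ->
    itg (fun t => pk w t * h t) /\ forall t, `|pk w t * h t| <= 2 / (1 - normc w) * 2.
  move=> mh hb.
  have B t : `|pk w t * h t| <= 2 / (1 - normc w) * 2.
    have /andP[h0 h2] := hb t; have p0 := pk_ge0 t (ltW w1).
    rewrite ger0_norm; last exact: mulr_ge0.
    by apply: ler_pM => //; exact: pk_le.
  split => //; apply: itg_bounded (fun t _ => B t).
  exact: measurable_funM.
have [ig _] := bnd g mg gb.
have m1 k : measurable_fun (@circ R) (fun t => (pk w t * v k t)%:E).
  by apply/measurable_EFinP; apply: measurable_funS (measurable_funM mpk (mv k)).
have m2 : measurable_fun (@circ R) (fun t => (pk w t * g t)%:E).
  by apply/measurable_EFinP; apply: measurable_funS (measurable_funM mpk mg).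
have c3 : {ae mu, forall t, @circ R t ->
    (fun k => (pk w t * v k t)%:E) @ \oo --> (pk w t * g t)%:E}.
  apply: (@filterS _ _ (ae_filter_ringOfSetsType mu)) ae => t h Dt.
  apply: cvg_EFin; first exact: nearW.
  by apply: cvgM; [exact: cvg_cst|exact: vg (h Dt)].
have d4 : {ae mu, forall t k, @circ R t ->
    (`|(pk w t * v k t)%:E| <= (2 / (1 - normc w) * 2)%:E)%E}.
  by apply: (aeW mu) => t k _; rewrite lee_fin; exact: (bnd _ (mv k) (vb k)).2.
have [_ _ dc] := dominated_convergence mD m1 m2 c3 (rintg_cst _ _ _) d4.
rewrite (eint_itg ig) in dc.
have dc' : (fun k => (2 * pi * u ((rho k)%:C * w))%:E) @ \oo --> (2 * pi * imean (fun t => pk w t * g t))%:E.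
  apply: cvg_trans dc; apply: near_eq_cvg; apply: nearW => k /=.
  by rewrite (u_poisson (rho01 k) w1) (eint_itg (bnd _ (mv k) (vb k)).1).
have lim_rho : forall e : R, 0 < e -> \forall k \near \oo, 1 - rho k < e.
  move=> e e0; exists (Num.truncn e^-1) => // k /= hk.
  have h : e^-1 < k.+2%:R.
    apply: lt_trans (truncnS_gt _) _; by rewrite ltr_nat !ltnS.
  have : 1 - k.+2%:R^-1 <= rho k by apply: le_trans (rhob k); rewrite le_max lexx orbT.
  have : k.+2%:R^-1 < e by rewrite invf_plt ?posrE ?ltr0n.
  by move: (rho k) (k.+2%:R^-1 : R) => x y; lra.
have c1 : (fun k => 2 * pi * u ((rho k)%:C * w)) @ \oo --> 2 * pi * imean (fun t => pk w t * g t).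
  by move/fine_cvg : dc'.
have c2 : (fun k => 2 * pi * u ((rho k)%:C * w)) @ \oo --> 2 * pi * u w.
  apply: cvgM; first exact: cvg_cst.
  apply/cvgrPdist_lt => e e0; have [d d0 hd] := u_contd w1 e0.
  apply: filterS (lim_rho d d0) => k hk; rewrite distrC; apply: hd.
  have -> : (rho k)%:C * w - w = (rho k - 1)%:C * w by rewrite rmorphB rmorph1; ring.
  have /andP[_ /ltW r1] := rho01 k.
  rewrite normc_realM distrC ger0_norm ?subr_ge0//.
  by apply: le_lt_trans hk; rewrite ler_piMr ?subr_ge0// ltW.
apply: (mulfI (lt0r_neq0 (twopi_gt0 R))).
exact: (cvg_unique (@norm_hausdorff _ R^o) c2 c1).
Qed.

End BoundaryDensity.

(** * Radial limits at Lebesgue points *)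

Section RadialLimits.
Variable R : realType.
Notation mu := (@lebesgue_measure R).
Implicit Types (r s t x y : R) (f : R[i] -> R[i]).

Let sin_lower_small y : 0 <= y <= 1 -> cos 1 * y <= sin y.
Proof.
move=> /andP[y0 y1]; have p2 := pi_ge2 R.
have -> : sin y = rint 0 y cos.
  by rewrite (@rint_FTC _ _ _ sin cos)// ?sin0 ?subr0//; exact: continuous_cos.
have -> : cos 1 * y = rint 0 y (fun=> cos 1) by rewrite rint_cst// subr0.
apply: le_rint => //; [exact: rintg_cst|by apply: cont_rintg => t _; exact: continuous_cos|].
move=> t; rewrite in_itv/= => /andP[t0 ty].
have [->//|ne] := eqVneq t 1.
apply: ltW; rewrite ltr_cos ?in_itv/= ?ler01 ?t0 /=; [|lra|lra].
by rewrite lt_neqAle ne (le_trans ty).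
Qed.

Let sin_lower y0 : 0 < y0 < pi -> exists2 c, 0 < c &
  forall y, 0 <= y <= y0 -> c * y <= sin y.
Proof.
move=> /andP[y00 y0pi]; have p2 := pi_ge2 R; have p0 := pi_gt0 R.
have s0 : 0 < sin y0 by apply: sin_gt0_pi; rewrite y00.
have s1 : 0 < sin 1 :> R by apply: sin_gt0_pi; rewrite ltr01 /=; lra.
pose m := Num.min (sin 1) (sin y0) / pi.
have m0 : 0 < m by rewrite divr_gt0// lt_min s1.
have smono (a b : R) : 0 <= a -> a <= b -> b <= pi / 2 -> sin a <= sin b.
  move=> a0 ab bp; have [->//|ne] := eqVneq a b.
  by apply: ltW; rewrite ltr_sin ?in_itv/=; [rewrite lt_neqAle ne|
    apply/andP; split; lra|apply/andP; split; lra].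
exists (Num.min (cos 1) m); first by rewrite lt_min cos1_gt0.
move=> y /andP[yp yy0]; have [y1|y1] := leP y 1.
  apply: le_trans (sin_lower_small _); last by rewrite yp.
  by rewrite ler_wpM2r// ge_min lexx.
apply: (@le_trans _ _ (m * pi)).
  apply: ler_pM => //; [by rewrite le_min (ltW (cos1_gt0 R)) (ltW m0)|by rewrite ge_min lexx orbT|lra].
rewrite /m divfK ?gt_eqF//.
have [yh|yh] := leP y (pi / 2).
  apply: (@le_trans _ _ (sin 1)); first by rewrite ge_min lexx.
  by apply: smono => //; exact: ltW.
apply: (@le_trans _ _ (sin y0)); first by rewrite ge_min lexx orbT.
have e (z : R) : sin (pi - z) = sin z.
  by rewrite sinB sinpi cospi mul0r sub0r mulN1r opprK.
by rewrite -(e y) -(e y0); apply: smono; lra.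
Qed.

Lemma chordE s t : normc (expi s - expi t) = 2 * `|sin ((s - t) / 2)|.
Proof.
apply: (@pexpIrn R 2 isT); rewrite ?nnegrE ?normc_ge0 ?mulr_ge0//.
rewrite normc_sqr ReD ImD ReN ImN /= exprMn real_normK ?num_real//.
set y := (s - t) / 2.
have -> : s = t + y + y by rewrite /y; lra.
have e1 := cos2Dsin2 t; have e2 := cos2Dsin2 y.
rewrite !(cosD, sinD).
move: (cos t) (sin t) (cos y) (sin y) e1 e2 => a b c d e1 e2.
have -> : (a * c - b * d) * c - (b * c + a * d) * d - a = - 2 * d * (a * d + b * c) + a * (c ^+ 2 + d ^+ 2 - 1) by ring.
have -> : (b * c + a * d) * c + (a * c - b * d) * d - b = 2 * d * (a * c - b * d) + b * (c ^+ 2 + d ^+ 2 - 1) by ring.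
rewrite e2 subrr !mulr0 !addr0.
have -> : (- 2 * d * (a * d + b * c)) ^+ 2 + (2 * d * (a * c - b * d)) ^+ 2 =
  4 * d ^+ 2 * ((a ^+ 2 + b ^+ 2) * (c ^+ 2 + d ^+ 2)) by ring.
by rewrite e1 e2; ring.
Qed.

(** For [t] inside the interval, [|s - t| / 2] stays below some [y0 < pi], where the sine is
    comparable to its argument. The constant degenerates at the end points, which form a null
    set. *)
Lemma chord_lower t : 0 < t < 2 * pi -> exists2 c, 0 < c &
  forall s, 0 <= s <= 2 * pi -> c * `|s - t| <= normc (expi s - expi t).
Proof.
move=> /andP[t0 t1]; pose y0 := Num.max t (2 * pi - t) / 2.
have y0b : 0 < y0 < pi.
  apply/andP; split; first by rewrite divr_gt0// lt_max t0.
  by rewrite ltr_pdivrMr// gt_max mulrC t1 /=; lra.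
have [c c0 hc] := sin_lower y0b.
exists c => // s /andP[s0 s1]; rewrite chordE.
have ab : 0 <= `|s - t| / 2 <= y0.
  rewrite divr_ge0//= /y0 ler_pM2r// ler_norml.
  have m1 : t <= Num.max t (2 * pi - t) by rewrite le_max lexx.
  have m2 : 2 * pi - t <= Num.max t (2 * pi - t) by rewrite le_max lexx orbT.
  by move: (Num.max _ _) m1 m2 => m m1 m2; apply/andP; split; lra.
have := hc _ ab.
have -> : sin (`|s - t| / 2) = `|sin ((s - t) / 2)|.
  have /andP[q0 q1] := ab; have /andP[_ yp] := y0b.
  have sg : 0 <= sin (`|s - t| / 2) by apply: sin_ge0_pi; rewrite q0 (le_trans q1)// ltW.
  rewrite -(ger0_norm sg); case: (ger0P (s - t)) => // _.
  by rewrite mulNr sinN normrN.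
lra.
Qed.

Lemma normc_expi_dist r s t :
  normc (expi s - r%:C * expi t) ^+ 2 = (1 - r) ^+ 2 + r * normc (expi s - expi t) ^+ 2.
Proof.
rewrite !normc_sqr !(ReD, ImD, ReN, ImN, ReZ, ImZ) /=.
have e1 := cos2Dsin2 t; have e2 := cos2Dsin2 s.
move: (cos t) (sin t) (cos s) (sin s) e1 e2 => a b c d e1 e2.
apply/eqP; rewrite -subr_eq0; apply/eqP.
have -> : (c - r * a) ^+ 2 + (d - r * b) ^+ 2 - ((1 - r) ^+ 2 + r * ((c - a) ^+ 2 + (d - b) ^+ 2)) =
  (1 - r) * (c ^+ 2 + d ^+ 2 - 1) + (r ^+ 2 - r) * (a ^+ 2 + b ^+ 2 - 1) by ring.
by rewrite e1 e2 subrr !mulr0 addr0.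
Qed.

(* Dilating the distance to the boundary by [K] costs a factor [K] on the arc
   far from the pole, so the mass of the kernel there is [O(1/K)]. *)
Lemma pk_compare r s t (K : R) : 2^-1 <= r < 1 -> 1 <= K -> K * (1 - r) <= 2^-1 ->
  K * (1 - r) <= normc (expi s - expi t) ->
  pk (r%:C * expi t) s <= 8 / K * pk ((1 - K * (1 - r))%:C * expi t) s.
Proof.
move=> /andP[r0 r1] K1; set d := 1 - r => Kd; set x := normc (expi s - expi t) => xd.
have d0 : 0 < d by rewrite /d; lra.
have K0 : 0 < K by lra.
have Kd0 : 0 < K * d by rewrite mulr_gt0.
have x0 : 0 < x by exact: lt_le_trans xd.
have rp : 0 <= r by lra.
have rp' : 0 <= 1 - K * d by lra.
rewrite /pk !normc_realM !normc_expi !mulr1 !ger0_norm// !normc_expi_dist -/x.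
rewrite -/d subKr.
have x20 : 0 < x ^+ 2 by rewrite exprn_gt0.
have xd2 : (K * d) ^+ 2 <= x ^+ 2 by rewrite lerXn2r ?nnegrE ?(ltW Kd0) ?(ltW x0).
have er : 1 - r ^+ 2 = d * (1 + r) by rewrite /d; ring.
have er' : 1 - (1 - K * d) ^+ 2 = K * d * (2 - K * d) by ring.
apply: (@le_trans _ _ (4 * d / x ^+ 2)).
  rewrite er ler_pdivrMr; last by rewrite ltr_wpDl ?sqr_ge0// mulr_gt0//; lra.
  rewrite mulrAC ler_pdivlMr//.
  have h1 : 0 <= d * x ^+ 2 by rewrite mulr_ge0 ?(ltW d0) ?(ltW x20).
  have h2 : 0 <= d * d ^+ 2 by rewrite mulr_ge0 ?sqr_ge0 ?(ltW d0).
  have h4 : 0 <= d * x ^+ 2 * (4 * r - (1 + r)) by rewrite mulr_ge0//; lra.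
  have -> : d * (1 + r) * x ^+ 2 = 4 * d * (r * x ^+ 2) - d * x ^+ 2 * (4 * r - (1 + r)) by ring.
  have -> : 4 * d * (d ^+ 2 + r * x ^+ 2) = 4 * d * (r * x ^+ 2) + 4 * (d * d ^+ 2) by ring.
  by move: h4 h2; lra.
have q0 : 0 < (K * d) ^+ 2 + (1 - K * d) * x ^+ 2.
  by rewrite ltr_pwDl// ?exprn_gt0// mulr_ge0// ltW.
rewrite er' mulrA ler_pdivlMr// mulrAC ler_pdivrMr//.
have e8 : 8 / K * (K * d * (2 - K * d)) = 8 * d * (2 - K * d) by field; rewrite gt_eqF.
rewrite e8.
have b1 : (K * d) ^+ 2 + (1 - K * d) * x ^+ 2 <= 2 * x ^+ 2.
  have : 0 <= K * d * x ^+ 2 by rewrite mulr_ge0 ?(ltW Kd0) ?(ltW x20).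
  by move: xd2; lra.
have d4 : 0 <= 4 * d by rewrite mulr_ge0// ltW.
have h1 := ler_wpM2l d4 b1.
have h2 : 0 <= d * x ^+ 2 * (1 - K * d).
  by apply: mulr_ge0 => //; apply: mulr_ge0; exact: ltW.
have -> : 8 * d * (2 - K * d) * x ^+ 2 = 4 * d * (2 * x ^+ 2) + 8 * (d * x ^+ 2 * (1 - K * d)) by ring.
by move: h1 h2; lra.
Qed.

Variable g : R -> R.
Hypothesis mg : measurable_fun setT g.
Hypothesis g02 : forall t, 0 <= g t <= 2.

Let devg t : R -> R := fun s => `|g s - g t|.

Let devg_le t s : 0 <= devg t s <= 2.
Proof.
rewrite normr_ge0 /devg ler_norml.
by have /andP[] := g02 s; have /andP[] := g02 t; move=> *; apply/andP; split; lra.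
Qed.

Let mdevg t : measurable_fun setT (devg t).
Proof.
by apply: measurableT_comp => //; exact: measurable_funB.
Qed.

Let near_part t (eta b : R) : 0 < eta -> (davg g t eta <= b%:E)%E -> 0 <= b ->
  let h := devg t \_ (ball t eta) in
  itg h /\ 2 * pi * imean h <= 2 * eta * b.
Proof.
move=> eta0 hb b0 h.
have mh : measurable_fun setT h.
  have mb0 : measurable (ball t eta : set R) by exact: measurable_ball.
  by apply/(measurable_restrictT _ mb0); exact: measurable_funS (mdevg t).
have hbd s : `|h s| <= 2.
  rewrite /h patchE; case: ifP => _; last by rewrite normr0.
  by have /andP[h0 h2] := devg_le t s; rewrite ger0_norm.
have ih : itg h by apply: itg_bounded (fun s _ => hbd s).
split => //; rewrite -lee_fin -eint_itg//.
have mD : measurable (@circ R : set (measurableTypeR R)) by exact: measurable_itv.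
have mb : measurable (ball t eta : set (measurableTypeR R)) by exact: measurable_ball.
have mE : measurable_fun (ball t eta) (fun s => (devg t s)%:E).
  by apply/measurable_EFinP; exact: measurable_funS (mdevg t).
apply: (@le_trans _ _ (\int[mu]_(s in ball t eta) (devg t s)%:E)%E).
  have -> : (\int[mu]_(s in @circ R) (h s)%:E = \int[mu]_(s in @circ R `&` ball t eta) (devg t s)%:E)%E.
    rewrite integral_mkcondr; apply: eq_integral => s _.
    by rewrite /h !patchE; case: ifP.
  apply: ge0_subset_integral => //.
  - exact: measurableI.
  - by move=> s _; rewrite lee_fin; have /andP[] := devg_le t s.
move: hb; rewrite /davg /iavg (lebesgue_measure_ball _ (ltW eta0)).
rewrite inver mulrn_eq0/= gt_eqF//= => hb.
have e2 : 0 < eta *+ 2 by rewrite mulrn_wgt0.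
have -> : (\int[mu]_(s in ball t eta) (devg t s)%:E)%E =
   ((eta *+ 2)%:E * (((eta *+ 2)^-1)%:E * \int[mu]_(s in ball t eta) `|((center (g t) \o g) s)%:E|))%E.
  by rewrite muleA -EFinM divff ?gt_eqF// mul1e.
have -> : 2 * eta * b = eta *+ 2 * b by rewrite mulr2n; ring.
by rewrite EFinM lee_wpmul2l// lee_fin ltW.
Qed.

(** Split the circle at distance [K * (1 - r)] from the pole. On the far arc the kernel has mass of
    order [1 / K]; on the near one it is at most [2 / (1 - r)] and the Lebesgue point makes the mean
    deviation small. *)
Lemma radial_lebesgue_pt t : 0 < t < 2 * pi -> lebesgue_pt g t ->
  forall e : R, 0 < e -> exists2 d : R, 0 < d & forall r, 1 - d < r < 1 ->
  `|imean (fun s => pk (r%:C * expi t) s * g s) - g t| < e.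
Proof.
move=> t01 lpt e e0; have [c c0 hc] := chord_lower t01.
have p0 := pi_gt0 R.
(* The deviation is at most 2, so the far arc contributes [16 / K < e / 2]. *)
pose K := 32 / e + 1.
have e32 : 0 < 32 / e by rewrite divr_gt0.
have K1 : 1 <= K by rewrite /K; lra.
have K0 : 0 < K by lra.
(* With [eta = K * (1 - r) / c], the near arc contributes [2 / (1 - r) * (2 * eta * b) = e / 4]. *)
pose b := e * c / (16 * K).
have b0 : 0 < b by rewrite divr_gt0 ?mulr_gt0.
have b0' : (0 < b%:E)%E by rewrite lte_fin.
have [d1 /= d10 hd1] : exists2 d1 : R, 0 < d1 & forall eta, 0 < eta < d1 -> (davg g t eta <= b%:E)%E.
  have [d1 /= d10 hd] := lpt _ (open_ereal_lt' b0').
  exists d1 => // eta /andP[h1 h2]; apply/ltW/hd => //=.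
  by rewrite sub0r normrN gtr0_norm.
pose d := Num.min (2^-1) (Num.min (2^-1 / K) (d1 * c / K)).
have d0 : 0 < d by rewrite !lt_min invr_gt0 ltr0n !divr_gt0// mulr_gt0.
exists d => // r /andP[r1 r2].
set dl := 1 - r; have dl0 : 0 < dl by rewrite /dl; lra.
have dld : dl < d by rewrite /dl; lra.
have : dl < 2^-1 by apply: lt_le_trans dld _; rewrite ge_min lexx.
move=> dlh; have r12 : 2^-1 <= r < 1 by rewrite r2 andbT; move: dlh; rewrite /dl; lra.
have Kdl : K * dl <= 2^-1.
  by rewrite mulrC -ler_pdivlMr//; apply: le_trans (ltW dld) _; rewrite !ge_min lexx orbT.
pose eta := K * dl / c.
have eta0 : 0 < eta by rewrite divr_gt0// mulr_gt0.
have eta1 : eta < d1.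
  by rewrite ltr_pdivrMr// mulrC -ltr_pdivlMr//; apply: lt_le_trans dld _; rewrite !ge_min lexx !orbT.
have hav := hd1 eta; rewrite eta0 eta1 in hav.
have [ih mh] := near_part eta0 (hav isT) (ltW b0).
set h := devg t \_ _ in ih mh.
have r01 : 0 <= r < 1 by rewrite r2 andbT; move: r12 => /andP[]; lra.
have z1 x : 0 <= x < 1 -> normc (x%:C * expi t) < 1.
  by move=> /andP[x0 x1]; rewrite normc_realM normc_expi mulr1 ger0_norm.
have mpk : measurable_fun setT (pk (r%:C * expi t)).
  by apply: continuous_measurable_fun => s; exact: pk_cont (z1 _ r01).
have pb s := pk_le s (z1 _ r01).
have pk0 s := pk_ge0 s (ltW (z1 _ r01)).
have nz : normc (r%:C * expi t) = r.
  by rewrite normc_realM normc_expi mulr1 ger0_norm//; case/andP: r01.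
rewrite nz -/dl in pb.
have bi (q : R -> R) : measurable_fun setT q -> (forall s, 0 <= q s <= 2) ->
    itg (fun s => pk (r%:C * expi t) s * q s).
  move=> mq hq; apply: (@itg_bounded _ _ (2 / dl * 2)); first exact: measurable_funM.
  move=> s _; have /andP[q0 q2] := hq s; rewrite ger0_norm; last exact: mulr_ge0.
  by apply: ler_pM.
have ig := bi _ mg g02.
have ipk := pk_itg (z1 _ r01).
have -> : imean (fun s => pk (r%:C * expi t) s * g s) - g t =
    imean (fun s => pk (r%:C * expi t) s * g s - g t * pk (r%:C * expi t) s).
  rewrite (imeanB ig (rintgZ (g t) ipk)) (imeanZ _ ipk) (imean_pk (z1 _ r01)).
  by rewrite mulr1.
have iabs := bi _ (mdevg t) (devg_le t).
have r'01 : 0 <= 1 - K * dl < 1.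
  by apply/andP; split; [move: Kdl; lra|rewrite ltrBlDr ltrDl mulr_gt0].
have ipk' := pk_itg (z1 _ r'01).
have iT := rintgD (rintgZ (16 / K) ipk') (rintgZ (2 / dl) ih).
have up : imean (fun s => pk (r%:C * expi t) s * devg t s) <=
   imean (fun s => 16 / K * pk ((1 - K * dl)%:C * expi t) s + 2 / dl * h s).
  apply: (le_imean iabs iT).
  move=> s; rewrite in_itv/= => sI.
  have /andP[v0 v2] := devg_le t s.
  have h0 : 0 <= h s by rewrite /h patchE; case: ifP.
  have pk'0 := pk_ge0 s (ltW (z1 _ r'01)).
  have [far|near] := leP (K * dl) (normc (expi s - expi t)).
    have hp := pk_compare r12 K1 Kdl far.
    apply: (@le_trans _ _ (16 / K * pk ((1 - K * dl)%:C * expi t) s)).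
      apply: le_trans (ler_pM _ _ hp v2) _ => //.
      by rewrite -/dl le_eqVlt; apply/orP; left; apply/eqP; ring.
    by rewrite lerDl mulr_ge0// divr_ge0// ltW.
  have sb : ball t eta s.
    rewrite /ball/= distrC ltr_pdivlMr// mulrC.
    exact: le_lt_trans (hc _ sI) near.
  rewrite -[leLHS]add0r; apply: lerD.
    by rewrite mulr_ge0// divr_ge0// ltW.
  by rewrite /h patchE mem_set// ler_wpM2r.
have tri : `|imean (fun s => pk (r%:C * expi t) s * g s - g t * pk (r%:C * expi t) s)| <=
    imean (fun s => pk (r%:C * expi t) s * devg t s).
  have i0 := rintgB ig (rintgZ (g t) ipk).
  rewrite ler_norml; apply/andP; split.
    rewrite -mulN1r -(imeanZ _ iabs); apply: (le_imean (rintgZ _ iabs) i0).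
    move=> s _; rewrite mulN1r [g t * _]mulrC -mulrBr -mulrN ler_wpM2l//.
    by rewrite /devg lerNl -normrN ler_norm.
  apply: (le_imean i0 iabs) => s _; rewrite [g t * _]mulrC -mulrBr ler_wpM2l//.
  by rewrite /devg ler_norm.
apply: le_lt_trans (le_trans tri up) _.
rewrite (imeanD (rintgZ (16 / K) ipk') (rintgZ (2 / dl) ih)) (imeanZ _ ipk') (imeanZ _ ih).
rewrite (imean_pk (z1 _ r'01)) mulr1.
have k1 : 16 / K < e / 2.
  rewrite ltr_pdivrMr//; have : 32 < e * K by rewrite /K mulrDr mulrC divfK ?gt_eqF//; lra.
  lra.
have k2 : 2 / dl * imean h <= e / 4.
  have m2 : imean h <= 2 * eta * b.
    apply: le_trans mh; have i0 : 0 <= imean h.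
      by apply: imean_ge0 => s _; rewrite /h patchE; case: ifP => // _; have /andP[] := devg_le t s.
    by rewrite ler_peMl//; have := pi_ge2 R; lra.
  apply: le_trans (ler_wpM2l _ m2) _; first by rewrite divr_ge0// ltW.
  have -> : 2 / dl * (2 * eta * b) = e / 4 by rewrite /eta /b; field; rewrite !gt_eqF.
  by [].
move: k1 k2; lra.
Qed.

End RadialLimits.

(** * Fatou's theorem for bounded analytic functions *)

Section FatouBounded.
Variable R : realType.
Notation mu := (@lebesgue_measure R).
Implicit Types (f : R[i] -> R[i]) (t r : R).

Definition rlim f t (l : R[i]) := forall e : R, 0 < e -> exists2 d : R, 0 < d &
  forall r, 1 - d < r < 1 -> normc (f (r%:C * expi t) - l) < e.

Let radial_real (u : R[i] -> R) :
  (forall rho w, 0 <= rho < 1 -> normc w < 1 ->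
    u (rho%:C * w) = imean (fun t => pk w t * u (rho%:C * expi t))) ->
  (forall rho : R, 0 <= rho < 1 -> continuous (fun t => u (rho%:C * expi t))) ->
  (forall z (e : R), disk z -> 0 < e -> exists2 d : R, 0 < d &
    forall w, normc (w - z) < d -> `|u w - u z| < e) ->
  (forall z, disk z -> 0 <= u z <= 2) ->
  {ae mu, forall t, 0 < t < 2 * pi -> exists l : R, forall e : R, 0 < e ->
     exists2 d : R, 0 < d & forall r, 1 - d < r < 1 -> `|u (r%:C * expi t) - l| < e}.
Proof.
move=> h1 h2 h3 h4; have [g [mg g02 ug]] := boundary_density h1 h2 h3 h4.
have lg : locally_integrable setT g.
  split; [exact: mg|exact: openT|move=> K _ cK].
  have mK : measurable (K : set (measurableTypeR R)) by exact: compact_measurable.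
  apply: (@le_lt_trans _ _ (\int[mu]_(x in K) (cst 2%:E x))%E).
    apply: ge0_le_integral => //.
    - apply/measurable_EFinP; apply: measurableT_comp => //.
      exact: measurable_funS mg.
    - move=> x _; rewrite lee_fin.
      by have /andP[g0 g2] := g02 x; rewrite ger0_norm.
  rewrite integral_cst//; apply: lte_mul_pinfty => //.
  exact: compact_finite_measure.
apply: (@filterS _ _ (ae_filter_ringOfSetsType mu)) (lebesgue_differentiation lg) => t lt t01.
exists (g t) => e e0; have [d d0 hd] := radial_lebesgue_pt mg g02 t01 lt e0.
exists (Num.min d 1); first by rewrite lt_min d0 ltr01.
move=> r /andP[r1 r2]; have r0 : 0 < r.
  by apply: le_lt_trans r1; rewrite subr_ge0 ge_min lexx orbT.
rewrite ug; last by rewrite normc_realM normc_expi mulr1 gtr0_norm.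
apply: hd; rewrite r2 andbT; apply: le_lt_trans r1.
by rewrite lerB// ge_min lexx.
Qed.

Lemma fatou_bounded f : analytic_on_disk f -> (forall z, disk z -> normc (f z) <= 1) ->
  {ae mu, forall t, 0 < t < 2 * pi -> exists l, rlim f t l}.
Proof.
move=> fa f1.
(* [p] stands for the real or the imaginary part; adding 1 brings [p (f z)] into [[0, 2]], and
   constants are their own Poisson integrals. *)
have shift (p : R[i] -> R) (fr : forall z w, `|p z - p w| <= normc (z - w))
    (pp : forall g z, anbhd g -> normc z < 1 ->
      p (g z) = imean (fun t => pk z t * p (g (expi t))))
    (p1 : forall z, `|p z| <= normc z) :
  {ae mu, forall t, 0 < t < 2 * pi -> exists l : R, forall e : R, 0 < e ->
     exists2 d : R, 0 < d & forall r, 1 - d < r < 1 -> `|p (f (r%:C * expi t)) - l| < e}.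
  have pc rho : 0 <= rho < 1 -> continuous (fun t => p (f (rho%:C * expi t))).
    move=> h t; have c := anbhd_rcont t (anbhd_dil h fa).
    apply/cvgrPdist_lt => e e0; have [d d0 hd] := rcontP c e0.
    apply: filterS (nbhsx_ballx t _ d0) => s; rewrite /ball/= distrC => /hd.
    by apply: le_lt_trans; rewrite distrC; exact: fr.
  have := @radial_real (fun z => p (f z) + 1).
  move=> /(_ _ _ _ _)-H.
  have H' : {ae mu, forall t, 0 < t < 2 * pi -> exists l : R, forall e : R, 0 < e ->
     exists2 d : R, 0 < d & forall r, 1 - d < r < 1 -> `|p (f (r%:C * expi t)) + 1 - l| < e}.
    apply: H.
    - move=> rho w h w1; rewrite (pp (dil rho f) w (anbhd_dil h fa) w1).
      have i1 : itg (fun t => pk w t * p (dil rho f (expi t))).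
        by apply: cont_itg => t; apply: continuousM; [exact: pk_cont|exact: pc].
      rewrite -[X in _ + X](imean_pk w1) -(imeanD i1 (pk_itg w1)).
      by apply: eq_imean => t _; rewrite mulrDr mulr1.
    - by move=> rho h t; apply: continuousD; [exact: pc|exact: cst_continuous].
    - move=> z e z1 e0; have [d d0 hd] := holo_ccont ((analytic_holo f).1 fa z z1) e0.
      exists d => // w /hd; apply: le_lt_trans.
      by rewrite opprD addrACA subrr addr0.
    - move=> z z1; have := le_trans (p1 (f z)) (f1 z z1).
      by rewrite ler_norml => /andP[? ?]; apply/andP; split; lra.
  apply: (@filterS _ _ (ae_filter_ringOfSetsType mu)) H' => t ht /ht[l hl].
  exists (l - 1) => e /hl[d d0 hd]; exists d => // r /hd.
  by congr (`|_| < e); ring.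
have hRe := shift (fun z => complex.Re z).
have hIm := shift (fun z => complex.Im z).
have aRe := hRe (fun z w => ltac:(by rewrite -ReN -ReD; exact: normc_Re))
   (@poisson_Re R) (@normc_Re R).
have aIm := hIm (fun z w => ltac:(by rewrite -ImN -ImD; exact: normc_Im))
   (@poisson_Im R) (@normc_Im R).
apply: (@filterS2 _ _ (ae_filter_ringOfSetsType mu)) aRe aIm => t h1 h2 t01.
have [a ha] := h1 t01; have [b hb] := h2 t01.
exists (a +i* b) => e e0; have e20 : 0 < e / 2 by rewrite divr_gt0.
have [d1 d10 hd1] := ha _ e20; have [d2 d20 hd2] := hb _ e20.
exists (Num.min d1 d2); first by rewrite lt_min d10.
move=> r /andP[r1 r2].
apply: le_lt_trans (normc_le_ReIm _) _; rewrite (splitr e) ReD ImD ReN ImN /=.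
apply: ltrD; [apply: hd1|apply: hd2]; rewrite r2 andbT; apply: le_lt_trans r1;
  by rewrite lerB// ge_min lexx ?orbT.
Qed.

End FatouBounded.

(** * Averages of Poisson integrals *)

Section PoissonAverage.
Variable R : realType.
Notation mu := (@lebesgue_measure R).
Implicit Types (A h : R -> R) (s t r : R).

Lemma itg_pkM A z : measurable_fun setT A -> itg A -> normc z < 1 ->
  itg (fun t => pk z t * A t).
Proof.
move=> mA iA z1.
have mpk : measurable_fun setT (pk z).
  by apply: continuous_measurable_fun => t; exact: pk_cont.
apply: (@le_integrable _ _ R mu (@circ R) _ _
   (fun t => ((2 / (1 - normc z))%:E * (A t)%:E)%E)) => //.
- exact: measurable_itv.
- by apply/measurable_EFinP; apply: measurable_funS (measurable_funM mpk mA).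
- move=> t _; rewrite -EFinM /= lee_fin normrM [X in _ <= X]normrM.
  apply: ler_wpM2r => //; rewrite ger0_norm; last exact: pk_ge0 (ltW z1).
  rewrite ger0_norm; first exact: pk_le.
  by rewrite divr_ge0// subr_ge0 ltW.
- exact: (rintgZ _ iA).
Qed.

(** Self-adjointness against the constant 1, which the Poisson operator fixes. *)
Lemma poisson_average A r : 0 <= r < 1 -> measurable_fun setT A ->
  (forall t, 0 <= A t) -> itg A ->
  itg (fun s => imean (fun t => pk (r%:C * expi s) t * A t)) /\
  imean (fun s => imean (fun t => pk (r%:C * expi s) t * A t)) = imean A.
Proof.
move=> r01 mA A0 iA.
have z1 s : normc (r%:C * expi s) < 1.
  by move: r01 => /andP[r0 r1]; rewrite normc_realM normc_expi mulr1 ger0_norm.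
have ipA s := itg_pkM mA iA (z1 s).
set A' := fun s => imean (fun t => pk (r%:C * expi s) t * A t).
have mA' : measurable_fun setT A'.
  pose f (x : R * R) : \bar R := (pk (r%:C * expi x.1) x.2 * A x.2 * \1_(@circ R) x.2)%:E.
  have mf : measurable_fun setT f.
    apply/measurable_EFinP; apply: measurable_funM; last first.
      by apply: (@measurableT_comp _ _ _ _ _ _ (\1_(@circ R) : R -> R)) => //;
        apply: measurable_indic; exact: measurable_itv.
    apply: measurable_funM; first exact: measurable_pk.
    exact: (@measurableT_comp _ _ _ _ _ _ A).
  have f0 x : (0 <= f x)%E.
    rewrite lee_fin; apply: mulr_ge0; last by rewrite indicE ler0n.
    by apply: mulr_ge0 => //; exact: pk_ge0 (ltW (z1 _)).
  have := @measurable_fun_fubini_tonelli_F _ _ _ _ R mu f mf f0.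
  have -> : fubini_F mu f = (fun s => (2 * pi * A' s)%:E).
    apply/funext => s; rewrite /fubini_F -eint_itg// [RHS]integral_mkcond.
    apply: eq_integral => t _; rewrite /f /= patchE indicE.
    by case: ifP => _; rewrite ?mulr1 ?mulr0.
  move=> /measurable_EFinP m2.
  have -> : A' = (fun s => (2 * pi)^-1 * (2 * pi * A' s)).
    by apply/funext => s; rewrite mulKf// gt_eqF ?twopi_gt0.
  by apply: measurable_funM.
have A'0 s : 0 <= A' s.
  by apply: imean_ge0 => t _; apply: mulr_ge0 => //; exact: pk_ge0 (ltW (z1 _)).
have iA' : itg A'.
  apply: (@itg_bounded _ _ (2 / (1 - r) * imean A)) => // s _; rewrite ger0_norm//.
  rewrite -imeanZ//; apply: le_imean => //; first exact: (rintgZ _ iA).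
  move=> t _; rewrite ler_wpM2r//; apply: le_trans (pk_le t (z1 s)) _.
  by rewrite normc_realM normc_expi mulr1 ger0_norm//; case/andP: r01.
split => //.
have := @imean_swap R A (fun=> 1) A' (fun=> 1) r r01 mA (measurable_cst _) A0.
have E (h : R -> R) : imean (fun t => h t * 1) = imean h by apply: eq_imean => t _; rewrite mulr1.
have F : (fun t => A t * 1) = A by apply/funext => t; rewrite mulr1.
have F' : (fun t => A' t * 1) = A' by apply/funext => t; rewrite mulr1.
rewrite F F'; apply => //.
- by move=> s; rewrite (_ : (fun t => _) = pk (r%:C * expi s)); [exact: pk_itg|
    by apply/funext => t; rewrite mulr1].
- by move=> s; rewrite E imean_pk.
Qed.

(** A quantitative form of the continuity of the Poisson integral up to the circle: the mean of
    [|expi t - w|] against the kernel is at most the square root of [1 - |w|^2]. *)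
Lemma poisson_lipschitz (H : R[i] -> R) (L : R) w : 0 <= L -> normc w < 1 ->
  continuous (fun t => H (expi t)) ->
  (forall t, H w - H (expi t) <= L * normc (expi t - w)) ->
  H w - L * Num.sqrt (1 - normc w ^+ 2) <= imean (fun t => pk w t * H (expi t)).
Proof.
move=> L0 w1 Hc hL; pose a := Num.sqrt (1 - normc w ^+ 2).
have w2 : 0 < 1 - normc w ^+ 2 by rewrite subr_gt0 expr_lt1// normc_ge0.
have a0 : 0 < a by rewrite sqrtr_gt0.
have a2 : a ^+ 2 = 1 - normc w ^+ 2 by rewrite sqr_sqrtr// ltW.
have ip := pk_itg w1.
have iH : itg (fun t => pk w t * H (expi t)).
  by apply: cont_itg => t; apply: continuousM; [exact: pk_cont|exact: Hc].
have -> : H w - L * a = imean (fun t => (H w - L * (a / 2)) * pk w t - L * (a / 2)).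
  rewrite (imeanB (rintgZ _ ip) (rintg_cst _ _ _)) (imeanZ _ ip) (imean_pk w1) imean_cst.
  by field.
apply: (le_imean (rintgB (rintgZ _ ip) (rintg_cst _ _ _)) iH) => t _.
set x := normc (expi t - w).
have x0 : 0 < x by rewrite normc_gt0 expi_sub_neq0.
have pE : pk w t = a ^+ 2 / x ^+ 2 by rewrite a2.
have p0 := pk_ge0 t (ltW w1).
(* AM-GM: [2 x <= a + x^2 / a], integrated against the kernel *)
have key : pk w t * x <= pk w t * (a / 2) + a / 2.
  rewrite pE; rewrite -subr_ge0.
  have -> : a ^+ 2 / x ^+ 2 * (a / 2) + a / 2 - a ^+ 2 / x ^+ 2 * x =
     a / 2 * (a / x - 1) ^+ 2 by field; rewrite gt_eqF.
  by rewrite mulr_ge0 ?sqr_ge0// divr_ge0// ltW.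
have h1 := ler_wpM2l p0 (hL t); rewrite -/x in h1.
have h2 := ler_wpM2l L0 key.
by move: h1 h2; nra.
Qed.

End PoissonAverage.

(** * Herglotz integrals and moment inequalities *)

Section Herglotz.
Variable R : realType.
Implicit Types (h : R -> R) (f G : R[i] -> R[i]) (z w : R[i]) (r t : R).

(** The kernel [2 * cauchyk z t - 1] is [(zeta + z) / (zeta - z)] at [zeta = expi t], whose real
    part is the Poisson kernel. *)
Definition herglotz h z : R[i] :=
  2 * cauchyint (fun t => (h t)%:C) z - (imean h)%:C.

Let rc h : continuous h -> forall t, rcont (fun t => (h t)%:C) t.
Proof. by move=> hc t; apply: rcont_real; exact: hc. Qed.

Lemma herglotz_analytic h : continuous h -> analytic_on_disk (herglotz h).
Proof.
move=> hc; apply/analytic_holo => z z1.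
have c := (analytic_holo _).1 (cauchyint_analytic (rc hc)) z z1.
exact: (holoB (holoM (holo_cst 2 z) c) (holo_cst (imean h)%:C z)).
Qed.

Lemma conj_cauchyk z t : conjc (cauchyk z t) = (1 - conjc z * expi t)^-1.
Proof.
rewrite /cauchyk rmorphM /= conjc_inv rmorphB/=.
rewrite -[X in X / _]invrK -invfM; congr (_^-1).
have -> : (conjc (expi t))^-1 = expi t.
  apply: (mulIf (x := conjc (expi t))); first by rewrite -normc_gt0 normc_conj normc_expi.
  by rewrite mulVf ?expi_mul_conj// -normc_gt0 normc_conj normc_expi.
by rewrite mulrBr expi_mul_conj [expi t * conjc z]mulrC.
Qed.

Lemma Re_herglotz_kernel z t : normc z < 1 ->
  2 * complex.Re (cauchyk z t) - 1 = pk z t.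
Proof.
move=> z1; have E := pkE t z1.
have n0 : 1 - conjc z * expi t != 0.
  rewrite subr_eq0; apply/eqP => e; have := normc1 R.
  by rewrite e normcM normc_conj normc_expi mulr1 => h; move: z1; rewrite h ltxx.
have E2 : (pk z t)%:C = cauchyk z t + conjc (cauchyk z t) - 1.
  by rewrite E conj_cauchyk; field.
have := congr1 (fun x => complex.Re x) E2.
rewrite !ReD Re_conj ReN /= => ->; lra.
Qed.

Lemma Re_herglotz h z : continuous h -> normc z < 1 ->
  complex.Re (herglotz h z) = imean (fun t => pk z t * h t).
Proof.
move=> hc z1.
have kc t : rcont (cauchyk z) t by exact: rcont_cauchyk.
have i1 : itg (fun t => h t * complex.Re (cauchyk z t)).
  by apply: cont_itg => t; apply: continuousM; [exact: hc|exact: (kc t).1].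
have ih : itg h by exact: cont_itg.
have Re2 w : complex.Re (2 * w) = 2 * complex.Re w by rewrite !mulr_natl !mulr2n ReD.
rewrite /herglotz ReD ReN Re2 Re_cmean.
have -> : imean (fun t => complex.Re ((h t)%:C * cauchyk z t)) =
   imean (fun t => h t * complex.Re (cauchyk z t)).
  by apply: eq_imean => t _; rewrite ReZ.
rewrite -(imeanZ 2 i1) -(imeanB (rintgZ 2 i1) ih); apply: eq_imean => t _.
by rewrite -(Re_herglotz_kernel t z1); ring.
Qed.

Lemma herglotz0 h : continuous h -> herglotz h 0 = (imean h)%:C.
Proof.
move=> hc; have k0 t : cauchyk 0 t = 1 :> R[i].
  by rewrite /cauchyk subr0 divff// expi_neq0.
rewrite /herglotz /cauchyint.
have -> : (fun t => (h t)%:C * cauchyk 0 t) = (fun t => (h t)%:C).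
  by apply/funext => t; rewrite k0 mulr1.
have -> : cmean (fun t => (h t)%:C) = (imean h)%:C.
  by apply: complexP; rewrite ?Re_cmean ?Im_cmean//; exact: (imean_cst 0).
by rewrite mulr_natl mulr2n addrK.
Qed.

Lemma normc_herglotz h z : continuous h -> (forall t, 0 <= h t) -> normc z < 1 ->
  normc (herglotz h z) <= 3 / (1 - normc z) * imean h.
Proof.
move=> hc h0 z1; have ih : itg h by exact: cont_itg.
have i0 : 0 <= imean h by apply: imean_ge0 => t _.
have d0 : 0 < 1 - normc z by rewrite subr_gt0.
have h1 : normc (cauchyint (fun t => (h t)%:C) z) <= (1 - normc z)^-1 * imean h.
  rewrite -(imeanZ _ ih); apply: normc_cmean_le.
  - by apply: rcont_ctg => t; apply: rcontM; [exact: rc|exact: rcont_cauchyk].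
  - exact: (rintgZ _ ih).
  - move=> t _; rewrite normc_realM ger0_norm// mulrC ler_wpM2r//.
    exact: normc_cauchyk.
rewrite /herglotz; apply: le_trans (normcB _ _) _.
rewrite normcM normc_real (ger0_norm i0).
have -> : normc (2 : R[i]) = 2.
  by rewrite -(rmorph_nat (real_complex R) 2) normc_real ger0_norm.
have h2 : 1 <= (1 - normc z)^-1 by rewrite invf_ge1//; have := normc_ge0 z; lra.
have h3 := ler_wpM2r i0 h2.
by move: h1 h3; lra.
Qed.

Lemma moment_mean G r n : analytic_on_disk G -> 0 <= r < 1 ->
  imean (fun t => complex.Re (G (r%:C * expi t) ^+ n)) = complex.Re (G 0 ^+ n).
Proof.
move=> Ga r01.
have Gna : analytic_on_disk (fun z => G z ^+ n).
  by apply/analytic_holo => z z1; exact: (holoX n ((analytic_holo _).1 Ga z z1)).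
have := mean_value (anbhd_dil r01 Gna).
by rewrite /dil mulr0 => /(congr1 (fun z => complex.Re z)); rewrite Re_cmean.
Qed.

Let Re_pow_real (z : R[i]) n : complex.Im z = 0 -> complex.Re (z ^+ n) = complex.Re z ^+ n.
Proof.
move=> z0; have -> : z = (complex.Re z)%:C by apply: complexP.
by rewrite -rmorphXn.
Qed.

Let Re_cont G r : analytic_on_disk G -> 0 <= r < 1 ->
  continuous (fun t => complex.Re (G (r%:C * expi t))).
Proof. by move=> Ga r01 t; have [] := anbhd_rcont t (anbhd_dil r01 Ga). Qed.

Lemma pow_cont (h : R -> R) n : continuous h -> continuous (fun t => h t ^+ n).
Proof.
move=> hc; elim: n => [|n ih] t; first exact: cst_continuous.
by apply: cont_ext (continuousM (hc t) (ih t)) => s /=; rewrite exprS.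
Qed.

Lemma Re_pow_itg G r n : analytic_on_disk G -> 0 <= r < 1 ->
  itg (fun t => complex.Re (G (r%:C * expi t)) ^+ n).
Proof. by move=> Ga r01; apply: cont_itg; apply: pow_cont; exact: Re_cont. Qed.

Lemma normc_pow_itg G r n : analytic_on_disk G -> 0 <= r < 1 ->
  itg (fun t => normc (G (r%:C * expi t)) ^+ n).
Proof. by move=> Ga r01; apply: cont_itg; apply: pow_cont; exact: dil_cont. Qed.

Let RePow_itg G r n : analytic_on_disk G -> 0 <= r < 1 ->
  itg (fun t => complex.Re (G (r%:C * expi t) ^+ n)).
Proof.
move=> Ga r01; have Gna : analytic_on_disk (fun z => G z ^+ n).
  by apply/analytic_holo => z z1; exact: (holoX n ((analytic_holo _).1 Ga z z1)).
exact: cont_itg (Re_cont Gna r01).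
Qed.

(** Integrate [|w|^2 = 2 (Re w)^2 - Re w^2] at [w = G]: the last term has mean [Re (G 0)^2],
    nonnegative because [G 0] is real. *)
Lemma moment2 G r : analytic_on_disk G -> complex.Im (G 0) = 0 -> 0 <= r < 1 ->
  imean (fun t => normc (G (r%:C * expi t)) ^+ 2) <=
  2 * imean (fun t => complex.Re (G (r%:C * expi t)) ^+ 2).
Proof.
move=> Ga G0 r01.
have i1 := Re_pow_itg 2 Ga r01; have i2 := RePow_itg 2 Ga r01.
have -> : imean (fun t => normc (G (r%:C * expi t)) ^+ 2) =
  imean (fun t => 2 * complex.Re (G (r%:C * expi t)) ^+ 2 - complex.Re (G (r%:C * expi t) ^+ 2)).
  by apply: eq_imean => t _; rewrite normc_sqr expr2 ReM; ring.
rewrite (imeanB (rintgZ 2 i1) i2) (imeanZ 2 i1) moment_mean// Re_pow_real//.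
by rewrite gerBl sqr_ge0.
Qed.

(* M. Riesz's inequality for the exponent 6: [|w|^6 + 2 Re w^6] is at most
   [5327 (Re w)^6] because [y^3 - 33 x y^2 + 5324 x^3 = (y - 22 x)^2 (y + 11 x)]. *)
Lemma moment6 G r : analytic_on_disk G -> complex.Im (G 0) = 0 -> 0 <= r < 1 ->
  imean (fun t => normc (G (r%:C * expi t)) ^+ 6) <=
  5327 * imean (fun t => complex.Re (G (r%:C * expi t)) ^+ 6).
Proof.
move=> Ga G0 r01.
have i1 := Re_pow_itg 6 Ga r01; have i2 := RePow_itg 6 Ga r01.
apply: (@le_trans _ _ (imean (fun t => 5327 * complex.Re (G (r%:C * expi t)) ^+ 6 -
   2 * complex.Re (G (r%:C * expi t) ^+ 6)))).
  apply: (le_imean (normc_pow_itg 6 Ga r01) (rintgB (rintgZ _ i1) (rintgZ _ i2))).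
  move=> t _; case: (G _) => a b.
  have -> : normc (a +i* b) ^+ 6 = (a ^+ 2 + b ^+ 2) ^+ 3.
    by rewrite (exprM _ 2 3) normc_sqr.
  have -> : complex.Re ((a +i* b) ^+ 6) =
      a ^+ 6 - 15 * a ^+ 4 * b ^+ 2 + 15 * a ^+ 2 * b ^+ 4 - b ^+ 6.
    rewrite !exprS expr0 !(ReM, ImM) /=; ring.
  rewrite /= -subr_ge0.
  have -> : 5327 * a ^+ 6 -
      2 * (a ^+ 6 - 15 * a ^+ 4 * b ^+ 2 + 15 * a ^+ 2 * b ^+ 4 - b ^+ 6) -
      (a ^+ 2 + b ^+ 2) ^+ 3 =
      (b ^+ 2 - 22 * a ^+ 2) ^+ 2 * (b ^+ 2 + 11 * a ^+ 2) + 27 * (a ^+ 4 * b ^+ 2) by ring.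
  have a4 : 0 <= a ^+ 4 by rewrite exprn_even_ge0.
  apply: addr_ge0; last by apply: mulr_ge0 => //; apply: mulr_ge0 => //; exact: sqr_ge0.
  apply: mulr_ge0; first exact: sqr_ge0.
  by apply: addr_ge0; [exact: sqr_ge0|apply: mulr_ge0 => //; exact: sqr_ge0].
rewrite (imeanB (rintgZ _ i1) (rintgZ _ i2)) (imeanZ _ i1) (imeanZ _ i2).
rewrite moment_mean// Re_pow_real// gerBl mulr_ge0// (exprM _ 2 3).
by rewrite exprn_ge0// sqr_ge0.
Qed.

Lemma expr_tangent (m x : R) n : 0 <= m -> 0 <= x ->
  m ^+ n.+1 + n.+1%:R * m ^+ n * (x - m) <= x ^+ n.+1.
Proof.
move=> m0 x0; elim: n => [|n ih]; first by rewrite !expr1 expr0; lra.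
have h := ler_wpM2l x0 ih.
rewrite (exprS x n.+1); apply: le_trans h.
have q : 0 <= m ^+ n * (n.+1%:R * (x - m) ^+ 2).
  by rewrite mulr_ge0 ?exprn_ge0// mulr_ge0// sqr_ge0.
rewrite -subr_ge0; apply: le_trans q _; rewrite le_eqVlt; apply/orP; left; apply/eqP.
rewrite (exprS m n.+1) (exprS m n) -[n.+2%:R]natr1; ring.
Qed.

(** The tangent line of the power at the mean value, integrated against the kernel of mass 1. *)
Lemma pk_jensen h z n : normc z < 1 -> (forall t, 0 <= h t) ->
  itg (fun t => pk z t * h t) -> itg (fun t => pk z t * h t ^+ n.+1) ->
  imean (fun t => pk z t * h t) ^+ n.+1 <= imean (fun t => pk z t * h t ^+ n.+1).
Proof.
move=> z1 h0 i1 i2; set m := imean _.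
have p0 t : 0 <= pk z t by apply: pk_ge0; exact: ltW.
have m0 : 0 <= m by apply: imean_ge0 => t _; rewrite mulr_ge0.
pose c := m ^+ n.+1 - n.+1%:R * m ^+ n * m; pose d := n.+1%:R * m ^+ n.
have ip : itg (pk z) := pk_itg z1.
have -> : m ^+ n.+1 = imean (fun t => c * pk z t + d * (pk z t * h t)).
  rewrite (imeanD (rintgZ c ip) (rintgZ d i1)) (imeanZ c ip) (imeanZ d i1) imean_pk//.
  rewrite -/m /c /d; ring.
apply: (le_imean (rintgD (rintgZ c ip) (rintgZ d i1)) i2) => t _.
have := ler_wpM2l (p0 t) (expr_tangent n m0 (h0 t)).
by apply: le_trans; rewrite le_eqVlt; apply/orP; left; apply/eqP; rewrite /c /d; ring.
Qed.

End Herglotz.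

(** * An analytic majorant for functions of H^1 *)

Section ZygmundMajorant.
Variable R : realType.
Implicit Types (z w : R[i]) (r t : R).
Variables (f : R[i] -> R[i]) (A : R).
Hypothesis fa : analytic_on_disk f.
Hypothesis fA : forall r, 0 < r < 1 -> pmean 1 r f <= A.

(** The root makes the mean squares bounded when [f] is in H^1. The added 1 keeps it Lipschitz in
    [|f|] and gives the Herglotz integral a real part at least 1, so that division by it is
    possible. *)
Definition zyg (rho : R) w : R := Num.sqrt (1 + normc (f (rho%:C * w))).

Lemma sqrt1_lip (a b : R) : 0 <= a -> 0 <= b ->
  Num.sqrt (1 + a) - Num.sqrt (1 + b) <= `|a - b|.
Proof.
move=> a0 b0; have pa : 0 <= 1 + a by lra. have pb : 0 <= 1 + b by lra.
have ea := sqr_sqrtr pa; have eb := sqr_sqrtr pb.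
have p1 : 1 <= Num.sqrt (1 + a) by rewrite -[leLHS]sqrtr1 ler_wsqrtr//; lra.
have q1 : 1 <= Num.sqrt (1 + b) by rewrite -[leLHS]sqrtr1 ler_wsqrtr//; lra.
move: (Num.sqrt (1 + a)) (Num.sqrt (1 + b)) ea eb p1 q1 => p q ea eb p1 q1.
have -> : a - b = p ^+ 2 - q ^+ 2 by rewrite ea eb; ring.
have [pq|pq] := leP p q; first by apply: le_trans (normr_ge0 _); lra.
by apply: le_trans (ler_norm _); nra.
Qed.

Lemma zyg_ge1 rho w : 1 <= zyg rho w.
Proof. by rewrite /zyg -[leLHS]sqrtr1 ler_wsqrtr// lerDl normc_ge0. Qed.

Lemma zyg_sqr rho w : zyg rho w ^+ 2 = 1 + normc (f (rho%:C * w)).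
Proof. by rewrite sqr_sqrtr// addr_ge0// normc_ge0. Qed.

Lemma zyg_cont rho : 0 <= rho < 1 -> continuous (fun t => zyg rho (expi t)).
Proof.
move=> r01 t; have c := @dil_cont R f rho fa r01 t.
apply/cvgrPdist_lt => e e0; move/cvgrPdist_lt : c => /(_ e e0).
apply: filterS => s; apply: le_lt_trans.
rewrite ler_norml; apply/andP; split; last exact: sqrt1_lip (normc_ge0 _) (normc_ge0 _).
by rewrite lerNl opprB distrC; exact: sqrt1_lip (normc_ge0 _) (normc_ge0 _).
Qed.

Let f1 r : 0 < r < 1 -> imean (fun t => normc (f (r%:C * expi t))) <= A.
Proof.
move=> r01; apply: le_trans (fA r01); rewrite le_eqVlt; apply/orP; left; apply/eqP.
by apply: eq_imean => t _; rewrite powRr1// normc_ge0.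
Qed.

Let A_ge0 : 0 <= A.
Proof.
by apply: le_trans (pmean_ge0 1 2^-1 f) (fA _); rewrite invr_gt0 ltr0n /= invf_lt1// ltr1n.
Qed.

Lemma zyg_sq_mean rho : 0 < rho < 1 ->
  itg (fun t => zyg rho (expi t) ^+ 2) /\ imean (fun t => zyg rho (expi t) ^+ 2) <= 1 + A.
Proof.
move=> r01; have r01' : 0 <= rho < 1 by case/andP: r01 => /ltW -> ->.
have i1 : itg (fun t => normc (f (rho%:C * expi t))) by apply: cont_itg; exact: dil_cont.
have -> : (fun t => zyg rho (expi t) ^+ 2) = (fun t => 1 + normc (f (rho%:C * expi t))).
  by apply/funext => t; rewrite zyg_sqr.
split; first exact: (rintgD (rintg_cst _ _ _) i1).
by rewrite (imeanD (rintg_cst _ _ _) i1) imean_cst lerD2l f1.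
Qed.

Lemma zyg_mean rho : 0 < rho < 1 -> imean (fun t => zyg rho (expi t)) <= 1 + A.
Proof.
move=> r01; have [i1] := zyg_sq_mean r01; apply: le_trans.
have r01' : 0 <= rho < 1 by case/andP: r01 => /ltW -> ->.
apply: (le_imean (cont_itg (zyg_cont r01')) i1) => t _.
by rewrite expr2 ler_peMl ?zyg_ge1// (le_trans ler01)// zyg_ge1.
Qed.

Let G rho := herglotz (fun t => zyg rho (expi t)).

Let G_analytic rho : 0 <= rho < 1 -> analytic_on_disk (G rho).
Proof. by move=> r01; apply: herglotz_analytic; exact: zyg_cont. Qed.

Let ReG rho z : 0 <= rho < 1 -> normc z < 1 ->
  complex.Re (G rho z) = imean (fun t => pk z t * zyg rho (expi t)).
Proof. by move=> r01 z1; apply: Re_herglotz => //; exact: zyg_cont. Qed.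

Let ReG_ge1 rho z : 0 <= rho < 1 -> normc z < 1 -> 1 <= complex.Re (G rho z).
Proof.
move=> r01 z1; rewrite ReG// -(imean_pk z1); apply: le_imean; first exact: pk_itg.
  by apply: cont_itg => t; apply: continuousM; [exact: pk_cont|exact: zyg_cont].
by move=> t _; rewrite ler_peMr ?zyg_ge1// pk_ge0// ltW.
Qed.

Let fbound r : 0 <= r < 1 -> exists2 M, 0 <= M & forall z, normc z <= r -> normc (f z) <= M.
Proof.
move=> /andP[r0 r1]; have A1 : 0 < A + 1 by have := A_ge0; lra.
exists (2 * (2 * (A + 1) / (1 - r))).
  by rewrite mulr_ge0// divr_ge0 ?mulr_ge0 ?(ltW A1)// subr_ge0 ltW.
move=> z zr; have z1 : disk z by exact: le_lt_trans r1.
have z1' : normc z < 1 by [].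
apply: le_trans (@growth R 1 f (A + 1) z (lexx _) fa A1 _ z1) _.
  by move=> s s01; apply: le_trans (fA s01) _; rewrite lerDl.
have q0 : 0 <= 2 * (A + 1) by rewrite mulr_ge0// ltW.
rewrite invr1 powRr1; last by rewrite divr_ge0// subr_ge0 ltW.
by rewrite ler_wpM2l// ler_wpM2l// lef_pV2 ?posrE ?subr_gt0// lerB.
Qed.

Let flip rho : 0 <= rho < 1 -> exists2 L, 0 <= L &
  forall z w, normc z <= 1 -> normc w <= 1 ->
    normc (f (rho%:C * z) - f (rho%:C * w)) <= L * normc (z - w).
Proof.
move=> r01; have /andP[r0 r1] := r01.
have rr1 : 0 <= (1 + rho) / 2 < 1 by apply/andP; split; lra.
have [C C0 hC] := analytic_quad r01.
have [M M0 hM] := fbound rr1.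
have CM : 0 <= C * M by rewrite mulr_ge0.
exists (3 * (C * M)); first by rewrite mulr_ge0.
move=> z w z1 w1.
have le v : normc v <= 1 -> normc (rho%:C * v) <= rho.
  by move=> v1; rewrite normc_realM ger0_norm// ler_piMr.
have [D [D1 D2]] := hC f M fa hM _ (le _ w1).
have := D2 _ (le _ z1).
have -> : rho%:C * z - rho%:C * w = rho%:C * (z - w) by ring.
rewrite normc_realM (ger0_norm r0) => h.
have n0 := normc_ge0 (z - w).
have n2 : normc (z - w) <= 2 by apply: le_trans (normcB _ _) _; lra.
rewrite -[X in normc X](subrK (D * (rho%:C * (z - w)))).
apply: le_trans (normcD _ _) _; rewrite normcM normc_realM (ger0_norm r0).
have e1 : rho * normc (z - w) <= normc (z - w) by rewrite ler_piMl// ltW.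
have e0 : 0 <= rho * normc (z - w) by rewrite mulr_ge0.
have h2 : C * M * (rho * normc (z - w)) ^+ 2 <= C * M * (2 * normc (z - w)).
  rewrite ler_wpM2l// expr2; apply: ler_pM => //; exact: le_trans e1 n2.
have h3 : normc D * (rho * normc (z - w)) <= C * M * normc (z - w).
  by apply: ler_pM => //; exact: normc_ge0.
move: h h2 h3; lra.
Qed.

(** Near the circle the Poisson integral of [zyg] is at least [zyg - 1 / 2], hence at least half of
    [zyg] because [zyg >= 1]. Squaring gives the factor 4. *)
Let majorant_near rho : 0 <= rho < 1 -> exists2 r0 : R, 0 < r0 < 1 &
  forall r t, r0 <= r < 1 -> normc (f (rho%:C * (r%:C * expi t))) <=
    4 * normc (G rho (r%:C * expi t)) ^+ 2.
Proof.
move=> r01; have [L L0 hL] := flip r01.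
have L1 : 0 < (L + 1) ^+ 2 by rewrite exprn_gt0//; lra.
(* For [1 - r <= e] one has [1 - r^2 <= 2 e], the square of [1 / (2 (L + 1))], so the Lipschitz
   error is at most one half. *)
pose e := (8 * (L + 1) ^+ 2)^-1.
have e0 : 0 < e by rewrite invr_gt0 mulr_gt0.
exists (Num.max 2^-1 (1 - e)).
  by rewrite lt_max invr_gt0 ltr0n /= gt_max invf_lt1 ?ltr1n//= ltrBlDr ltrDl.
move=> r t /andP[]; rewrite ge_max => /andP[rh re] r1.
have r0 : 0 <= r by apply: le_trans rh; rewrite invr_ge0.
set w := r%:C * expi t.
have nw : normc w = r by rewrite normc_realM normc_expi mulr1 ger0_norm.
have w1 : normc w < 1 by rewrite nw.
have lip s : zyg rho w - zyg rho (expi s) <= L * normc (expi s - w).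
  apply: le_trans (sqrt1_lip (normc_ge0 _) (normc_ge0 _)) _.
  apply: le_trans (normc_dist _ _) _; rewrite (normc_sub (expi s)); apply: hL.
    exact: ltW.
  by rewrite normc_expi.
have := poisson_lipschitz L0 w1 (zyg_cont r01) lip.
rewrite -ReG// nw.
have sq : L * Num.sqrt (1 - r ^+ 2) <= 2^-1.
  have h1 : 1 - r ^+ 2 <= (2 * (L + 1)) ^- 2.
    have -> : (2 * (L + 1)) ^- 2 = 2 * e by rewrite /e; field; lra.
    by move: re r0 r1; nra.
  have h2 := ler_wsqrtr h1.
  have q0 : 0 <= (2 * (L + 1))^-1 by rewrite invr_ge0 mulr_ge0//; lra.
  rewrite -exprVn sqrtr_sqr ger0_norm// in h2.
  apply: le_trans (ler_wpM2l L0 h2) _.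
  by rewrite ler_pdivrMr ?mulr_gt0//; lra.
have z1 := zyg_ge1 rho w; move=> hG.
have : zyg rho w <= 2 * complex.Re (G rho w) by move: hG sq z1; lra.
move=> h; have R0 : 0 <= complex.Re (G rho w) by move: h z1; lra.
have h4 : zyg rho w ^+ 2 <= 4 * normc (G rho w) ^+ 2.
  have -> : 4 * normc (G rho w) ^+ 2 = (2 * normc (G rho w)) ^+ 2 by rewrite exprMn; ring.
  rewrite lerXn2r ?nnegrE ?mulr_ge0 ?normc_ge0//; first exact: le_trans ler01 z1.
  by apply: le_trans h _; rewrite ler_wpM2l// Re_le_normc.
by apply: le_trans h4; rewrite zyg_sqr lerDr.
Qed.

Let ReG_neq0 (F : R[i] -> R[i]) z : 1 <= complex.Re (F z) -> F z != 0.
Proof.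
by move=> h; apply/eqP => e; move: h; rewrite e /= ler10.
Qed.

Let majorant rho z : 0 <= rho < 1 -> disk z ->
  normc (f (rho%:C * z)) <= 4 * normc (G rho z) ^+ 2.
Proof.
move=> r01 z1; have z1' : normc z < 1 by [].
have [r0 /andP[r00 r01'] h] := majorant_near r01.
pose q w := f (rho%:C * w) * (G rho w * G rho w)^-1.
have Gn w : normc w < 1 -> G rho w != 0 by move=> w1; apply: ReG_neq0; exact: ReG_ge1.
have qa : analytic_on_disk q.
  apply/analytic_holo => w w1; have w1' : normc w < 1 by [].
  have Ga := (analytic_holo _).1 (G_analytic r01) w w1.
  apply: (holoM (f := fun w => f (rho%:C * w))).
    apply: (@holo_comp _ (fun w => rho%:C * w) f).
      exact: (holoM (holo_cst rho%:C w) (holo_id w)).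
    by apply: ((analytic_holo _).1 fa); apply: disk_dil => //; exact: ltW.
  apply: (holoV (f := fun w => G rho w * G rho w)); first by rewrite mulf_neq0 ?Gn.
  exact: (holoM Ga Ga).
pose r := Num.max r0 ((1 + normc z) / 2).
have rr0 : r0 <= r by rewrite le_max lexx.
have r1 : r < 1 by rewrite gt_max r01' /=; lra.
have rz : normc z < r by apply: (@lt_le_trans _ _ ((1 + normc z) / 2)); [lra|rewrite le_max lexx orbT].
have rp : 0 < r by exact: lt_le_trans rr0.
have rc0 : r%:C != 0 by rewrite eq_complex /= gt_eqF.
have qb : normc (q z) <= 4.
  have -> : z = r%:C * (r^-1%:C * z) by rewrite fmorphV mulVKf.
  apply: (@max_principle R (dil r q)).
  - by apply: anbhd_dil => //; rewrite (ltW rp).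
  - move=> t; rewrite /dil /q normcM normcV normcM.
    have w1 : normc (r%:C * expi t) < 1 by rewrite normc_realM normc_expi mulr1 gtr0_norm.
    rewrite ler_pdivrMr ?mulr_gt0 ?normc_gt0 ?Gn// -expr2.
    by apply: h; rewrite rr0.
  - by rewrite normc_realM gtr0_norm ?invr_gt0// mulrC ltr_pdivrMr// mul1r.
move: qb; rewrite /q normcM normcV normcM ler_pdivrMr ?mulr_gt0 ?normc_gt0 ?Gn//.
Qed.

Definition zrho (k : nat) : R := 1 - k.+2%:R^-1.

Lemma zrho01 k : 0 < zrho k < 1.
Proof.
rewrite /zrho subr_gt0 invf_lt1 ?ltr0n// ltr1n /= ltrBlDr ltrDl invr_gt0 ltr0n//.
Qed.

Lemma zrho_near (e : R) : 0 < e -> \forall k \near \oo, 1 - zrho k < e.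
Proof.
move=> e0; exists (Num.truncn e^-1) => // k /= hk.
rewrite /zrho subKr invf_plt ?posrE ?ltr0n//.
by apply: lt_trans (truncnS_gt _) _; rewrite ltr_nat !ltnS.
Qed.

(* On the circle the Herglotz integral of [zyg] majorizes [f_rho] because its real
   part is [zyg] itself; the maximum principle for [f_rho / G_rho ^+ 2] carries
   this into the disk. *)
Theorem zygmund : exists H : R[i] -> R[i], [/\
  analytic_on_disk H /\ forall r, 0 <= r < 1 ->
    imean (fun t => normc (H (r%:C * expi t)) ^+ 2) <= 4 * (1 + A) + 2,
  forall z, disk z -> 1 <= complex.Re (H z),
  forall z, disk z -> normc (f z) <= 4 * normc (H z) ^+ 2,
  complex.Im (H 0) = 0 &
  forall z b, disk z ->
    (\forall k \near \oo, imean (fun t => pk z t * zyg (zrho k) (expi t)) <= b) ->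
    complex.Re (H z) <= b].
Proof.
have [U [UU Uoo]] := ultraFilterLemma (_ : ProperFilter \oo).
have r01 k : 0 <= zrho k < 1 by have /andP[/ltW -> ->] := zrho01 k.
pose F k := G (zrho k).
have Fb k z : normc z < 1 -> normc (F k z) <= 3 / (1 - normc z) * (1 + A).
  move=> z1; apply: le_trans (normc_herglotz (zyg_cont (r01 k)) _ z1) _.
    by move=> t; exact: le_trans ler01 (zyg_ge1 _ _).
  rewrite ler_wpM2l ?divr_ge0// ?subr_ge0 ?(ltW z1)//; exact: zyg_mean (zrho01 k).
have /choice[H hH] : forall z, exists l, disk z -> ulim U (F^~ z) l.
  move=> z; have [z1|z1] := pselect (disk z); last by exists 0.
  by have [l hl] := ultra_lim UU (fun k => Fb k z z1); exists l.
have ub (r : R) : 0 <= r < 1 ->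
    exists M, forall k z, normc z <= r -> normc (F k z) <= M.
  move=> /andP[r0 r1]; exists (3 / (1 - r) * (1 + A)) => k z zr.
  have z1 : normc z < 1 by exact: le_lt_trans r1.
  apply: le_trans (Fb k z z1) _; rewrite ler_wpM2r ?addr_ge0//.
  by rewrite ler_wpM2l// lef_pV2 ?posrE ?subr_gt0// lerB.
have Fa k : analytic_on_disk (F k) by exact: G_analytic.
have Ha : analytic_on_disk H by exact: (analytic_ulim UU Fa ub hH).
have Relim z e : disk z -> 0 < e -> \forall k \near U, `|complex.Re (F k z) - complex.Re (H z)| < e.
  move=> z1 /(hH z z1); apply: filterS => k; apply: le_lt_trans.
  by rewrite -ReN -ReD; exact: normc_Re.
have o1 : disk (0 : R[i]) by change (normc (0 : R[i]) < 1); rewrite normc0.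
have ImF0 k : complex.Im (F k 0) = 0 by rewrite /F /G herglotz0//; exact: zyg_cont.
have sqm k r : 0 <= r < 1 -> imean (fun t => normc (F k (r%:C * expi t)) ^+ 2) <= 2 * (1 + A).
  move=> rr; apply: le_trans (moment2 (Fa k) (ImF0 k) rr) _; rewrite ler_wpM2l//.
  have [i1 le1] := zyg_sq_mean (zrho01 k); apply: le_trans le1.
  have zc := zyg_cont (r01 k).
  have z2 : continuous (fun t => zyg (zrho k) (expi t) ^+ 2) by apply: (@pow_cont R (fun t => zyg (zrho k) (expi t))); exact: zc.
  have [j1 <-] := poisson_average rr (continuous_measurable_fun z2) (fun t => sqr_ge0 _) i1.
  apply: (le_imean (Re_pow_itg 2 (Fa k) rr) j1) => s _.
  have w1 : normc (r%:C * expi s) < 1.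
    by rewrite normc_realM normc_expi mulr1; case/andP: rr => ? ?; rewrite ger0_norm.
  rewrite (ReG (r01 k) w1); apply: (@pk_jensen R _ _ 1 w1).
  - by move=> t; exact: le_trans ler01 (zyg_ge1 _ _).
  - by apply: cont_itg => t; apply: continuousM; [exact: pk_cont|exact: zc].
  - by apply: cont_itg => t; apply: continuousM; [exact: pk_cont|exact: z2].
exists H; split => //.
- split=> // r rr.
  (* A single index with [|F k - H| <= 1] on the disk of radius [r] is enough, since
     [(p + 1)^2 <= 2 p^2 + 2]; this is the origin of the bound [4 (1 + A) + 2]. *)
  have [k hk] := filter_ex (ulim_unif UU Fa ub hH rr ltr01).
  have i1 := normc_pow_itg 2 (Fa k) rr.
  have e2 : 4 * (1 + A) + 2 = 2 * (2 * (1 + A)) + 2 by ring.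
  rewrite e2; apply: le_trans (lerD (ler_wpM2l (ler0n _ 2) (sqm k r rr)) (lexx 2)).
  rewrite -(imeanZ 2 i1) -[X in _ <= _ + X]imean_cst -(imeanD (rintgZ 2 i1) (rintg_cst _ _ _)).
  apply: (le_imean (normc_pow_itg 2 Ha rr) (rintgD (rintgZ 2 i1) (rintg_cst _ _ _))) => t _.
  have zr : normc (r%:C * expi t) <= r.
    by rewrite normc_realM normc_expi mulr1; case/andP: rr => ? ?; rewrite ger0_norm.
  have h1 := hk _ zr; have := normcB_ge (H (r%:C * expi t)) (F k (r%:C * expi t)).
  rewrite normc_sub in h1.
  move: h1 (normc_ge0 (H (r%:C * expi t))) (normc_ge0 (F k (r%:C * expi t))).
  move: (normc (F k _)) (normc (H _)) (normc _) => p q m m1 q0 p0 qp.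
  have q1 : q <= p + 1 by lra.
  have q2 : q ^+ 2 <= (p + 1) ^+ 2 by rewrite lerXn2r ?nnegrE// addr_ge0.
  apply: le_trans q2 _; have := sqr_ge0 (p - 1); rewrite -subr_ge0 => h.
  by rewrite -subr_ge0; apply: le_trans h _; rewrite le_eqVlt; apply/orP; left; apply/eqP; ring.
- move=> z z1; have z1' : normc z < 1 by [].
  apply/ler_addgt0Pl => e e0; have [k hk] := filter_ex (Relim z e z1 e0).
  have := @ReG_ge1 (zrho k) z (r01 k) z1'; move: hk; rewrite -/(F k) ltr_norml => /andP[]; lra.
- move=> z z1; have z1' : normc z < 1 by [].
  apply/ler_addgt0Pr => e e0.
  have N0 := normc_ge0 (H z).
  (* Replacing [|H|] by [|H| + d] in the majorant costs [4 d (2 |H| + d)], at most [e / 2]; the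
     other half pays for moving [f] from [zrho k * z] to [z]. *)
  pose d := Num.min 1 (e / 2 / (4 * (2 * normc (H z) + 1))).
  have P0 : 0 < 4 * (2 * normc (H z) + 1) by rewrite mulr_gt0//; lra.
  have d0 : 0 < d by rewrite lt_min ltr01 !divr_gt0.
  have e20 : 0 < e / 2 by rewrite divr_gt0.
  have [c c0 hc] := holo_ccont ((analytic_holo _).1 fa z z1) e20.
  have h2 := Uoo _ (zrho_near c0).
  have [k [k1 k2]] := filter_ex (filterI (hH z z1 d d0) h2).
  have hf : normc (f ((zrho k)%:C * z) - f z) < e / 2.
    apply: hc; have -> : (zrho k)%:C * z - z = (zrho k - 1)%:C * z.
      by rewrite (rmorphB (real_complex R) (zrho k) 1) rmorph1 mulrBl mul1r.
    have /andP[_ /ltW q1] := r01 k.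
    rewrite normc_realM distrC ger0_norm ?subr_ge0//.
    by apply: le_lt_trans k2; rewrite ler_piMr ?subr_ge0// ltW.
  have m := @majorant (zrho k) z (r01 k) z1.
  have t1 := normcB_ge (f z) (f ((zrho k)%:C * z)); rewrite normc_sub in t1.
  have t2 := normcB_ge (F k z) (H z).
  have n1 : normc (F k z) <= normc (H z) + d by move: k1 t2; rewrite -/(F k z); lra.
  have n2 : normc (F k z) ^+ 2 <= (normc (H z) + d) ^+ 2.
    by rewrite lerXn2r ?nnegrE ?normc_ge0// addr_ge0// ltW.
  have dd : d * (4 * (2 * normc (H z) + 1)) <= e / 2.
    by rewrite -ler_pdivlMr// ge_min lexx orbT.
  have d1 : d <= 1 by rewrite ge_min lexx.
  rewrite -/(F k) in m; move: m n2 dd t1 hf d1 d0; nra.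
- apply/eqP; rewrite -normr_eq0; apply/eqP/le_anti; rewrite normr_ge0 andbT.
  apply/ler_addgt0Pr => e e0; rewrite add0r.
  have [k hk] := filter_ex (hH 0 o1 e e0).
  have FE : F k 0 = (imean (fun t => zyg (zrho k) (expi t)))%:C.
    by rewrite /F /G herglotz0//; exact: zyg_cont.
  have := le_lt_trans (normc_Im _) hk; rewrite ImD ImN FE /= add0r normrN.
  exact: ltW.
- move=> z b z1 hb; have z1' : normc z < 1 by [].
  apply/ler_addgt0Pr => e e0.
  have [k [k1 k2]] := filter_ex (filterI (Relim z e z1 e0) (Uoo _ hb)).
  by move: k1 k2; rewrite -(@ReG (zrho k) z (r01 k) z1') -/(F k) /= ltr_norml => /andP[]; lra.
Qed.

End ZygmundMajorant.

(** * Fatou's lemma and dominated convergence on the circle *)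

Section LimitsOnTheCircle.
Variable R : realType.
Notation mu := (@lebesgue_measure R).
Implicit Types (h : nat -> R -> R) (g : R -> R).

Let mD : measurable (@circ R : set (measurableTypeR R)).
Proof. exact: measurable_itv. Qed.

Lemma ae_circ_interior : {ae mu, forall t, @circ R t -> 0 < t < 2 * pi}.
Proof.
have n a : {ae mu, forall t, t != a}.
  exists [set a]; split; first exact: measurable_set1.
    by apply: lebesgue_measure_set1.
  by move=> t /= /negP; rewrite negbK => /eqP.
apply: (@filterS2 _ _ (ae_filter_ringOfSetsType mu)) (n 0) (n (2 * pi)) => t t0 t1.
by rewrite /circ /= in_itv /= => /andP[a b]; rewrite !lt_neqAle eq_sym t0 a t1.
Qed.

Section Fatou.
Variables (h : nat -> R -> R) (C : R).
Hypothesis mh : forall k, measurable_fun setT (h k).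
Hypothesis h0 : forall k t, 0 <= h k t.
Hypothesis ih : forall k, itg (h k).
Hypothesis hC : forall k, imean (h k) <= C.

Let E k t := (h k t)%:E.

Let mE k : measurable_fun (@circ R) (E k).
Proof. by apply/measurable_EFinP; exact: measurable_funS (mh k). Qed.

Let m_einf : measurable_fun (@circ R) (fun t => limn_einf (E ^~ t)).
Proof.
have -> : (fun t => limn_einf (E ^~ t)) = (fun t => (- limn_esup (-%E \o (E ^~ t)))%E).
  by apply/funext => t; rewrite (limn_esupN (E ^~ t)) oppeK.
apply: measurableT_comp => //.
by apply: measurable_fun_limn_esup => k; apply: measurableT_comp (mE k).
Qed.

Let einf_ge0 t : (0 <= limn_einf (E ^~ t))%E.
Proof.
rewrite limn_einf_lim; apply: lime_ge; first exact: is_cvg_einfs.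
apply: nearW => n; apply: le_ereal_inf_tmp => _ [k _ <-] /=.
by rewrite lee_fin.
Qed.

Let int_einf : (\int[mu]_(t in @circ R) limn_einf (E ^~ t) <= (2 * pi * C)%:E)%E.
Proof.
have E0 k t : @circ R t -> (0 <= E k t)%E by rewrite lee_fin.
apply: le_trans (@fatou _ _ R mu _ mD E mE E0) _.
rewrite limn_einf_lim; apply: lime_le; first exact: is_cvg_einfs.
apply: nearW => n; apply: ge_ereal_inf; exists (\int[mu]_(t in @circ R) E n t)%E.
  by exists n => //=.
by rewrite (eint_itg (ih n)) lee_fin ler_wpM2l// ltW// twopi_gt0.
Qed.

(** By Fatou's lemma the lower limit is integrable, hence finite almost everywhere. It excludes
    zeros of the radial limits of [1 / H]. *)
Lemma fatou_not_infty : {ae mu, forall t, @circ R t ->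
  ~ ((fun k => (h k t)%:E) @ \oo --> +oo%E)}.
Proof.
have iS : mu.-integrable (@circ R) (fun t => limn_einf (E ^~ t)).
  apply/integrableP; split; first exact: m_einf.
  under eq_integral do rewrite gee0_abs//.
  by apply: le_lt_trans int_einf (ltry _).
apply: filterS (integrable_ae mD iS) => t ht Dt c; have := ht Dt.
have -> : limn_einf (E ^~ t) = +oo%E.
  by rewrite is_cvg_limn_einfE; [exact/cvg_lim|apply/cvg_ex; exists +oo%E].
by [].
Qed.

Lemma fatou_imean (g : R -> R) : measurable_fun (@circ R) g ->
  (forall t, @circ R t -> 0 <= g t) ->
  {ae mu, forall t, @circ R t -> (h ^~ t) @ \oo --> g t} ->
  (\int[mu]_(t in @circ R) (g t)%:E <= (2 * pi * C)%:E)%E.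
Proof.
move=> mg g0 hg; apply: le_trans int_einf.
rewrite le_eqVlt; apply/orP; left; apply/eqP.
apply: ge0_ae_eq_integral => //; first exact/measurable_EFinP.
apply: (@filterS _ _ (ae_filter_ringOfSetsType mu)) hg => t ht Dt.
have c : E ^~ t @ \oo --> (g t)%:E by apply: cvg_EFin; [exact: nearW|exact: ht].
by rewrite is_cvg_limn_einfE; [exact/esym/cvg_lim|apply/cvg_ex; exists (g t)%:E].
Qed.

End Fatou.

Lemma imean_dominated h g (M : R) : (forall k, measurable_fun setT (h k)) ->
  measurable_fun setT g -> (forall k t, `|h k t| <= M) -> (forall t, `|g t| <= M) ->
  {ae mu, forall t, @circ R t -> (h ^~ t) @ \oo --> g t} ->
  (fun k => imean (h k)) @ \oo --> imean g.
Proof.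
move=> mh mg hM gM hg.
have ih k : itg (h k) by apply: itg_bounded (fun t _ => hM k t).
have ig : itg g by apply: itg_bounded (fun t _ => gM t).
have m1 k : measurable_fun (@circ R) (fun t => (h k t)%:E).
  by apply/measurable_EFinP; apply: measurable_funS (mh k).
have m2 : measurable_fun (@circ R) (fun t => (g t)%:E).
  by apply/measurable_EFinP; apply: measurable_funS mg.
have c3 : {ae mu, forall t, @circ R t -> (fun k => (h k t)%:E) @ \oo --> (g t)%:E}.
  apply: (@filterS _ _ (ae_filter_ringOfSetsType mu)) hg => t hh Dt.
  by apply: cvg_EFin; [exact: nearW|exact: hh].
have d4 : {ae mu, forall t k, @circ R t -> (`|(h k t)%:E| <= M%:E)%E}.
  by apply: (aeW mu) => t k _; rewrite lee_fin.
have [_ _ dc] := dominated_convergence mD m1 m2 c3 (rintg_cst _ _ _) d4.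
rewrite (eint_itg ig) in dc.
have /fine_cvg c : (fun k => (2 * pi * imean (h k))%:E) @ \oo --> (2 * pi * imean g)%:E.
  by apply: cvg_trans dc; apply: near_eq_cvg; apply: nearW => k /=; rewrite (eint_itg (ih k)).
have n0 := lt0r_neq0 (twopi_gt0 R).
have -> : imean g = (2 * pi)^-1 * (2 * pi * imean g) by rewrite mulKf.
have -> : (fun k => imean (h k)) = (fun k => (2 * pi)^-1 * (2 * pi * imean (h k))).
  by apply/funext => k; rewrite mulKf.
by apply: cvgM; [exact: cvg_cst|exact: c].
Qed.

End LimitsOnTheCircle.

(** * Fatou's theorem for H^1 *)

Section FatouHardy.
Variable R : realType.
Notation mu := (@lebesgue_measure R).
Implicit Types (f : R[i] -> R[i]) (t r : R) (l : R[i]).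

Lemma rlimP f t l : rlim f t l <->
  ((f (r%:C * expi t) : R[i]^o) @[r --> (1 : R)^'-] --> (l : R[i]^o)).
Proof.
split=> [h|/(@cvg_normcP _ _ _ _ (fun r => f (r%:C * expi t)) l) h].
  apply/(@cvg_normcP _ _ _ _ (fun r => f (r%:C * expi t)) l) => e /h[d d0 hd].
  apply/nbhs_ballP; exists d => //= r; rewrite /ball /= ltr_norml => /andP[_ r1] r2.
  by apply: hd; rewrite r2 andbT; lra.
move=> e /h/nbhs_ballP[d /= d0 hd]; exists d => // r /andP[r1 r2]; apply: hd => //.
by rewrite /ball /= ltr_norml; apply/andP; split; lra.
Qed.

Lemma boundary_rlim f t l : rlim f t l -> boundary f (expi t) = l.
Proof. by move/rlimP => c; exact: (cvg_lim (@norm_hausdorff _ R[i]^o) c). Qed.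

Lemma rlimM f1 f2 t l1 l2 : rlim f1 t l1 -> rlim f2 t l2 ->
  rlim (fun z => f1 z * f2 z) t (l1 * l2).
Proof. by move=> /rlimP c1 /rlimP c2; apply/rlimP; exact: (cvgM c1 c2). Qed.

Lemma rlimB f1 f2 t l1 l2 : rlim f1 t l1 -> rlim f2 t l2 ->
  rlim (fun z => f1 z - f2 z) t (l1 - l2).
Proof. by move=> /rlimP c1 /rlimP c2; apply/rlimP; exact: (cvgB c1 c2). Qed.

Lemma rlimV f t l : l != 0 -> rlim f t l -> rlim (fun z => (f z)^-1) t l^-1.
Proof. by move=> l0 /rlimP c; apply/rlimP; exact: (cvgV l0 c). Qed.

Lemma eq_rlim f1 f2 t l : (forall z, disk z -> f1 z = f2 z) -> rlim f1 t l -> rlim f2 t l.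
Proof.
move=> e h x x0; have [d d0 hd] := h _ x0; exists (Num.min d 1); first by rewrite lt_min d0 ltr01.
move=> r /andP[r1 r2]; rewrite -e; last first.
  apply: disk_realM; rewrite r2 andbT; apply: ltW; apply: le_lt_trans r1.
  by rewrite subr_ge0 ge_min lexx orbT.
apply: hd; rewrite r2 andbT; apply: le_lt_trans r1.
by rewrite lerB// ge_min lexx.
Qed.

Lemma rlim_zrho f t l (e : R) : rlim f t l -> 0 < e ->
  \forall k \near \oo, normc (f ((zrho R k)%:C * expi t) - l) < e.
Proof.
move=> h e0; have [d d0 hd] := h _ e0; apply: filterS (zrho_near d0) => k hk.
by apply: hd; have /andP[_ ->] := zrho01 R k; rewrite andbT; lra.
Qed.

Lemma fatou_hardy1 f : hardy 1 f ->
  {ae mu, forall t, @circ R t -> rlim f t (boundary f (expi t))}.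
Proof.
move=> /(hardyP _ ltr01)[fa [A A0 hA]].
have [H [[Ha Hsq] H1 Hf _ _]] := zygmund fa hA.
have Hn z : disk z -> 1 <= normc (H z) by move=> z1; apply: le_trans (H1 z z1) (Re_le_normc _).
have H0 z : disk z -> H z != 0 by move=> z1; rewrite -normc_gt0; apply: lt_le_trans (Hn z z1).
have HVa : analytic_on_disk (fun z => (H z)^-1).
  by apply/analytic_holo => z z1; apply: (holoV (H0 z z1)); exact: ((analytic_holo _).1 Ha).
pose q z := (4^-1)%:C * (f z * ((H z)^-1 * (H z)^-1)).
have qa : analytic_on_disk q.
  apply/analytic_holo => z z1; apply: (holoM (holo_cst (4^-1)%:C z)).
  have h2 := (analytic_holo _).1 HVa z z1.
  exact: (holoM ((analytic_holo _).1 fa z z1) (holoM h2 h2)).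
have HV1 z : disk z -> normc (H z)^-1 <= 1.
  by move=> z1; rewrite normcV invf_le1 ?Hn// (lt_le_trans ltr01) ?Hn.
have q1 z : disk z -> normc (q z) <= 1.
  move=> z1; rewrite /q normc_realM !normcM normcV ger0_norm//.
  have p := lt_le_trans ltr01 (Hn z z1).
  have := Hf z z1; move: (normc (f z)) (normc (H z)) p => x y p h.
  have -> : 4^-1 * (x * (y^-1 * y^-1)) = x / (4 * y ^+ 2) by field; rewrite gt_eqF.
  by rewrite ler_pdivrMr ?mul1r// mulr_gt0// exprn_gt0.
(* At a point where [1 / H] had radial limit 0, [|H|^2] would tend to infinity along the radii
   [zrho], against its bounded means. *)
have fin : {ae mu, forall t, @circ R t ->
    ~ ((fun k => (normc (H ((zrho R k)%:C * expi t)) ^+ 2)%:E) @ \oo --> +oo%E)}.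
  have z01 k : 0 <= zrho R k < 1 by have /andP[/ltW -> ->] := zrho01 R k.
  apply: (@fatou_not_infty R (fun k t => normc (H ((zrho R k)%:C * expi t)) ^+ 2) (4 * (1 + A) + 2)).
  - move=> k; apply: continuous_measurable_fun; apply: pow_cont; exact: dil_cont.
  - by move=> k t; exact: sqr_ge0.
  - by move=> k; exact: normc_pow_itg.
  - by move=> k; exact: Hsq.
have a1 := fatou_bounded qa q1; have a2 := fatou_bounded HVa HV1.
have a12 := @filterS2 _ _ (ae_filter_ringOfSetsType mu) _ _ _ (fun t x y => conj x y) a1 a2.
have a3 := @filterS2 _ _ (ae_filter_ringOfSetsType mu) _ _ _ (fun t x y => conj x y) fin (ae_circ_interior R).
apply: (@filterS2 _ _ (ae_filter_ringOfSetsType mu)) a12 a3 => t [h1 h2] [h3 h4] Dt.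
have t01 := h4 Dt; have [l1 L1] := h1 t01; have [l2 L2] := h2 t01.
have l20 : l2 != 0.
  apply/eqP => e; apply: (h3 Dt); apply/cvgeyPge => B.
  have B1 : 0 < `|B| + 1 by have := normr_ge0 B; lra.
  rewrite e in L2; have iB : 0 < (`|B| + 1)^-1 by rewrite invr_gt0.
  apply: filterS (rlim_zrho L2 iB) => k; rewrite subr0 normcV.
  have d1 : disk ((zrho R k)%:C * expi t).
    by apply: disk_realM; have /andP[/ltW -> ->] := zrho01 R k.
  have n1 := Hn _ d1; rewrite ltf_pV2 ?posrE// ?(lt_le_trans ltr01)// => hk.
  by rewrite lee_fin; move: hk n1 (ler_norm B); move: (normc _) => x; nra.
(* [l1] is the limit of [f / (4 H^2)] and [l2] that of [1 / H]; the 4 undoes the normalization that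
   made the quotient bounded by 1. *)
have Lf : rlim f t (4%:C * (l1 * (l2^-1 * l2^-1))).
  have c4 : rlim (fun=> 4%:C) t (4%:C : R[i]).
    by move=> x x0; exists 1 => // r _; rewrite subrr normc0.
  have V := rlimV l20 L2.
  apply: eq_rlim (rlimM c4 (rlimM L1 (rlimM V V))) => z z1.
  rewrite invrK /q; have := H0 z z1; move: (f z) (H z) => x y y0.
  have -> : (4 : R)%:C * ((4^-1)%:C * (x * (y^-1 * y^-1)) * (y * y)) =
      (4%:C * (4^-1)%:C) * (x * ((y^-1 * y) * (y^-1 * y))) by ring.
  by rewrite -rmorphM divff// rmorph1 mulVf// !mulr1 mul1r.
by rewrite (boundary_rlim Lf).
Qed.

End FatouHardy.

(** * Smirnov's theorem for the exponent 3 *)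

Section Smirnov.
Variable R : realType.
Notation mu := (@lebesgue_measure R).
Implicit Types (t r : R).

Lemma itg_le (h1 h2 : R -> R) : measurable_fun setT h1 -> itg h2 ->
  (forall t, @circ R t -> `|h1 t| <= h2 t) -> itg h1.
Proof.
move=> m1 i2 h; apply: (@le_integrable _ _ R mu (@circ R) _ _ (EFin \o h2)) => //.
- exact: measurable_itv.
- by apply/measurable_EFinP; exact: measurable_funS m1.
- by move=> t Dt /=; rewrite lee_fin; apply: le_trans (h t Dt) (ler_norm _).
Qed.

Variable f : R[i] -> R[i].
Hypothesis f1 : hardy 1 f.
Let b t := normc (boundary f (expi t)).
Hypothesis mb : measurable_fun (@circ R) b.
Hypothesis ib : itg (fun t => b t ^+ 3).

(** The almost everywhere limit of the functions [zyg]. It is set to 0 outside [circ], where nothing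
    is assumed about the measurability of [b]. *)
Let hs := (fun t => Num.sqrt (1 + b t)) \_ (@circ R).

Let b0 t : 0 <= b t. Proof. exact: normc_ge0. Qed.

Let hsE t : @circ R t -> hs t = Num.sqrt (1 + b t).
Proof. by move=> Dt; rewrite /hs patchE mem_set. Qed.

Let hs_ge0 t : 0 <= hs t.
Proof. by rewrite /hs patchE; case: ifP => // _; exact: sqrtr_ge0. Qed.

Let hs_ge1 t : @circ R t -> 1 <= hs t.
Proof. by move=> Dt; rewrite hsE// -[leLHS]sqrtr1 ler_wsqrtr// lerDl. Qed.

Let hs6 t : @circ R t -> hs t ^+ 6 = (1 + b t) ^+ 3.
Proof. by move=> Dt; rewrite hsE// (exprM _ 2 3) sqr_sqrtr// addr_ge0. Qed.

Let mhs : measurable_fun setT hs.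
Proof.
apply/(measurable_restrictT _ _).1; first exact: measurable_itv.
apply: (measurableT_comp (f := @Num.sqrt R)).
  by apply: continuous_measurable_fun; exact: sqrt_continuous.
by apply: measurable_funD => //; exact: measurable_cst.
Qed.

Let ihs6 : itg (fun t => hs t ^+ 6).
Proof.
apply: (@itg_le _ (fun t => 4 + 4 * b t ^+ 3)).
- exact: measurable_funX.
- exact: (rintgD (rintg_cst _ _ _) (rintgZ _ ib)).
- move=> t Dt; rewrite hs6// ger0_norm ?exprn_ge0// ?addr_ge0//.
  have := b0 t; move: (b t) => x x0.
  have q : 0 <= (x + 1) * (x - 1) ^+ 2 by rewrite mulr_ge0 ?sqr_ge0// addr_ge0.
  have e : 4 + 4 * x ^+ 3 - (1 + x) ^+ 3 = 3 * ((x + 1) * (x - 1) ^+ 2) by ring.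
  by rewrite -subr_ge0 e mulr_ge0.
Qed.

Let ihs : itg hs.
Proof.
apply: (itg_le mhs ihs6) => t Dt; rewrite ger0_norm// -[leLHS]expr1.
by apply: ler_weXn2l => //; exact: hs_ge1.
Qed.

Let trunc (T x : R) := Num.min x T.

Let trunc_lip T x y : `|trunc T x - trunc T y| <= `|x - y|.
Proof.
rewrite /trunc; have [xT|xT] := leP x T; have [yT|yT] := leP y T => //.
- by rewrite ler_norml; move: (ler_norm (x - y)) (ler_norm (y - x)); rewrite (distrC y); lra.
- by rewrite ler_norml; move: (ler_norm (x - y)) (ler_norm (y - x)); rewrite (distrC y); lra.
- by rewrite subrr normr0.
Qed.

(** Uniform integrability in elementary form: bounded mean squares make the loss by truncation of
    order [1 / T]. *)
Let trunc_bound T x : 0 < T -> 0 <= x -> 0 <= trunc T x <= T /\ x <= trunc T x + T^-1 * x ^+ 2.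
Proof.
move=> T0 x0; have q : 0 <= T^-1 * x ^+ 2 by rewrite mulr_ge0 ?sqr_ge0// invr_ge0 ltW.
rewrite /trunc; have [xT|xT] := leP x T; split; rewrite ?x0 ?lexx ?(ltW T0)//.
  by rewrite lerDl.
have : x <= T^-1 * x ^+ 2 by rewrite ler_pdivlMl// expr2 ler_wpM2r// ltW.
by move/le_trans; apply; rewrite lerDr ltW.
Qed.

Let mtrunc T (h : R -> R) : measurable_fun setT h -> measurable_fun setT (fun t => trunc T (h t)).
Proof. by move=> mh; exact: (measurable_minr mh (measurable_cst _)). Qed.

Let zlim : {ae mu, forall t, @circ R t ->
  (fun k => zyg f (zrho R k) (expi t)) @ \oo --> hs t}.
Proof.
apply: (@filterS _ _ (ae_filter_ringOfSetsType mu)) (fatou_hardy1 f1) => t h Dt.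
apply/cvgrPdist_lt => e e0; apply: filterS (rlim_zrho (h Dt) e0) => k.
apply: le_lt_trans; rewrite hsE// /zyg; apply: le_trans (normc_dist _ _).
rewrite ler_norml; apply/andP; split; last first.
  by rewrite distrC; apply: sqrt1_lip => //; exact: normc_ge0.
by rewrite lerNl opprB; apply: sqrt1_lip => //; exact: normc_ge0.
Qed.

Theorem smirnov_cube : exists B, forall r, 0 < r < 1 ->
  imean (fun t => normc (f (r%:C * expi t)) ^+ 3) <= B.
Proof.
have [fa [A A0 hA]] := (hardyP f ltr01).1 f1.
have [H [[Ha Hsq] H1 Hf H0 HP]] := zygmund fa hA.
have z01 k : 0 <= zrho R k < 1 by have /andP[/ltW -> ->] := zrho01 R k.
have zc k : continuous (fun t => zyg f (zrho R k) (expi t)) by exact: zyg_cont.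
have z0 k t : 0 <= zyg f (zrho R k) (expi t) by apply: le_trans (zyg_ge1 _ _ _).
have RH z : disk z -> complex.Re (H z) <= imean (fun t => pk z t * hs t).
  move=> z1; have z1' : normc z < 1 by [].
  apply/ler_addgt0Pr => d d0; apply: HP => //.
  pose P := 2 / (1 - normc z).
  have P0 : 0 < P by rewrite divr_gt0// subr_gt0.
  (* The kernel is at most [P] and the mean squares of [zyg] at most [1 + A], so truncation costs at
     most [d / 2]. The other half goes to dominated convergence of the truncated functions. *)
  pose T := 2 * P * (1 + A) / d + 1.
  have A1 : 0 <= 1 + A by rewrite addr_ge0.
  have q0 : 0 <= 2 * P * (1 + A) / d by exact: (divr_ge0 (mulr_ge0 (mulr_ge0 (ler0n _ 2) (ltW P0)) A1) (ltW d0)).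
  have T0 : 0 < T by rewrite /T; lra.
  have PT : T^-1 * (P * (1 + A)) <= d / 2.
    rewrite ler_pdivrMl//; have -> : T * (d / 2) = P * (1 + A) + d / 2.
      by rewrite /T; field; rewrite gt_eqF.
    by rewrite lerDl; lra.
  have mpk : measurable_fun setT (pk z).
    by apply: continuous_measurable_fun => t; exact: pk_cont.
  have p0 t : 0 <= pk z t by apply: pk_ge0; exact: ltW.
  have bd x t : 0 <= x -> `|pk z t * trunc T x| <= P * T.
    move=> x0; have [/andP[u0 uT] _] := trunc_bound T0 x0.
    rewrite ger0_norm; last exact: mulr_ge0.
    by apply: ler_pM => //; exact: pk_le.
  have mk k : measurable_fun setT (fun t => pk z t * trunc T (zyg f (zrho R k) (expi t))).
    by apply: measurable_funM => //; apply: mtrunc; exact: continuous_measurable_fun.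
  have ms : measurable_fun setT (fun t => pk z t * trunc T (hs t)).
    by apply: measurable_funM => //; exact: mtrunc.
  have bk k t : `|pk z t * trunc T (zyg f (zrho R k) (expi t))| <= P * T by exact: bd.
  have bs t : `|pk z t * trunc T (hs t)| <= P * T by exact: bd.
  have cv : {ae mu, forall t, @circ R t ->
     (fun k => pk z t * trunc T (zyg f (zrho R k) (expi t))) @ \oo --> pk z t * trunc T (hs t)}.
    apply: (@filterS _ _ (ae_filter_ringOfSetsType mu)) zlim => t h Dt.
    apply: cvgM; first exact: cvg_cst.
    apply/cvgrPdist_lt => e e0; move/cvgrPdist_lt : (h Dt) => /(_ e e0).
    by apply: filterS => k; apply: le_lt_trans; exact: trunc_lip.
  have c := imean_dominated mk ms bk bs cv.
  have d20 : 0 < d / 2 by rewrite divr_gt0.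
  move/cvgrPdist_lt : c => /(_ _ d20); apply: filterS => k hk.
  have ik : itg (fun t => pk z t * trunc T (zyg f (zrho R k) (expi t))).
    exact: itg_bounded (mk k) (fun t _ => bk k t).
  have is' : itg (fun t => pk z t * trunc T (hs t)) by exact: itg_bounded ms (fun t _ => bs t).
  have [i2 m2] := zyg_sq_mean fa hA (zrho01 R k).
  have c1 : imean (fun t => pk z t * zyg f (zrho R k) (expi t)) <=
      imean (fun t => pk z t * trunc T (zyg f (zrho R k) (expi t)) +
        T^-1 * P * zyg f (zrho R k) (expi t) ^+ 2).
    have iz : itg (fun t => pk z t * zyg f (zrho R k) (expi t)).
      by apply: cont_itg => t; apply: continuousM; [exact: pk_cont|exact: zc].
    apply: (le_imean iz (rintgD ik (rintgZ _ i2))) => t _.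
    have [_ h] := trunc_bound T0 (z0 k t).
    apply: le_trans (ler_wpM2l (p0 t) h) _; rewrite mulrDr lerD2l mulrCA -(mulrA T^-1 P).
    apply: ler_wpM2l; first by rewrite invr_ge0 ltW.
    by apply: ler_wpM2r; [exact: sqr_ge0|exact: pk_le].
  rewrite (imeanD ik (rintgZ _ i2)) (imeanZ _ i2) in c1.
  have c2 : imean (fun t => pk z t * trunc T (hs t)) <= imean (fun t => pk z t * hs t).
    apply: (le_imean is' (itg_pkM mhs ihs z1')) => t _.
    by rewrite ler_wpM2l// /trunc ge_min lexx.
  have c3 : T^-1 * P * imean (fun t => zyg f (zrho R k) (expi t) ^+ 2) <= d / 2.
    apply: le_trans PT; rewrite -(mulrA T^-1); apply: ler_wpM2l; first by rewrite invr_ge0 ltW.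
    exact: ler_wpM2l (ltW P0) _ _ m2.
  move: hk; rewrite ltr_norml => /andP[c4 c5]; move: c1 c2 c3 c4 c5; lra.
(* [64 = 4^3] comes from [|f| <= 4 |H|^2] and 5327 from [moment6]. Jensen's inequality for the
   kernel and the invariance of means under the Poisson operator then lead from [Re H] to [hs]. *)
exists (64 * (5327 * imean (fun t => hs t ^+ 6))) => r r01.
have r01' : 0 <= r < 1 by case/andP: r01 => /ltW -> ->.
have ifn := normc_pow_itg 3 fa r01'; have i6 := normc_pow_itg 6 Ha r01'.
have d1 t : disk (r%:C * expi t) by exact: disk_realM.
have s1 : imean (fun t => normc (f (r%:C * expi t)) ^+ 3) <=
    imean (fun t => 64 * normc (H (r%:C * expi t)) ^+ 6).
  apply: (le_imean ifn (rintgZ _ i6)) => t _.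
  have := Hf _ (d1 t); move: (normc_ge0 (f (r%:C * expi t))).
  move: (normc (f _)) (normc (H _)) => x y x0 h.
  have -> : 64 * y ^+ 6 = (4 * y ^+ 2) ^+ 3 by ring.
  by rewrite lerXn2r ?nnegrE// (le_trans x0).
apply: le_trans s1 _; rewrite (imeanZ _ i6); apply: ler_wpM2l (ler0n _ _) _ _ _.
apply: le_trans (moment6 Ha H0 r01') _; apply: ler_wpM2l (ler0n _ _) _ _ _.
have m6 : measurable_fun setT (fun t => hs t ^+ 6) by exact: measurable_funX.
have [j1 <-] := poisson_average r01' m6 (fun t => exprn_ge0 6 (hs_ge0 t)) ihs6.
apply: (le_imean (Re_pow_itg 6 Ha r01') j1) => s _.
have w1 : normc (r%:C * expi s) < 1 by exact: d1.
apply: (@le_trans _ _ (imean (fun t => pk (r%:C * expi s) t * hs t) ^+ 6)).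
  have R1 := H1 _ (d1 s); have R2 := RH _ (d1 s).
  by rewrite lerXn2r ?nnegrE//; [lra|apply: le_trans R2; lra].
by apply: (@pk_jensen R _ _ 5 w1) => //; exact: itg_pkM.
Qed.

End Smirnov.

(** * Measurability of boundary functions *)

Section RadialMeasurability.
Variable R : realType.

(** Cauchy's criterion at 1. Continuity in the radius reduces it to rational radii, hence to
    countable unions and intersections of measurable sets. *)
Lemma measurable_cvg_at1 (g : R -> R -> R) :
  (forall r, 0 < r < 1 -> measurable_fun setT (g r)) ->
  (forall t r, 0 < r < 1 -> {for r, continuous (g ^~ t)}) ->
  measurable ([set t : R | cvg (g r t @[r --> (1 : R)^'-])] : set (measurableTypeR R)).
Proof.
move=> mg cg.
pose near1 (m : nat) (r : R) := Num.max 0 (1 - m.+1%:R^-1) < r < 1.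
have near01 m r : near1 m r -> 0 < r < 1.
  by rewrite /near1 gt_max => /andP[/andP[-> _] ->].
pose bad n m (q q' : rat) := [set t : R | near1 m (ratr q) /\ near1 m (ratr q') /\
  n.+1%:R^-1 < `|g (ratr q) t - g (ratr q') t|].
have mbad n m q q' : measurable (bad n m q q' : set (measurableTypeR R)).
  have [h|h] := pselect (near1 m (ratr q) /\ near1 m (ratr q')); last first.
    rewrite (_ : bad _ _ _ _ = set0); first exact: measurable0.
    by apply/seteqP; split => // t [a [b _]]; apply: h.
  have -> : bad n m q q' = setT `&` (fun t => `|g (ratr q) t - g (ratr q') t|) @^-1` `]n.+1%:R^-1, +oo[.
    rewrite setTI; apply/seteqP; split => t /=; rewrite in_itv /= andbT; first by case=> _ [].
    by move=> ?; split; [case: h|split; [case: h|]].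
  have m1 := mg _ (near01 _ _ h.1); have m2 := mg _ (near01 _ _ h.2).
  apply: (measurableT_comp (@normr_measurable R setT) (measurable_funB m1 m2)) => //.
pose S := \bigcap_n \bigcup_m ~` (\bigcup_q \bigcup_q' bad n m q q').
have mS : measurable (S : set (measurableTypeR R)).
  apply: bigcapT_measurable => n; apply: bigcupT_measurable => m; apply: measurableC.
  apply: bigcupT_measurable_rat => q; apply: bigcupT_measurable_rat => q'; exact: mbad.
have cball (x y e : R) : ball x e y = (`|x - y| < e) :> Prop by [].
suff -> : [set t : R | cvg (g r t @[r --> (1 : R)^'-])] = S by [].
apply/seteqP; split => t.
  move=> /= /cvg_ex[l /cvgrPdist_lt c] n _.
  have p : 0 < n.+1%:R^-1 / 2 :> R by rewrite divr_gt0// invr_gt0.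
  have [d /= d0 hd] := c _ p.
  exists (Num.truncn d^-1) => // -[q _ [q' _ [h1 [h2]]]].
  have cl r : near1 (Num.truncn d^-1) r -> `|l - g r t| < n.+1%:R^-1 / 2.
    rewrite /near1 gt_max => /andP[/andP[_ r1] r2]; apply: hd => //.
    rewrite /= gtr0_norm ?subr_gt0// ltrBlDr -ltrBlDl; apply: le_lt_trans r1.
    by rewrite lerB// invf_ple ?posrE// ltW// truncnS_gt.
  apply/negP; rewrite -leNgt ltW//; have := cl _ h1; have := cl _ h2 => a1 a2.
  rewrite -[X in `|X|](subrKA l); apply: le_lt_trans (ler_normD _ _) _.
  by rewrite [X in _ < X]splitr ltrD// distrC.
move=> St; apply: cauchy_cvg; apply: cauchy_exP => e e0.
pose n := Num.truncn e^-1.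
have ne : n.+1%:R^-1 < e by rewrite invf_plt ?posrE// truncnS_gt.
have [m _ hm] := St n I.
have mid : Num.max 0 (1 - m.+1%:R^-1) < 1 :> R by rewrite gt_max ltr01/= gtrBl invr_gt0.
have [q0 q0P] := rat_in_itvoo mid.
have q0n : near1 m (ratr q0) by move: q0P; rewrite in_itv.
exists (g (ratr q0) t).
exists (1 - Num.max 0 (1 - m.+1%:R^-1)); first by rewrite /= subr_gt0.
move=> r /= rd r1.
have rn : near1 m r.
  rewrite /near1 r1 andbT; by move: rd; rewrite gtr0_norm ?subr_gt0// ltrD2l ltrN2.
change (`|g (ratr q0) t - g r t| < e); apply: le_lt_trans ne.
rewrite leNgt; apply/negP => hgt.
have pos : 0 < `|g (ratr q0) t - g r t| - n.+1%:R^-1 by rewrite subr_gt0.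
have /cvgrPdist_lt /(_ _ pos)[d /= d0 hd] := cg t r (near01 _ _ rn).
pose lo := Num.max (Num.max 0 (1 - m.+1%:R^-1)) (r - d).
have lor : lo < r by rewrite gt_max; case/andP: rn => -> _ /=; rewrite gtrBl.
have [q /[!in_itv]/= /andP[q1 q2]] := rat_in_itvoo lor.
have qn : near1 m (ratr q).
  by rewrite /near1 (lt_trans q2 r1) andbT; apply: le_lt_trans q1; rewrite le_max lexx.
have := hd (ratr q); rewrite /= gtr0_norm ?subr_gt0// => /(_ _)h.
have h1 : r - ratr q < d.
  by rewrite ltrBlDr -ltrBlDl; apply: le_lt_trans q1; rewrite le_max lexx orbT.
have {}h := h h1.
apply: hm; exists q0 => //; exists q => //; split=> //; split=> //.
have := ler_normD (g (ratr q0) t - g (ratr q) t) (g (ratr q) t - g r t).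
rewrite subrKA (distrC (g (ratr q) t)); move: h => /=.
move: (`|_|) (`|_|) (`|_|) => x y z a b.
by rewrite -(ltrD2r z); apply: lt_le_trans b; rewrite -ltrBrDl.
Qed.

Variable f : R[i] -> R[i].
Hypothesis fa : analytic_on_disk f.

Let S := [set t : R | exists l, rlim f t l].

Let Reg (r t : R) := complex.Re (f (r%:C * expi t)).
Let Img (r t : R) := complex.Im (f (r%:C * expi t)).

Let contr t (r : R) : 0 < r < 1 -> {for r, continuous (Reg ^~ t)} /\ {for r, continuous (Img ^~ t)}.
Proof.
move=> r01; have r01' : 0 <= r < 1 by case/andP: r01 => /ltW -> ->.
have c := holo_ccont ((analytic_holo _).1 fa _ (disk_realM t r01')).
have near (e : R) : 0 < e -> \forall s \near r, normc (f (r%:C * expi t) - f (s%:C * expi t)) < e.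
  move=> e0; have [d d0 hd] := c _ e0; apply: filterS (nbhsx_ballx r _ d0) => s; rewrite /ball /= => hs.
  rewrite normc_sub; apply: hd; rewrite -mulrBl -rmorphB normc_realM normc_expi mulr1.
  by rewrite distrC.
split; apply/cvgrPdist_lt => e /near; apply: filterS => s; apply: le_lt_trans.
  by rewrite -ReN -ReD; exact: normc_Re.
by rewrite -ImN -ImD; exact: normc_Im.
Qed.

Let contt (r : R) : 0 < r < 1 -> continuous (Reg r) /\ continuous (Img r).
Proof.
move=> r01; have r01' : 0 <= r < 1 by case/andP: r01 => /ltW -> ->.
by split=> t; have [] := anbhd_rcont t (anbhd_dil r01' fa).
Qed.

Let SE : S = [set t | cvg (Reg r t @[r --> (1 : R)^'-])] `&` [set t | cvg (Img r t @[r --> (1 : R)^'-])].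
Proof.
apply/seteqP; split=> t.
  move=> [l h]; split; apply/cvg_ex; [exists (complex.Re l)|exists (complex.Im l)];
    apply/cvgrPdist_lt => e /h[d d0 hd]; exists d => // r /=; rewrite ltr_norml => /andP[_ r1] r2;
    (apply: le_lt_trans (hd r _); last by rewrite r2 andbT; lra); rewrite distrC.
    by rewrite -ReN -ReD; exact: normc_Re.
  by rewrite -ImN -ImD; exact: normc_Im.
move=> [/= /cvg_ex[a /cvgrPdist_lt ha] /cvg_ex[b /cvgrPdist_lt hb]].
exists (a +i* b) => e e0; have e2 : 0 < e / 2 by rewrite divr_gt0.
have [d1 /= d10 hd1] := ha _ e2; have [d2 /= d20 hd2] := hb _ e2.
exists (Num.min d1 d2); first by rewrite lt_min d10.
move=> r /andP[r1 r2]; have rd : 1 - r < Num.min d1 d2 by move: r1; lra.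
move: rd; rewrite lt_min => /andP[q1 q2].
have n1 : `|1 - r| = 1 - r by rewrite gtr0_norm ?subr_gt0.
apply: le_lt_trans (normc_le_ReIm _) _; rewrite (splitr e) ReD ImD ReN ImN /= ltrD//; rewrite distrC.
  by apply: hd1 => //=; rewrite n1.
by apply: hd2 => //=; rewrite n1.
Qed.

Let mS : measurable (S : set (measurableTypeR R)).
Proof.
rewrite SE; apply: measurableI; apply: measurable_cvg_at1 => [r r01|t r r01].
- by apply: continuous_measurable_fun; exact: (contt r01).1.
- exact: (contr t r01).1.
- by apply: continuous_measurable_fun; exact: (contt r01).2.
- exact: (contr t r01).2.
Qed.

(** Wherever the radial limit does not exist, [lim] returns one and the same default value. A
    non-constant default could destroy measurability. *)
Let boundary_off : exists c, forall t, ~ S t -> boundary f (expi t) = c.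
Proof.
eexists => t nS; rewrite /boundary; apply: (@dvgP R[i]^o) => c; apply: nS.
by eexists; apply/rlimP; exact: c.
Qed.

Let mpart (p : R[i] -> R) (g : R -> R -> R) : (forall r t, g r t = p (f (r%:C * expi t))) ->
  (forall z w, `|p z - p w| <= normc (z - w)) ->
  (forall r, 0 < r < 1 -> continuous (g r)) ->
  measurable_fun setT (fun t : R => p (boundary f (expi t))).
Proof.
move=> gE pl gc; have [c0 hc0] := boundary_off.
(* The approximations are patched with the default value off the convergence set, so that they
   converge at every point. *)
apply: (@measurable_fun_cvg _ (measurableTypeR R) R setT (fun k t => if t \in S then g (zrho R k) t else p c0)).
  move=> k; apply: measurable_fun_ifT.
  - apply: (measurable_fun_bool true); have -> : (setT `&` (fun t => t \in S) @^-1` [set true]) = S.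
      rewrite setTI; apply/seteqP; split => t /=; first exact: set_mem.
      exact: mem_set.
    exact: mS.
  - by apply: continuous_measurable_fun; exact: gc (zrho01 R k).
  - exact: measurable_cst.
move=> t _; have [/set_mem St|/negP nS] := boolP (t \in S); last first.
  by rewrite hc0 => [|h]; [exact: cvg_cst|apply: nS; exact: mem_set].
have [l L] := St; rewrite (boundary_rlim L).
apply/cvgrPdist_lt => e e0; apply: filterS (rlim_zrho L e0) => k.
by apply: le_lt_trans; rewrite distrC gE.
Qed.

Lemma boundary_measurable : circle_measurable (boundary f).
Proof.
split; apply: measurable_funS (measurableT) (subsetT _) _.
  apply: (mpart (g := Reg)) => //; last by move=> r /contt[].
  by move=> z w; rewrite -ReN -ReD; exact: normc_Re.
apply: (mpart (g := Img)) => //; last by move=> r /contt[].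
by move=> z w; rewrite -ImN -ImD; exact: normc_Im.
Qed.

End RadialMeasurability.

(** * The Orlicz function *)

Section OrliczFunction.
Variable R : realType.
Implicit Types (x y t : R) (n N : nat).

Definition kink n : R := 2 ^+ (4 ^ n).

Definition slope n : R := 2 ^+ (7 * n) * kink n ^+ 2.

Definition psiN N x : R := x ^+ 3 + \sum_(n < N) slope n * Num.max 0 (x - kink n).

(** The full series in finite form: as [kink n >= n + 1], the terms of index [n >= x] vanish, and
    any cut beyond [x] gives the same value. *)
Definition psi x : R := psiN (Num.truncn x).+1 x.

Definition Psi (x : \bar R) : \bar R :=
  match x with r%:E => (psi r)%:E | +oo%E => +oo%E | -oo%E => 0%E end.

Lemma kink_ge n : n.+1%:R <= kink n.
Proof.
rewrite /kink -natrX ler_nat; apply: (@leq_trans (4 ^ n).+1); last exact: ltn_expl.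
by rewrite ltnS ltnW// ltn_expl.
Qed.

Lemma kink_gt0 n : 0 < kink n. Proof. exact: exprn_gt0. Qed.

Lemma slope_ge0 n : 0 <= slope n.
Proof. by rewrite mulr_ge0 ?sqr_ge0// exprn_ge0. Qed.

Lemma psiE N x : x <= N%:R -> psi x = psiN N x.
Proof.
have stab M M' : x <= M%:R -> (M <= M')%N -> psiN M' x = psiN M x.
  move=> xM; elim: M' => [|M' ih]; first by rewrite leqn0 => /eqP ->.
  rewrite leq_eqVlt => /orP[/eqP -> //|]; rewrite ltnS => MM.
  rewrite -ih// /psiN big_ord_recr /= (max_l (y := x - _)) ?mulr0 ?addr0//.
  rewrite subr_le0; apply: le_trans xM _; apply: le_trans (kink_ge M').
  by rewrite ler_nat; apply: leq_trans MM _.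
move=> xN; rewrite /psi.
have xt : x <= (Num.truncn x).+1%:R by rewrite ltW// truncnS_gt.
have [h|h] := leqP N (Num.truncn x).+1; first exact: stab.
by apply/esym/stab => //; exact: ltnW.
Qed.

Lemma psiE2 x y : exists N, psi x = psiN N x /\ psi y = psiN N y.
Proof.
exists (maxn (Num.truncn x).+1 (Num.truncn y).+1); split; apply: psiE.
  by apply: le_trans (ltW (truncnS_gt x)) _; rewrite ler_nat leq_maxl.
by apply: le_trans (ltW (truncnS_gt y)) _; rewrite ler_nat leq_maxr.
Qed.

Lemma psi_ge x : 0 <= x -> x ^+ 3 <= psi x.
Proof.
move=> x0; rewrite lerDl sumr_ge0// => n _.
by rewrite mulr_ge0 ?slope_ge0// le_max lexx.
Qed.

Lemma psi_ge0 x : 0 <= x -> 0 <= psi x.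
Proof. by move=> x0; apply: le_trans (psi_ge x0); rewrite exprn_ge0. Qed.

Lemma psi_small x : x <= 1 -> psi x = x ^+ 3.
Proof.
move=> x1; rewrite (@psiE 1)// /psiN big_ord1 max_l ?mulr0 ?addr0//.
by rewrite subr_le0; apply: le_trans x1 (le_trans _ (kink_ge 0)).
Qed.

Lemma psi_nondecreasing x y : 0 <= x -> x <= y -> psi x <= psi y.
Proof.
move=> x0 xy; have [N [-> ->]] := psiE2 x y.
have y0 := le_trans x0 xy.
rewrite /psiN; apply: lerD; first by rewrite lerXn2r ?nnegrE.
apply: ler_sum => n _; rewrite ler_wpM2l ?slope_ge0//.
by rewrite ge_max le_max lexx /= le_max lerB ?orbT.
Qed.

Let ramp_convex (c x y t : R) : 0 < t < 1 ->
  Num.max 0 (t * x + (1 - t) * y - c) <=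
  t * Num.max 0 (x - c) + (1 - t) * Num.max 0 (y - c).
Proof.
move=> /andP[t0 t1]; have s0 : 0 < 1 - t by rewrite subr_gt0.
have a (z : R) : 0 <= Num.max 0 z /\ z <= Num.max 0 z by rewrite !le_max !lexx orbT.
have [a1 a2] := a (x - c); have [b1 b2] := a (y - c).
rewrite ge_max; apply/andP; split; first by rewrite addr_ge0// mulr_ge0// ltW.
have -> : t * x + (1 - t) * y - c = t * (x - c) + (1 - t) * (y - c) by ring.
by apply: lerD; rewrite ler_pM2l.
Qed.

Let cube_convex_gap (x y t : R) :
  t * x ^+ 3 + (1 - t) * y ^+ 3 - (t * x + (1 - t) * y) ^+ 3 =
  t * (1 - t) * (x - y) ^+ 2 * ((1 + t) * x + (2 - t) * y).
Proof. ring. Qed.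

(** The ramps are convex, and the cube contributes its exact convexity defect; convexity and strict
    convexity are both read off from the sign of that defect. *)
Let psi_gap x y t : 0 < t < 1 ->
  psi (t * x + (1 - t) * y) + t * (1 - t) * (x - y) ^+ 2 * ((1 + t) * x + (2 - t) * y) <=
  t * psi x + (1 - t) * psi y.
Proof.
move=> t01; have /andP[t0 t1] := t01.
pose N := maxn (maxn (Num.truncn x).+1 (Num.truncn y).+1) (Num.truncn (t * x + (1 - t) * y)).+1.
have le z : (Num.truncn z < N)%N -> psi z = psiN N z.
  by move=> h; apply: psiE; apply: le_trans (ltW (truncnS_gt z)) _; rewrite ler_nat.
rewrite !le ?leq_max ?leqnn ?orbT//.
rewrite -cube_convex_gap /psiN.
set s1 := \sum_(n < N) _; set s2 := \sum_(n < N) _; set s3 := \sum_(n < N) _.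
suff : s1 <= t * s2 + (1 - t) * s3 by move: s1 s2 s3 => a b c; lra.
rewrite !mulr_sumr -big_split /=; apply: ler_sum => n _.
rewrite mulrCA [X in _ <= _ + X]mulrCA -mulrDr ler_wpM2l ?slope_ge0//.
exact: ramp_convex.
Qed.

Lemma psi_convex x y t : 0 <= x -> 0 <= y -> 0 < t < 1 ->
  psi (t * x + (1 - t) * y) <= t * psi x + (1 - t) * psi y.
Proof.
move=> x0 y0 t01; apply: le_trans (psi_gap x y t01); rewrite lerDl.
have /andP[t0 t1] := t01; have u : 0 <= 1 - t by lra.
apply: mulr_ge0; first exact: mulr_ge0 (mulr_ge0 (ltW t0) u) (sqr_ge0 _).
by apply: addr_ge0; apply: mulr_ge0 => //; lra.
Qed.

Lemma psi_strictly_convex x y t : 0 <= x -> 0 <= y -> x != y -> 0 < t < 1 ->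
  psi (t * x + (1 - t) * y) < t * psi x + (1 - t) * psi y.
Proof.
move=> x0 y0 xy t01; apply: lt_le_trans (psi_gap x y t01); rewrite ltrDl.
have /andP[t0 t1] := t01; have u : 0 < 1 - t by lra.
apply: mulr_gt0; first by apply: mulr_gt0 (mulr_gt0 t0 u) _; rewrite exprn_even_gt0//= subr_eq0.
have [x00|x1] := eqVneq x 0; last first.
  have x2 : 0 < x by rewrite lt_def x1.
  have p : 0 < (1 + t) * x by rewrite mulr_gt0//; lra.
  have q : 0 <= (2 - t) * y by rewrite mulr_ge0//; lra.
  by lra.
have y2 : 0 < y by rewrite lt_def y0 andbT eq_sym -x00.
by rewrite x00 mulr0 add0r mulr_gt0//; lra.
Qed.

Lemma psi_scale x t : 0 <= x -> 0 <= t <= 1 -> psi (t * x) <= t * psi x.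
Proof.
move=> x0 /andP[t0 t1].
have p00 : psi 0 = 0 by rewrite psi_small// expr0n.
have [->|tn0] := eqVneq t 0; first by rewrite !mul0r p00.
have [->|tn1] := eqVneq t 1; first by rewrite !mul1r.
have t01 : 0 < t < 1 by rewrite !lt_neqAle eq_sym tn0 t0 tn1 t1.
by have := psi_convex x0 (lexx 0) t01; rewrite p00 !mulr0 !addr0.
Qed.

Lemma orlicz_Psi : orlicz_function Psi.
Proof.
have P0 (x : \bar R) : (0 <= x)%E -> (0 <= Psi x)%E.
  by case: x => [r| |] //=; rewrite !lee_fin; exact: psi_ge0.
split => //.
- by rewrite /= psi_small// expr0n.
- move=> [x| |] [y| |] //=; rewrite ?lee_fin// ?leey//.
  exact: psi_nondecreasing.
- move=> x y t x0 y0 t01; have /andP[t0 t1] := t01; have u0 : 0 < 1 - t by rewrite subr_gt0.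
  have nn (s : R) z : 0 < s -> (0 <= z)%E -> (s%:E * Psi z != -oo)%E.
    move=> s0 z0; rewrite gt_eqF//; apply: (@lt_le_trans _ _ 0%E) => //.
    by apply: mule_ge0; [rewrite lee_fin ltW|exact: P0].
  case: x x0 => [x| |] // x0; last first.
    by rewrite /= [X in (_ <= X + _)%E]gt0_muley ?lte_fin// addye ?leey ?nn.
  case: y y0 => [y| |] // y0; last first.
    by rewrite /= [X in (_ <= _ + X)%E]gt0_muley ?lte_fin// addey ?leey ?nn.
  by rewrite -!EFinM -EFinD /= lee_fin; apply: psi_convex.
- move=> x y t x0 y0 xy t01.
  by rewrite -!EFinM -EFinD lte_fin; exact: psi_strictly_convex.
- apply: cvg_EFin; first exact: nearW.
  apply/cvgrPdist_lt => e e0; exists (Num.min 1 e); first by rewrite /= lt_min ltr01.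
  move=> x /= + x0; rewrite sub0r normrN gtr0_norm// lt_min => /andP[x1 xe].
  rewrite sub0r normrN psi_small; last exact: ltW.
  rewrite ger0_norm ?exprn_ge0 ?(ltW x0)//; apply: le_lt_trans xe.
  by rewrite (exprS x 2) ler_piMr ?exprn_ile1// ltW.
- apply/cvgeyPge => A; exists (Num.max 1 A); split; first exact: num_real.
  move=> x; rewrite gt_max => /andP[x1 xA]; have x0 : 0 < x by exact: lt_trans x1.
  rewrite -EFinM lee_fin ler_pdivlMr//; apply: le_trans (psi_ge (ltW x0)).
  by rewrite (exprS x 2) mulrC ler_pM2l// expr2; nra.
Qed.

Lemma psi_measurable : measurable_fun setT psi.
Proof.
apply: (@measurable_fun_cvg _ (measurableTypeR R) R setT psiN) => [N|x _].
  apply: measurable_funD; first exact: measurable_funX.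
  apply: measurable_sum => n; apply: measurable_funM => //.
  by apply: measurable_maxr => //; exact: measurable_funB.
apply: cvg_near_cst; exists (Num.truncn x).+1 => // N /= h.
apply/esym/psiE; apply: le_trans (ltW (truncnS_gt x)) _; by rewrite ler_nat.
Qed.

(** Since [kink n.+1 = kink n ^ 4], the bound gains a factor [kink n ^ 6], more than
    [2 ^ (7 n) + 1]. Hence all earlier kinks together at most double the cube at [kink n]. *)
Lemma slope_sum n : \sum_(m < n) slope m <= kink n ^+ 2.
Proof.
elim: n => [|n ih]; first by rewrite big_ord0 sqr_ge0.
rewrite big_ord_recr /=; apply: le_trans (lerD ih (lexx _)) _.
have -> : kink n.+1 ^+ 2 = kink n ^+ 6 * kink n ^+ 2.
  by rewrite /kink -!exprM -exprD; congr (_ ^+ _); rewrite expnS; lia.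
rewrite /slope -{1}[kink n ^+ 2]mul1r -mulrDl ler_wpM2r ?sqr_ge0//.
have h : (7 * n + 1 <= 4 ^ n * 6)%N.
  by elim: n {ih} => // n; rewrite expnS; lia.
apply: (@le_trans _ _ (2 ^+ (7 * n + 1))).
  rewrite addn1 exprS mulr_natl (mulr2n (2 ^+ (7 * n))); apply: lerD => //.
  by apply: exprn_ege1; rewrite ler1n.
by rewrite /kink -exprM; apply: ler_weXn2l => //; rewrite ler1n.
Qed.

Lemma psi_kink n : psi (kink n) <= 2 * kink n ^+ 3.
Proof.
have k0 := kink_gt0 n.
pose N := maxn n (Num.truncn (kink n)).+1.
rewrite (@psiE N); last first.
  by apply: le_trans (ltW (truncnS_gt _)) _; rewrite ler_nat leq_maxr.
rewrite mulr_natl (mulr2n (kink n ^+ 3)) lerD2l.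
have -> : \sum_(m < N) slope m * Num.max 0 (kink n - kink m) =
    \sum_(m < n) slope m * Num.max 0 (kink n - kink m).
  rewrite (big_ord_widen N (fun m => slope m * Num.max 0 (kink n - kink m)) (leq_maxl _ _)).
  rewrite [RHS]big_mkcond; apply: eq_bigr => m _; case: ltnP => // nm.
  rewrite max_l ?mulr0// subr_le0 /kink ler_weXn2l ?ler1n// leq_exp2l//.
apply: (@le_trans _ _ ((\sum_(m < n) slope m) * kink n)).
  rewrite mulr_suml; apply: ler_sum => m _; rewrite ler_wpM2l ?slope_ge0//.
  by rewrite ge_max (ltW k0) gerBl ltW// kink_gt0.
by rewrite (exprSr _ 2) ler_wpM2r ?slope_sum// ltW.
Qed.

Lemma psi_2kink n : 2 ^+ (7 * n) * kink n ^+ 3 <= psi (2 * kink n).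
Proof.
have k0 := kink_gt0 n.
pose N := maxn n.+1 (Num.truncn (2 * kink n)).+1.
rewrite (@psiE N); last first.
  by apply: le_trans (ltW (truncnS_gt _)) _; rewrite ler_nat leq_maxr.
have nN : (n < N)%N by rewrite leq_maxl.
have e : 2 ^+ (7 * n) * kink n ^+ 3 = slope n * Num.max 0 (2 * kink n - kink n).
  have -> : 2 * kink n - kink n = kink n by ring.
  by rewrite max_r ?ltW// /slope -mulrA -exprSr.
rewrite e /psiN (bigD1 (Ordinal nN)) //= addrCA lerDl addr_ge0//.
  by rewrite exprn_ge0// mulr_ge0// ltW.
by apply: sumr_ge0 => m _; rewrite mulr_ge0 ?slope_ge0// le_max lexx.
Qed.

(* A kink below [x] costs at most [slope n * x * (x / kink n) `^ (2 + eps)]. *)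
Lemma psi_le_powR (eps : R) : 0 < eps -> exists2 B : R, 0 <= B &
  forall x, 0 <= x -> psi x <= B + B * x `^ (3 + eps).
Proof.
move=> e0; have ln2 : 0 < ln (2 : R) by rewrite ln_gt0// ltr1n.
(* From [(y / 4)^4 <= exp y] at [y = eps * 4 ^ n * ln 2], for which [exp y] is [kink n ^ eps]. *)
pose C := (4 / (eps * ln 2)) ^+ 4 : R.
have C0 : 0 <= C by rewrite exprn_ge0// divr_ge0// mulr_ge0// ltW.
(* Of the eight powers of [2 ^ n], seven absorb the factor in [slope n] and the eighth makes the sum
   over the kinks geometric. *)
have decay n : 2 ^+ (8 * n) <= C * kink n `^ eps.
  pose y : R := eps * ((4 ^ n)%:R * ln 2).
  have y0 : 0 <= y by rewrite !mulr_ge0// ltW.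
  have -> : kink n `^ eps = expR y.
    by rewrite /powR gt_eqF ?kink_gt0// /kink lnXn// /y mulr_natl.
  have h1 : (y / 4) ^+ 4 <= expR y.
    have -> : expR y = expR (y / 4) ^+ 4 by rewrite -expRM_natl; congr expR; field.
    rewrite lerXn2r ?nnegrE ?divr_ge0 ?expR_ge0//.
    by apply: le_trans (expR_ge1Dx _); rewrite lerDr.
  apply: le_trans (ler_wpM2l C0 h1); rewrite /C -exprMn /y.
  have -> : 4 / (eps * ln 2) * (eps * ((4 ^ n)%:R * ln 2) / 4) = (2 ^+ (2 * n) : R).
    rewrite natrX (_ : (4%:R : R) = 2 ^+ 2); last by rewrite expr2 -natrM.
    by rewrite -exprM; field; rewrite !gt_eqF.
  by rewrite -exprM ler_weXn2l ?ler1n//; lia.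
pose B := 1 + 2 * C.
exists B; first by rewrite addr_ge0// mulr_ge0.
move=> x x0; set X := x `^ (3 + eps).
have X0 : 0 <= X by exact: powR_ge0.
have cube : x ^+ 3 <= 1 + X.
  have [x1|x1] := leP x 1; first by rewrite ler_wpDr// exprn_ile1.
  rewrite /X powRD ?(gt_eqF (lt_trans ltr01 x1)) ?implybT//.
  have -> : x `^ 3 = x ^+ 3 by rewrite -powR_mulrn.
  have h : 1 <= x `^ eps by rewrite -(powRr0 x) ler_powR// ltW.
  by rewrite ler_wpDl// ler_peMr// exprn_ge0.
have term n : slope n * Num.max 0 (x - kink n) <= C * X * 2 ^- n.
  have k0 := kink_gt0 n.
  have p0 : 0 < (2 : R) ^+ n by rewrite exprn_gt0.
  have [xk|xk] := leP x (kink n).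
    rewrite max_l ?subr_le0// mulr0; apply: mulr_ge0 (mulr_ge0 C0 X0) _.
    by rewrite invr_ge0 ltW.
  have xp : 0 < x by exact: lt_trans k0 xk.
  have ke : 0 < kink n `^ eps by exact: powR_gt0.
  apply: (@le_trans _ _ (slope n * x)).
    by rewrite ler_wpM2l ?slope_ge0// ge_max x0 gerBl ltW.
  rewrite ler_pdivlMr//.
  have h1 : kink n ^+ 2 * x * kink n `^ eps <= X.
    rewrite /X powRD ?(gt_eqF xp) ?implybT//.
    have -> : x `^ 3 = x ^+ 3 by rewrite -powR_mulrn.
    apply: ler_pM; [by rewrite mulr_ge0// sqr_ge0|exact: ltW| |].
      by rewrite (exprSr x 2) ler_wpM2r// lerXn2r ?nnegrE ?(ltW k0)// ltW.
    by apply: ge0_ler_powR; rewrite ?nnegrE ?(ltW k0) ?(ltW e0)// ltW.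
  have h2 := ler_wpM2l C0 h1; apply: le_trans h2.
  have h3 := ler_wpM2r (mulr_ge0 (sqr_ge0 (kink n)) x0) (decay n).
  have -> : slope n * x * 2 ^+ n = 2 ^+ (8 * n) * (kink n ^+ 2 * x).
    rewrite /slope -[(8 * n)%N]/((1 + 7) * n)%N (mulnDl 1 7 n) mul1n (exprD 2 n (7 * n)).
    move: (2 ^+ (7 * n)) (2 ^+ n) (kink n) => a b c.
    ring.
  by apply: le_trans h3 _; rewrite le_eqVlt; apply/orP; left; apply/eqP; ring.
have geo N : \sum_(n < N) 2 ^- n <= 2 :> R.
  suff : \sum_(n < N) 2 ^- n = 2 - 2 * 2 ^- N :> R.
    by move=> ->; rewrite gerBl mulr_ge0// invr_ge0 exprn_ge0.
  elim: N => [|N ih]; first by rewrite big_ord0 expr0 invr1; ring.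
  by rewrite big_ord_recr /= ih exprS; field; rewrite expf_neq0.
apply: (@le_trans _ _ (1 + X + \sum_(n < (Num.truncn x).+1) C * X * 2 ^- n)).
  by apply: lerD cube _; apply: ler_sum => n _; exact: term.
rewrite -mulr_sumr; have h := ler_wpM2l (mulr_ge0 C0 X0) (geo (Num.truncn x).+1).
have : 0 <= C * X by exact: mulr_ge0.
by rewrite /B; move: h; move: (\sum_(n < _) _) => s; nra.
Qed.

End OrliczFunction.

(** * The inclusions between the Hardy spaces and the Hardy-Orlicz space *)

Section Inclusions.
Variable R : realType.
Notation mu := (@lebesgue_measure R).
Implicit Types (f : R[i] -> R[i]) (p t r : R).

Let mD : measurable (@circ R : set (measurableTypeR R)).
Proof. exact: measurable_itv. Qed.

Lemma hardy_le1 p f : 1 <= p -> hardy p f -> hardy 1 f.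
Proof.
move=> p1; have p0 : 0 < p by exact: lt_le_trans p1.
move=> /(hardyP _ p0)[fa [A A0 hA]]; apply/(hardyP _ ltr01); split => //.
exists (1 + A); first by rewrite addr_ge0.
move=> r r01; have r01' : 0 <= r < 1 by case/andP: r01 => /ltW -> ->.
have i1 := pmean_itg fa r01' (ltW p0).
have i2 := pmean_itg fa r01' (@ler01 R).
apply: le_trans (lerD (lexx 1) (hA r r01)).
rewrite -[X in _ <= X + _]imean_cst -(imeanD (rintg_cst _ _ _) i1).
apply: (le_imean i2 (rintgD (rintg_cst _ _ _) i1)) => t _.
rewrite powRr1 ?normc_ge0//.
by have := weak_jensen p1 ltr01 (normc_ge0 (f (r%:C * expi t))); rewrite powR1 mul1r.
Qed.

Lemma circle_measurable_normc f : circle_measurable f ->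
  measurable_fun (@circ R) (fun t => normc (f (expi t))).
Proof.
move=> [m1 m2].
have -> : (fun t => normc (f (expi t))) =
    (fun t => Num.sqrt (complex.Re (f (expi t)) ^+ 2 + complex.Im (f (expi t)) ^+ 2)).
  by apply/funext => t; rewrite normcE.
apply: (measurableT_comp (f := @Num.sqrt R)).
  by apply: continuous_measurable_fun; exact: sqrt_continuous.
by apply: measurable_funD; exact: measurable_funX.
Qed.

Lemma psi_circ_measurable (h : R -> R) : measurable_fun (@circ R) h ->
  measurable_fun (@circ R) (fun t => (psi (h t))%:E).
Proof. by move=> mh; apply/measurable_EFinP; by apply: (measurableT_comp (f := @psi R)) => //; exact: psi_measurable. Qed.

Lemma modular_le (C K : R) f :
  (\int[mu]_(t in @circ R) (psi (normc (f (expi t)) / C))%:E <= (2 * pi * K)%:E)%E <->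
  (modular (@Psi R) C f <= K%:E)%E.
Proof.
have p := twopi_gt0 R.
rewrite /modular /circle_integral /= -/(@circ R).
by rewrite lee_pdivrMl// EFinM.
Qed.

Lemma cvg_powR_seq (y : nat -> R) (l p : R) : 0 < p -> (forall k, 0 <= y k) -> 0 <= l ->
  y @ \oo --> l -> (fun k => y k `^ p) @ \oo --> l `^ p.
Proof.
move=> p0 y0; rewrite le_eqVlt => /orP[/eqP <-|l0] c.
  rewrite powR0 ?gt_eqF//; apply/cvgrPdist_lt => e e0.
  have q0 : 0 < e `^ p^-1 by exact: powR_gt0.
  move/cvgrPdist_lt : c => /(_ _ q0); apply: filterS => k.
  rewrite !sub0r !normrN !ger0_norm ?powR_ge0// => h.
  have -> : e = (e `^ p^-1) `^ p by rewrite -powRrM mulVf ?gt_eqF// powRr1// ltW.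
  by apply: gt0_ltr_powR; rewrite ?nnegrE// ltW.
have -> : l `^ p = expR (p * ln l) by rewrite /powR gt_eqF.
have cl : (fun k => expR (p * ln (y k))) @ \oo --> expR (p * ln l).
  apply: (continuous_cvg _ (@continuous_expR R _)).
  apply: cvgM; first exact: cvg_cst.
  exact: (continuous_cvg _ (continuous_ln l0)).
apply: cvg_trans cl; apply: near_eq_cvg.
move/cvgrPdist_lt : c => /(_ _ l0); apply: filterS => k h.
rewrite /powR gt_eqF//; move: h; rewrite ltr_norml => /andP[_]; lra.
Qed.

(** Fatou's lemma along the radii [zrho] carries the bound on the means over to the boundary
    function, and [psi] is dominated by the power. *)
Lemma hardy_sub_orlicz (eps : R) : 0 < eps -> hardy (3 + eps) `<=` hardy_orlicz (@Psi R).
Proof.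
move=> e0 f fh; have p1 : 1 <= 3 + eps by lra.
have p0 : 0 < 3 + eps by exact: lt_le_trans p1.
have fh1 := hardy_le1 p1 fh.
have [fa [A A0 hA]] := (hardyP f p0).1 fh.
have mb := boundary_measurable fa; have mn := circle_measurable_normc mb.
split => //; split => //; exists 1 => //.
have [B B0 hB] := psi_le_powR e0.
have mpow : measurable_fun (@circ R) (fun t => normc (boundary f (expi t)) `^ (3 + eps)).
  exact: measurableT_comp (measurable_powR _) mn.
have z01 k : 0 <= zrho R k < 1 by have /andP[/ltW -> ->] := zrho01 R k.
have F : (\int[mu]_(t in @circ R) (normc (boundary f (expi t)) `^ (3 + eps))%:E <= (2 * pi * A)%:E)%E.
  apply: (@fatou_imean R (fun k t => normc (f ((zrho R k)%:C * expi t)) `^ (3 + eps)) A) => //.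
  - move=> k; apply: measurableT_comp (measurable_powR _) _.
    by apply: continuous_measurable_fun; exact: dil_cont.
  - by move=> k t; exact: powR_ge0.
  - by move=> k; apply: pmean_itg => //; exact: ltW.
  - by move=> k; exact: hA (zrho01 R k).
  - by move=> t _; exact: powR_ge0.
  - apply: (@filterS _ _ (ae_filter_ringOfSetsType mu)) (fatou_hardy1 fh1) => t h Dt.
    have c : (fun k => normc (f ((zrho R k)%:C * expi t))) @ \oo --> normc (boundary f (expi t)).
      apply/cvgrPdist_lt => e e0'; apply: filterS (rlim_zrho (h Dt) e0') => k.
      by apply: le_lt_trans; rewrite distrC; exact: normc_dist.
    by apply: (cvg_powR_seq p0 _ _ c) => [k|]; exact: normc_ge0.
apply: (@le_lt_trans _ _ (B + B * A)%:E); last exact: ltry.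
apply/modular_le.
pose P t := normc (boundary f (expi t)) `^ (3 + eps).
have ip : itg P.
  apply/integrableP; split; first exact/measurable_EFinP.
  apply: le_lt_trans (ltry (2 * pi * A)); apply: le_trans F.
  rewrite le_eqVlt; apply/orP; left; apply/eqP; apply: eq_integral => t _.
  by rewrite gee0_abs// lee_fin powR_ge0.
have PA : imean P <= A.
  by move: F; rewrite (eint_itg ip) lee_fin ler_pM2l// twopi_gt0.
have iB : itg (fun t => B + B * P t) := rintgD (rintg_cst _ _ B) (rintgZ B ip).
apply: (@le_trans _ _ (\int[mu]_(t in @circ R) (B + B * P t)%:E)%E).
  apply: ge0_le_integral => //.
  - by move=> t _; rewrite lee_fin psi_ge0// divr1 normc_ge0.
  - exact: (psi_circ_measurable (measurable_funM mn (measurable_cst _))).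
  - by apply/measurable_EFinP; apply: measurable_funD => //; exact: measurable_funM.
  - by move=> t _; rewrite lee_fin divr1 hB// normc_ge0.
rewrite (eint_itg iB) (imeanD (rintg_cst _ _ B) (rintgZ B ip)) (imeanZ _ ip) imean_cst.
by rewrite lee_fin ler_wpM2l ?(ltW (twopi_gt0 R))// lerD2l ler_wpM2l.
Qed.

Lemma orlicz_sub_hardy3 : hardy_orlicz (@Psi R) `<=` hardy 3.
Proof.
move=> f [f1 [mb [C C0 hC]]]; have mn := circle_measurable_normc mb.
have [fa _] := (hardyP f ltr01).1 f1.
have ib : itg (fun t => normc (boundary f (expi t)) ^+ 3).
  apply/integrableP; split; first by apply/measurable_EFinP; exact: measurable_funX.
  have C3 : 0 < C ^+ 3 by rewrite exprn_gt0.
  apply: (@le_lt_trans _ _ (\int[mu]_(t in @circ R) (C ^+ 3 * psi (normc (boundary f (expi t)) / C))%:E)%E).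
    apply: ge0_le_integral => //.
    - by apply/measurable_EFinP; apply: measurableT_comp => //; exact: measurable_funX.
    - apply/measurable_EFinP; apply: measurable_funM => //.
      apply: (measurableT_comp (f := @psi R)); first exact: psi_measurable.
      exact: measurable_funM.
    - move=> t _; rewrite lee_fin ger0_norm ?exprn_ge0 ?normc_ge0//.
      have d0 : 0 <= normc (boundary f (expi t)) / C by rewrite divr_ge0 ?normc_ge0 ?ltW.
      apply: le_trans (ler_wpM2l (ltW C3) (psi_ge d0)).
      by rewrite -exprMn mulrC divfK ?gt_eqF.
  under eq_integral do rewrite EFinM.
  rewrite ge0_integralZl//; last 3 first.
  - exact: (psi_circ_measurable (measurable_funM mn (measurable_cst _))).
  - by move=> t _; rewrite lee_fin psi_ge0// divr_ge0 ?normc_ge0 ?ltW.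
  - by rewrite lee_fin ltW.
  apply: lte_mul_pinfty => //; first by rewrite lee_fin ltW.
  have p := twopi_gt0 R; have p' : 0 < (2 * pi)^-1 :> R by rewrite invr_gt0.
  move: hC; rewrite /modular /circle_integral /= -/(@circ R).
  case: (integral _ _ _) => // [r _|]; first exact: ltry.
  by rewrite gt0_muley ?lte_fin.
have [B hB] := smirnov_cube f1 mn ib.
apply/(hardyP _ (ltr0n _ 3)); split => //; exists (Num.max 0 B); first by rewrite le_max lexx.
move=> r r01; apply: (@le_trans _ _ B); last by rewrite le_max lexx orbT.
apply: le_trans (hB r r01); rewrite le_eqVlt; apply/orP; left; apply/eqP.
by apply: eq_imean => t _; rewrite -powR_mulrn// normc_ge0.
Qed.

End Inclusions.

(** * Failure of compactness on the Hardy-Orlicz space *)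

Section NonCompactness.
Variable R : realType.
Notation mu := (@lebesgue_measure R).
Implicit Types (z w : R[i]) (t : R) (n m : nat).

(** The binary logarithm of [2 * kink n ^ 3], an upper bound for [psi] at [kink n]. It is kept as a
    natural number because it is the parameter [k] of [symbol_contact]. *)
Definition peak_exp n : nat := (3 * 4 ^ n).+1.

Definition peak_width n : R := 2 ^- peak_exp n.

(* A square of a normalized Cauchy kernel, so that its modulus is a multiple of
   the Poisson kernel at [1 - peak_width n]. *)
Definition peak n z : R[i] :=
  (kink R n)%:C * ((peak_width n)%:C * (1 - (1 - peak_width n)%:C * z)^-1) ^+ 2.

Let mD : measurable (@circ R : set (measurableTypeR R)).
Proof. exact: measurable_itv. Qed.

Lemma peak_width01 n : 0 < peak_width n < 1.
Proof.
by rewrite /peak_width invr_gt0 exprn_gt0//= invf_lt1 ?exprn_gt0// exprn_egt1 ?ltr1n.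
Qed.

Lemma kink_cube n : 2 * kink R n ^+ 3 = (peak_width n)^-1.
Proof. by rewrite /kink /peak_width invrK /peak_exp (exprS 2 (3 * 4 ^ n)) (mulnC 3) exprM. Qed.

Lemma peak_den_ge n z : normc z <= 1 ->
  peak_width n <= normc (1 - (1 - peak_width n)%:C * z).
Proof.
move=> z1; have /andP[d0 d1] := peak_width01 n.
have := normcB_ge 1 ((1 - peak_width n)%:C * z).
rewrite normc1 normc_realM ger0_norm; last by rewrite subr_ge0 ltW.
apply: le_trans; rewrite lerBrDl -lerBrDr ler_piMr// subr_ge0 ltW//.
Qed.

Lemma normc_peak n z : normc (peak n z) =
  kink R n * (peak_width n / normc (1 - (1 - peak_width n)%:C * z)) ^+ 2.
Proof.
have /andP[d0 d1] := peak_width01 n.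
by rewrite /peak normc_realM normcX normc_realM normcV !ger0_norm// ltW// kink_gt0.
Qed.

Lemma normc_peak_le n z : normc z <= 1 -> normc (peak n z) <= kink R n.
Proof.
move=> z1; have /andP[d0 d1] := peak_width01 n.
have h := peak_den_ge n z1; have q0 := lt_le_trans d0 h.
rewrite normc_peak ler_piMr//; first by rewrite ltW// kink_gt0.
by apply: exprn_ile1; [exact: divr_ge0 (ltW d0) (ltW q0)|rewrite ler_pdivrMr// mul1r].
Qed.

Lemma peak_holo n z : normc z <= 1 -> holo (peak n) z.
Proof.
move=> z1; have /andP[d0 d1] := peak_width01 n.
have n0 : 1 - (1 - peak_width n)%:C * z != 0.
  by rewrite -normc_gt0; exact: lt_le_trans d0 (peak_den_ge n z1).
have hV : holo (fun z => (1 - (1 - peak_width n)%:C * z)^-1) z.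
  apply: (holoV (f := fun z => 1 - (1 - peak_width n)%:C * z)) n0 _.
  exact: (holoB (holo_cst 1 z) (holoM (holo_cst _ z) (holo_id z))).
exact: (holoM (holo_cst _ z) (holoX 2 (holoM (holo_cst _ z) hV))).
Qed.

Lemma peak_analytic n : analytic_on_disk (peak n).
Proof. by apply/analytic_holo => z z1; apply: peak_holo; exact: ltW. Qed.

Lemma peak_rlim n (v : R[i] -> R[i]) t :
  (forall z, normc z <= 1 -> normc (v z) <= 1) ->
  (forall e : R, 0 < e -> exists2 d : R, 0 < d & forall w, normc w <= 1 ->
     normc (w - expi t) < d -> normc (v w - v (expi t)) < e) ->
  rlim (peak n \o v) t (peak n (v (expi t))).
Proof.
move=> v1 vc e e0; have v1t : normc (v (expi t)) <= 1 by apply: v1; rewrite normc_expi.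
have [d d0 hd] := holo_ccont (peak_holo n v1t) e0.
have [d' d'0 hd'] := vc d d0.
exists (Num.min 1 d'); first by rewrite lt_min ltr01.
move=> r /andP[r1 r2]; have r0 : 0 <= r.
  by apply: ltW; apply: le_lt_trans r1; rewrite subr_ge0 ge_min lexx.
have rd : 1 - r < d'.
  by rewrite ltrBlDr -ltrBlDl; apply: le_lt_trans r1; rewrite lerB// ge_min lexx orbT.
apply: hd; apply: hd'; first by rewrite normc_realM normc_expi mulr1 ger0_norm// ltW.
have -> : r%:C * expi t - expi t = (r - 1)%:C * expi t.
  by rewrite (rmorphB (real_complex R) r 1) rmorph1 mulrBl mul1r.
by rewrite normc_realM normc_expi mulr1 distrC ger0_norm// subr_ge0 ltW.
Qed.

Lemma boundary_peak n t : boundary (peak n) (expi t) = peak n (expi t).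
Proof.
by apply: boundary_rlim; apply: (@peak_rlim n id) => // e e0; exists e.
Qed.

(** With [d] the width and [q] the modulus of the denominator, convexity gives [psi] at most
    [(d / q)^2 * psi (kink n)], hence at most [d / q^2]. The Poisson kernel at [1 - d] is
    [d (2 - d) / q^2], and its mean 1 bounds the modular. *)
Lemma psi_peak n t : psi (normc (peak n (expi t))) <=
  pk ((1 - peak_width n)%:C : R[i]) t.
Proof.
have /andP[d0 d1] := peak_width01 n; set d := peak_width n in d0 d1 *.
have e1 : normc (expi t) <= 1 :> R by rewrite normc_expi.
have h := peak_den_ge n e1; rewrite -/d in h; have q0 := lt_le_trans d0 h.
have qE : normc (1 - (1 - d)%:C * expi t) = normc (expi t - (1 - d)%:C) :> R.
  transitivity (normc (conjc (expi t) * (expi t - (1 - d)%:C))); last first.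
    by rewrite normcM normc_conj normc_expi mul1r.
  rewrite mulrBr [conjc _ * expi t]mulrC expi_mul_conj mulrC -[RHS]normc_conj; congr normc.
  by apply: complexP; rewrite ?(Re_conj, Im_conj, ReD, ImD, ReN, ImN, ReM, ImM) /=; ring.
rewrite normc_peak -/d mulrC.
set q := normc (1 - _) in h q0 qE *.
have s01 : 0 <= (d / q) ^+ 2 <= 1.
  rewrite sqr_ge0; apply: exprn_ile1; first exact: divr_ge0 (ltW d0) (ltW q0).
  by rewrite ler_pdivrMr// mul1r.
apply: le_trans (psi_scale (ltW (kink_gt0 R n)) s01) _.
have /andP[s0 _] := s01.
apply: le_trans (ler_wpM2l s0 (psi_kink R n)) _; rewrite kink_cube -/d.
rewrite /pk -qE normc_real ger0_norm; last by rewrite subr_ge0 ltW.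
have -> : (d / q) ^+ 2 / d = d / q ^+ 2 by field; rewrite !gt_eqF.
rewrite ler_wpM2r ?invr_ge0 ?sqr_ge0//; nra.
Qed.

Lemma modular_peak n : (modular (@Psi R) 1 (boundary (peak n)) <= 1%:E)%E.
Proof.
have /andP[d0 d1] := peak_width01 n.
have z1 : normc ((1 - peak_width n)%:C : R[i]) < 1.
  by rewrite normc_real ger0_norm ?subr_ge0 ?(ltW d1)// gtrBl.
have mb := circle_measurable_normc (boundary_measurable (@peak_analytic n)).
apply/modular_le.
apply: (@le_trans _ _ (\int[mu]_(t in @circ R) (pk ((1 - peak_width n)%:C : R[i]) t)%:E)%E); last first.
  by rewrite (eint_itg (pk_itg z1)) imean_pk.
apply: ge0_le_integral => //.
- by move=> t _; rewrite lee_fin psi_ge0// divr1 normc_ge0.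
- exact: (psi_circ_measurable (measurable_funM mb (measurable_cst _))).
- by case/integrableP : (pk_itg z1).
- by move=> t _; rewrite lee_fin divr1 boundary_peak psi_peak.
Qed.

Lemma peak_hardy_orlicz n : hardy_orlicz (@Psi R) (peak n).
Proof.
split.
  apply/(hardyP _ ltr01); split; first exact: peak_analytic.
  exists (kink R n); first by rewrite ltW// kink_gt0.
  move=> r r01; have r01' : 0 <= r < 1 by case/andP: r01 => /ltW -> ->.
  rewrite -[leRHS]imean_cst.
  apply: (le_imean (pmean_itg (@peak_analytic n) r01' (@ler01 R)) (rintg_cst _ _ _)) => t _.
  rewrite powRr1 ?normc_ge0//; apply: normc_peak_le.
  by apply: ltW; exact: disk_realM.
split; first exact: boundary_measurable (@peak_analytic n).
exists 1 => //; exact: le_lt_trans (modular_peak n) (ltry _).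
Qed.

Lemma peak_norm_le1 n : (hardy_orlicz_norm (@Psi R) (peak n) <= 1%:E)%E.
Proof. by apply: ereal_inf_lbound; exists 1 => //; split => //; exact: modular_peak. Qed.

Lemma peak_lower n w : normc w <= 1 -> normc (1 - w) <= peak_width n ->
  kink R n / 4 <= normc (peak n w).
Proof.
move=> w1 h; have /andP[d0 d1] := peak_width01 n.
have q0 := lt_le_trans d0 (peak_den_ge n w1).
rewrite normc_peak ler_wpM2l//; first by rewrite ltW// kink_gt0.
have q2 : normc (1 - (1 - peak_width n)%:C * w) <= 2 * peak_width n.
  have -> : 1 - (1 - peak_width n)%:C * w = (1 - w) + (peak_width n)%:C * w.
    by rewrite (rmorphB (real_complex R) 1) rmorph1; ring.
  apply: le_trans (normcD _ _) _; rewrite normc_realM (ger0_norm (ltW d0)).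
  have : peak_width n * normc w <= peak_width n by rewrite ler_piMr// ltW.
  by move: h; lra.
move: (peak_width n) (normc (1 - _)) d0 q0 q2 => d q d0 q0 q2.
have -> : 4^-1 = (2^-1) ^+ 2 :> R by field.
have h2 : 0 <= 2^-1 :> R by rewrite invr_ge0.
rewrite lerXn2r ?nnegrE// ?(divr_ge0 (ltW d0) (ltW q0))//.
by rewrite ler_pdivlMr//; lra.
Qed.

Lemma kink_step n m : (n < m)%N -> 8 * kink R n <= kink R m.
Proof.
move=> nm; rewrite /kink (_ : 8 = 2 ^+ 3) -?exprD; last by rewrite -natrX.
rewrite ler_weXn2l ?ler1n//.
have : (4 ^ n.+1 <= 4 ^ m)%N by rewrite leq_exp2l.
have q : (0 < 4 ^ n)%N by rewrite expn_gt0.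
by rewrite expnS; lia.
Qed.

(** The width cancels the cube of the kink and leaves [2 ^ (7 m)] over four times the cube of
    [peak_exp m], which is at most [2 ^ (6 m + 6)]. As [2 pi < 8], it suffices that
    [6 m + 11 <= 7 m]. *)
Lemma peak_mass m : (12 <= m)%N ->
  2 * pi < peak_width m / (2 * (peak_exp m)%:R ^+ 3) * psi (2 * kink R m).
Proof.
move=> m12; have /andP[d0 d1] := peak_width01 m.
have K0 : 0 < (peak_exp m)%:R :> R by rewrite ltr0n.
have pi4 : 2 * pi < 8 :> R by have := pihalf_lt2 R; lra.
apply: lt_le_trans pi4 _.
have a0 : 0 <= peak_width m / (2 * (peak_exp m)%:R ^+ 3).
  by rewrite divr_ge0 ?(ltW d0)// mulr_ge0// exprn_ge0// ltW.
apply: le_trans (ler_wpM2l a0 (psi_2kink R m)).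
have -> : peak_width m / (2 * (peak_exp m)%:R ^+ 3) * (2 ^+ (7 * m) * kink R m ^+ 3) =
    2 ^+ (7 * m) / (4 * (peak_exp m)%:R ^+ 3).
  have -> : kink R m ^+ 3 = (2 * peak_width m)^-1.
    by rewrite invfM -kink_cube mulKf.
  by field; rewrite !gt_eqF.
rewrite ler_pdivlMr ?mulr_gt0 ?exprn_gt0//.
have h1 : (peak_exp m <= 2 ^ (2 * m + 2))%N.
  have q : (0 < 4 ^ m)%N by rewrite expn_gt0.
  rewrite /peak_exp expnD expnM.
  by rewrite (_ : 2 ^ 2 = 4)%N//; lia.
have h2 : (peak_exp m)%:R ^+ 3 <= 2 ^+ (6 * m + 6) :> R.
  rewrite (_ : (6 * m + 6 = (2 * m + 2) * 3)%N); last by lia.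
  by rewrite exprM lerXn2r ?nnegrE ?exprn_ge0// -natrX ler_nat.
have e : 8 * (4 * 2 ^+ (6 * m + 6)) = 2 ^+ (6 * m + 11) :> R.
  have -> : (6 * m + 11 = (6 * m + 6) + 5)%N by lia.
  by rewrite (exprD 2 (6 * m + 6) 5); move: (2 ^+ (6 * m + 6)) => x; ring.
apply: (@le_trans _ _ (8 * (4 * 2 ^+ (6 * m + 6)))).
  by rewrite !ler_wpM2l.
by rewrite e ler_weXn2l ?ler1n//; lia.
Qed.

Theorem noncompact_symbol :
  ~ compact_composition (hardy_orlicz (@Psi R)) (hardy_orlicz_norm (@Psi R)) (@symbol R).
Proof.
have half_le (p q k : R) : p <= 2^-1 * q + (1 - 2^-1) * k -> 2 * p <= q + k by lra.
have sum_le (p q k : R) : k / 8 <= p + q -> 2 * k <= 2^-1 * (32 * p) + (1 - 2^-1) * (32 * q).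
  by lra.
have area (p x : R) : 2 * x * p <= 2 * pi + 2 * pi -> 2 * pi < p * x -> False by nra.
move=> /(_ peak peak_hardy_orlicz (ex_intro _ 1 peak_norm_le1))[s [g [smono [g1 _] lim]]].
have [ga _] := (hardyP g ltr01).1 g1.
pose D n := (peak (s n) \o @symbol R) \- g.
have Da n : analytic_on_disk (D n).
  apply/analytic_holo => z z1; apply: (holoB (f := peak (s n) \o @symbol R)).
    exact: ((analytic_holo _).1 (analytic_comp (symbol_self_map R) (@peak_analytic (s n))) z z1).
  exact: ((analytic_holo _).1 ga z z1).
pose b n t := normc (boundary (D n) (expi t)).
have mb n : measurable_fun (@circ R) (b n).
  exact: circle_measurable_normc (boundary_measurable (Da n)).
have b0 n t : 0 <= b n t by exact: normc_ge0.
pose E n t := psi (32 * b n t).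
have mE n : measurable_fun (@circ R) (fun t => (E n t)%:E).
  exact: (psi_circ_measurable (measurable_funM (measurable_cst _) (mb n))).
have E0 n t : (0 <= (E n t)%:E)%E by rewrite lee_fin psi_ge0// mulr_ge0.
(* A norm below [1 / 32] provides an admissible constant [C < 1 / 32], so the modular bound holds
   with the factor 32 inside [psi]. *)
have [N hN] : exists N, forall n, (N <= n)%N ->
    (\int[mu]_(t in @circ R) (E n t)%:E <= (2 * pi)%:E)%E.
  have c32 : (0 < (32^-1)%:E :> \bar R)%E by rewrite lte_fin invr_gt0.
  have : \forall n \near \oo, (hardy_orlicz_norm (@Psi R) (D n) < (32^-1)%:E)%E.
    have op := @open_ereal_lt' R 0%E (32^-1)%:E c32.
    exact: (lim _ op).
  move=> [N _ hN]; exists N => n Nn.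
  have /ereal_inf_lt[_ [C [C0 hC] <-]] := hN n Nn; rewrite lte_fin => C32.
  move/modular_le : hC; rewrite mulr1; apply: le_trans.
  apply: ge0_le_integral => //.
  - exact: mE.
  - apply: (@psi_circ_measurable R (fun t => b n t / C)).
    exact: measurable_funM (mb n) (measurable_cst _).
  - move=> t _; rewrite lee_fin; apply: psi_nondecreasing; first by rewrite mulr_ge0.
    by rewrite mulrC ler_wpM2l// -[leLHS]invrK lef_pV2 ?posrE ?invr_gt0// ltW.
have rl n : {ae mu, forall t, @circ R t ->
    boundary (D n) (expi t) = peak (s n) (symbol (expi t)) - boundary g (expi t)}.
  apply: (@filterS _ _ (ae_filter_ringOfSetsType mu)) (fatou_hardy1 g1) => t h Dt.
  apply: boundary_rlim; have c := @peak_rlim (s n) (@symbol R) t (@symbol_le1 R).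
  have e1 : normc (expi t) <= 1 :> R by rewrite normc_expi.
  have {}c := c (fun e e0 => symbol_cont e1 e0).
  exact: rlimB c (h Dt).
have sge n : (n <= s n)%N.
  by elim: n => // n ih; apply: leq_ltn_trans ih _; exact: smono.
(* Two terms of the convergent subsequence are compared, the later one beyond the threshold 12 of
   [peak_mass]; strict monotonicity of [s] separates the kinks. *)
pose m' := maxn N.+1 12; pose m := s m'; pose n := s N.
have m12 : (12 <= m)%N by apply: leq_trans (sge m'); exact: leq_maxr.
have nm : (n < m)%N by apply: smono; exact: leq_maxl.
have /andP[d0 d1] := peak_width01 m.
have K1 : 1 <= (peak_exp m)%:R :> R by rewrite ler1n.
pose a : R := peak_width m / (2 * (peak_exp m)%:R ^+ 3).
have K3 : 1 <= (peak_exp m)%:R ^+ 3 :> R by exact: exprn_ege1.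
have a0 : 0 <= a by rewrite /a divr_ge0 ?(ltW d0)// mulr_ge0// (le_trans ler01).
have a1 : a <= 1.
  by rewrite /a ler_pdivrMr ?mul1r; lra.
have Ecirc : `[0, a]%classic `<=` @circ R.
  move=> t; rewrite /circ /= !in_itv /= => /andP[-> h] /=.
  by have := pi_ge2 R; lra.
have mEa : measurable (`[0, a]%classic : set (measurableTypeR R)) by exact: measurable_itv.
have lower : {ae mu, forall t, `[0, a]%classic t ->
    ((2 * psi (2 * kink R m))%:E <= (E m' t)%:E + (E N t)%:E)%E}.
  apply: (@filterS2 _ _ (ae_filter_ringOfSetsType mu)) (rl m') (rl N) => t h1 h2 ta.
  have Dt := Ecirc _ ta; have {}h1 := h1 Dt; have {}h2 := h2 Dt.
  have w1 : normc (symbol (expi t)) <= 1 :> R by apply: symbol_le1; rewrite normc_expi.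
  have near1 : normc (1 - symbol (expi t)) <= peak_width m.
    apply: symbol_contact; last by move: ta; rewrite /= in_itv.
    by rewrite /peak_exp ltnS muln_gt0 expn_gt0.
  have lo := peak_lower w1 near1; have up := normc_peak_le n w1.
  have st := kink_step nm; have km := kink_gt0 R m.
  (* On the arc the peak of index [m] is at least a quarter of its kink and the other one at most an
     eighth of it. Halving by midpoint convexity and the factor 32 turn [kink / 8] into [2 * kink],
     where [psi] has already gained [2 ^ (7 m)]. *)
  have df : kink R m / 8 <= b m' t + b N t.
    apply: (@le_trans _ _ (normc (peak m (symbol (expi t)) - peak n (symbol (expi t))))).
      have := normcB_ge (peak m (symbol (expi t))) (peak n (symbol (expi t))).
      by move: lo up st km; lra.
    have -> : peak m (symbol (expi t)) - peak n (symbol (expi t)) =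
        boundary (D m') (expi t) - boundary (D N) (expi t).
      by rewrite h1 h2 opprB addrA subrK.
    exact: normcB.
  have half : 0 < (2^-1 : R) < 1 by rewrite invr_gt0 ltr0n invf_lt1// ltr1n.
  have x0 k : 0 <= 32 * b k t by rewrite mulr_ge0.
  have cv := psi_convex (x0 m') (x0 N) half.
  have mo : psi (2 * kink R m) <= psi (2^-1 * (32 * b m' t) + (1 - 2^-1) * (32 * b N t)).
    apply: psi_nondecreasing; first by rewrite mulr_ge0// ltW.
    exact: sum_le.
  by rewrite -EFinD lee_fin; apply: half_le; exact: le_trans mo cv.
have i1 : (\int[mu]_(t in `[0%R, a]%classic) (2 * psi (2 * kink R m))%:E <=
    \int[mu]_(t in @circ R) ((E m' t)%:E + (E N t)%:E))%E.
  apply: (@le_trans _ _ (\int[mu]_(t in `[0%R, a]%classic) ((E m' t)%:E + (E N t)%:E))%E).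
    apply: ae_ge0_le_integral => //.
    - by move=> t _; rewrite lee_fin mulr_ge0// psi_ge0// mulr_ge0// ltW// kink_gt0.
    - by move=> t _; exact: adde_ge0.
    - exact: (measurable_funS mD Ecirc (emeasurable_funD (mE m') (mE N))).
  apply: ge0_subset_integral => //; first exact: emeasurable_funD (mE m') (mE N).
  by move=> t _; exact: adde_ge0.
rewrite integral_cst// in i1.
rewrite (ge0_integralD _ mD (fun t _ => E0 m' t) (mE m') (fun t _ => E0 N t) (mE N)) in i1.
have i2 := le_trans i1 (leeD (hN m' _) (hN N (leqnn N))).
have {}i2 := i2 (leq_trans (leqnSn N) (leq_maxl _ _)).
have mass := peak_mass m12; rewrite -/a in mass.
have ap : 0 < a.
  by rewrite divr_gt0// mulr_gt0// (lt_le_trans ltr01).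
have me : mu (`[0, a]%classic : set R) = a%:E.
  by rewrite lebesgue_measure_itv /= lte_fin ap -EFinB subr0.
have {}i2 : ((2 * psi (2 * kink R m))%:E * a%:E <= (2 * pi)%:E + (2 * pi)%:E)%E.
  by rewrite -me; exact: i2.
by move: i2; rewrite -EFinM -EFinD lee_fin => /area; apply.
Qed.

End NonCompactness.

Theorem corollary5p3 (R : realType) :
  exists Psi : \bar R -> \bar R,
    [/\ orlicz_function Psi,
        forall eps : R, 0 < eps -> hardy (3 + eps) `<=` hardy_orlicz Psi /\ hardy_orlicz Psi `<=` hardy 3 &
        exists phi : R[i] -> R[i],
          [/\ self_map phi,
              compact_composition (hardy 3) (hardy_norm 3) phi,
              forall eps : R, 0 < eps ->
                compact_composition (hardy (3 + eps)) (hardy_norm (3 + eps)) phi &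
              ~ compact_composition (hardy_orlicz Psi) (hardy_orlicz_norm Psi) phi]].
Proof.
have p3 (eps : R) : 0 < eps -> 1 <= 3 + eps by lra.
exists (@Psi R); split; first exact: orlicz_Psi.
  move=> eps e0; split; first exact: hardy_sub_orlicz.
  exact: orlicz_sub_hardy3.
exists (@symbol R); split.
- exact: symbol_self_map.
- by apply: compact_hardy_symbol; rewrite ler1n.
- by move=> eps /p3 e0; exact: compact_hardy_symbol.
- exact: noncompact_symbol.
Qed.
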